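(* Let $\Gamma$ be a countable discrete group and $1\le p\le\infty$. The map $$w:\mathcal S_p\otimes_\pi\mathcal S_\infty\to\mathcal S_p\otimes_\varepsilon\mathcal S_\infty,\qquad w(S\otimes T):=\sum_{s,t\in\Gamma}p_sSp_t\otimes\pi(\lambda_s)T\pi(\lambda_{t^{-1}}),$$ is a contraction.
   Context: $\mathcal S_p=\mathcal S_p(\ell^2(\Gamma))$ is the Schatten $p$-ideal for $1\le p<\infty$ and $\mathcal S_\infty=B(\ell^2(\Gamma))$ with the operator norm. $\otimes_\pi$ and $\otimes_\varepsilon$ denote the projective and the injective tensor products of Banach spaces. $\{e_\gamma\}_{\gamma\in\Gamma}$ is the canonical orthonormal basis of $\ell^2(\Gamma)$, $p_s$ is the rank-one projection onto $\mathbb Ce_s$, and $\pi(\lambda_\gamma)$ is the unitary of left translation by $\gamma$ ($\pi(\lambda_\gamma)e_s=e_{\gamma s}$). The sum defining $w(S\otimes T)$ is understood via slice maps: for $\phi$ in the dual unit ball $B_1^*$ of $\mathcal S_\infty$, applying $1\otimes\phi$ gives $w_\phi(S)=\sum_{s,t}p_sSp_t\,\phi(\pi(\lambda_s)T\pi(\lambda_{t^{-1}}))$, the operator with matrix entries $\langle e_s,Se_t\rangle\,\phi(\pi(\lambda_s)T\pi(\lambda_{t^{-1}}))$, and the injective norm is $\|w(S\otimes T)\|_\varepsilon=\sup_{\phi\in B_1^*}\|w_\phi(S)\|_{\mathcal S_p}$ (extended linearly to sums of elementary tensors).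
   Formalization: For p = ∞ the values of w are not claimed to lie in S_∞ ⊗_ε S_∞ (this fails for infinite Γ, S = 1, T = p_e); there w maps into families of slices in S_∞ over B_1^* with the sup (injective) norm, and is a contraction. *)

(* Defs.v *)
From HB Require Import structures.
From mathcomp Require Import all_boot all_order all_algebra.
From mathcomp Require Import complex.
From mathcomp Require Import all_classical all_reals all_analysis.
From mathcomp Require Import lra.

Set Implicit Arguments.
Unset Strict Implicit.
Unset Printing Implicit Defensive.

Import Order.TTheory GRing.Theory Num.Theory.
Import numFieldNormedType.Exports.
Import ComplexField.Normc.

Local Open Scope classical_set_scope.
Local Open Scope ring_scope.
Local Open Scope complex_scope.

Section l2.
Variables (R : realType) (G : groupType).
Local Notation C := R[i].
Implicit Types (x y : G -> C) (a : C).

Definition sqsum x : \bar R := \esum_(s in setT) ((normc (x s)) ^+ 2)%:E.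

Definition l2_pred : {pred G -> C} := mem [set x | (sqsum x < +oo)%E].

Lemma sqsum_ge0 x : (0 <= sqsum x)%E.
Proof. by apply: esum_ge0 => s _; rewrite lee_fin sqr_ge0. Qed.

Lemma sqsumZ a x : (sqsum (a *: x)%R <= (normc a ^+ 2)%:E * sqsum x)%E.
Proof.
apply: ge_ereal_sup => _ [A [finA _]] <-.
rewrite (eq_fsbigr (fun s => ((normc a ^+ 2)%:E * (normc (x s) ^+ 2)%:E)%E)).
  rewrite -ge0_mule_fsumr; last by move=> s; rewrite lee_fin sqr_ge0.
  rewrite lee_wpmul2l ?lee_fin ?sqr_ge0//.
  by apply: ereal_sup_ubound; exists A.
by move=> s _; rewrite -EFinM -exprMn -normcM.
Qed.

Lemma normc_ge0 a : 0 <= normc a.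
Proof. by case: a => u v /=; rewrite sqrtr_ge0. Qed.

Lemma normc_sqrD a b : normc (a + b) ^+ 2 <= normc a ^+ 2 *+ 2 + normc b ^+ 2 *+ 2.
Proof.
apply: (@le_trans _ _ ((normc a + normc b) ^+ 2)).
  by rewrite ler_sqr ?nnegrE ?addr_ge0 ?normc_ge0// le_normcD.
have : 0 <= (normc a - normc b) ^+ 2 by rewrite sqr_ge0.
move: (normc a) (normc b) => u v; rewrite sqrrB sqrrD !mulr2n.
lra.
Qed.

Lemma sqsumD x y :
  (sqsum (x + y)%R <= (sqsum x + sqsum x) + (sqsum y + sqsum y))%E.
Proof.
have p0 z s : setT s -> (0 <= ((normc (z s : C)) ^+ 2)%:E :> \bar R)%E.
  by rewrite lee_fin sqr_ge0.
have pp0 z s : setT s -> (0 <= ((normc (z s : C)) ^+ 2)%:E +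
    ((normc (z s : C)) ^+ 2)%:E :> \bar R)%E.
  by move=> _; rewrite adde_ge0 ?p0.
rewrite /sqsum -!esumD//; try exact: p0; try exact: pp0.
apply: le_esum => s _; rewrite -!EFinD lee_fin.
by have := normc_sqrD (x s) (y s); rewrite !mulr2n.
Qed.

Lemma l2_submod_closed : submod_closed l2_pred.
Proof.
split=> [|a x y].
  rewrite inE /= /sqsum esum1 ?ltry// => s _.
  by rewrite /= expr0n/= addr0 sqrtr0 expr0n.
rewrite !inE /= => hx hy.
apply: le_lt_trans (sqsumD _ _) _.
have hax : (sqsum (a *: x)%R < +oo)%E.
  apply: le_lt_trans (sqsumZ _ _) _.
  by rewrite lte_mul_pinfty ?lee_fin ?sqr_ge0// sqsum_ge0.
by rewrite !lte_add_pinfty.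
Qed.

HB.instance Definition _ :=
  GRing.isSubmodClosed.Build _ _ l2_pred l2_submod_closed.

Record l2 := L2 { l2_fun :> G -> C; l2_funP : l2_fun \in l2_pred }.

HB.instance Definition _ := [isSub for l2_fun].
HB.instance Definition _ := [Choice of l2 by <:].
HB.instance Definition _ := [SubChoice_isSubLmodule of l2 by <:].

End l2.

Section l2_hilbert.
Variables (R : realType) (G : groupType).
Local Notation C := R[i].
Local Notation H := (l2 R G).
Implicit Types (x y : H) (a : C) (g s t : G).

Definition l2norm x : R := Num.sqrt (fine (sqsum x)).

(** Sum of an absolutely summable real (resp. complex) family. *)
Definition rsum (f : G -> R) : R :=
  fine (\esum_(s in setT) (Num.max (f s) 0)%:E) -
  fine (\esum_(s in setT) (Num.max (- f s) 0)%:E).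

Definition csum (f : G -> C) : C :=
  rsum (fun s => complex.Re (f s)) +i* rsum (fun s => complex.Im (f s)).

(** Antilinear in the first variable. *)
Definition inner x y : C := csum (fun s => (x s)^* * y s).

Lemma l2_fin x : sqsum x \is a fin_num.
Proof.
by rewrite ge0_fin_numE ?sqsum_ge0//; have := l2_funP x; rewrite inE.
Qed.

Lemma l2norm_ge0 x : 0 <= l2norm x.
Proof. exact: sqrtr_ge0. Qed.

Lemma l2normZ_le a x : l2norm (a *: x) <= normc a * l2norm x.
Proof.
rewrite /l2norm -[X in _ <= X * _](ger0_norm (normc_ge0 a)) -sqrtr_sqr.
rewrite -sqrtrM ?sqr_ge0// ler_wsqrtr// -lee_fin EFinM.
by rewrite !fineK ?l2_fin//; exact: sqsumZ.
Qed.

Lemma l2normD_le x y : l2norm (x + y) <= 2 * (l2norm x + l2norm y).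
Proof.
have x0 := l2norm_ge0 x; have y0 := l2norm_ge0 y.
rewrite -(@ler_sqr _ (l2norm _)) ?nnegrE ?l2norm_ge0//; last first.
  by rewrite mulr_ge0// addr_ge0.
have e z : l2norm z ^+ 2 = fine (sqsum z).
  by rewrite sqr_sqrtr// fine_ge0// sqsum_ge0.
have : l2norm (x + y) ^+ 2 <=
    (l2norm x ^+ 2 + l2norm x ^+ 2) + (l2norm y ^+ 2 + l2norm y ^+ 2).
  rewrite !e -lee_fin !EFinD !fineK ?l2_fin//; exact: sqsumD.
nra.
Qed.

Lemma delta_subproof t : (fun s => (s == t)%:R : C) \in @l2_pred R G.
Proof.
rewrite inE /= /sqsum (eq_esum (b := fun s => if s \in [set t] then 1%E else 0%E)).
  by rewrite -esum_mkcond esum_set1 ?ltry.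
move=> s _; have [->|st] := eqVneq s t.
  by rewrite mem_set// normc1 expr1n.
rewrite memNset ?normc0 ?expr0n//= => /eqP; exact/negP.
Qed.

Definition delta t : H := L2 (delta_subproof t).

Lemma rsum_single (f : G -> R) t :
  (forall s, s != t -> f s = 0) -> rsum f = f t.
Proof.
have aux (g : G -> R) : (forall s, s != t -> g s = 0) ->
    \esum_(s in setT) (Num.max (g s) 0)%:E = (Num.max (g t) 0)%:E.
  move=> g0; rewrite (eq_esum (b := fun s =>
    if s \in [set t] then (Num.max (g s) 0)%:E else 0%E)).
    by rewrite -esum_mkcond esum_set1// lee_fin le_max lexx orbT.
  move=> s _; have [->|st] := eqVneq s t; first by rewrite mem_set.
  by rewrite memNset ?g0 ?maxxx//= => /eqP; exact/negP.
move=> f0; rewrite /rsum !aux//=; last by move=> s /f0 ->; rewrite oppr0.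
have [f1|f1] := leP (f t) 0.
  by rewrite max_l ?oppr_ge0// sub0r opprK.
by rewrite max_r ?oppr_le0 ?subr0// ltW.
Qed.

Lemma inner_delta t x : inner (delta t) x = x t.
Proof.
have d0 s : s != t -> delta t s = 0 by move=> st; rewrite /= (negbTE st).
rewrite /inner /csum !(@rsum_single _ t); first last.
- by move=> s st; rewrite d0// rmorph0 mul0r.
- by move=> s st; rewrite d0// rmorph0 mul0r.
by rewrite /= eqxx rmorph1 mul1r; case: (x t).
Qed.

Lemma sqsum_transl g (x : G -> C) :
  sqsum (fun s => x (g^-1 * s)%g) = sqsum x.
Proof.
rewrite /sqsum [RHS](@reindex_esum _ _ _ setT setT (fun s => (g^-1 * s)%g))//.
split=> //; first by move=> s t _ _ /mulgI.
by move=> s _; exists (g * s)%g => //; rewrite mulKg.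
Qed.

End l2_hilbert.

Section operators.
Variables (R : realType) (G : groupType).
Local Notation C := R[i].
Local Notation H := (l2 R G).

Definition bop_pred : {pred H -> H} :=
  mem [set f | linear f /\ exists M, forall x, l2norm (f x) <= M * l2norm x].

Lemma bop_submod_closed : submod_closed bop_pred.
Proof.
split=> [|a f g]; rewrite !inE /=.
  split=> [b x y|]; first by rewrite scaler0 addr0.
  exists 0 => x; rewrite mul0r -[X in l2norm X](scale0r (0 : H)).
  by apply: le_trans (l2normZ_le _ _) _; rewrite normc0 mul0r.
move=> [lf [M hM]] [lg [N hN]]; split=> [b x y|].
  rewrite !fctE lf lg !scalerDr !scalerA [a * b]mulrC.
  by rewrite -!addrA; congr (_ + _); rewrite addrCA.
exists (2 * (normc a * M + N)) => x; rewrite !fctE.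
apply: le_trans (l2normD_le _ _) _; rewrite -mulrA ler_pM2l// mulrDl.
apply: lerD => //; apply: le_trans (l2normZ_le _ _) _.
by rewrite -mulrA ler_wpM2l// normc_ge0.
Qed.

HB.instance Definition _ :=
  GRing.isSubmodClosed.Build _ _ bop_pred bop_submod_closed.

Record bop := Bop { bop_fun :> H -> H; bop_funP : bop_fun \in bop_pred }.

HB.instance Definition _ := [isSub for bop_fun].
HB.instance Definition _ := [Choice of bop by <:].
HB.instance Definition _ := [SubChoice_isSubLmodule of bop by <:].

Implicit Types (S T : bop).

Definition opnorm T : R := sup [set l2norm (T x) | x in [set x | l2norm x <= 1]].

Lemma bopP T : linear T /\ exists M, forall x, l2norm (T x) <= M * l2norm x.
Proof. by have := bop_funP T; rewrite inE. Qed.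

Lemma bop_comp_subproof S T : S \o T \in bop_pred.
Proof.
have [lS [M hM]] := bopP S; have [lT [N hN]] := bopP T; rewrite inE.
split=> [a x y|]; first by rewrite /= lT lS.
exists (`|M| * N) => x /=; apply: le_trans (hM _) _.
apply: le_trans (_ : `|M| * l2norm (T x) <= _).
  by rewrite ler_wpM2r ?l2norm_ge0 ?ler_norm.
by rewrite -mulrA ler_wpM2l.
Qed.

Definition bop_comp S T : bop := Bop (bop_comp_subproof S T).

Lemma transl_l2_subproof (g : G) (x : H) :
  (fun s => x (g^-1 * s)%g) \in @l2_pred R G.
Proof. by rewrite inE /= sqsum_transl; have := l2_funP x; rewrite inE. Qed.

Definition transl_l2 g x : H := L2 (transl_l2_subproof g x).

Lemma transl_subproof g : transl_l2 g \in bop_pred.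
Proof.
rewrite inE; split=> [a x y|]; first exact/val_inj.
by exists 1 => x; rewrite mul1r /l2norm /= sqsum_transl.
Qed.

(** The unitary pi(lambda_g) of left translation by g. *)
Definition transl g : bop := Bop (transl_subproof g).

Lemma transl_delta g s : transl g (delta R s) = delta R (g * s)%g.
Proof.
apply/val_inj/funext => t /=; congr (_ %:R); congr nat_of_bool.
by rewrite -(inj_eq (mulgI g)) mulVKg.
Qed.

Lemma opnorm_has_sup T :
  has_sup [set l2norm (T x) | x in [set x | l2norm x <= 1]].
Proof.
split.
  exists (l2norm (T 0)), 0 => //=.
  rewrite -[X in l2norm X](scale0r (0 : H)).
  by apply: le_trans (l2normZ_le _ _) _; rewrite normc0 mul0r.
have [_ [M hM]] := bopP T.
exists `|M| => _ [x /= x1 <-]; apply: le_trans (hM x) _.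
apply: le_trans (_ : `|M| * l2norm x <= _).
  by rewrite ler_wpM2r ?l2norm_ge0 ?ler_norm.
by rewrite ler_piMr.
Qed.

Lemma opnorm_ge0 T : 0 <= opnorm T.
Proof.
have [[y Ey] ub] := opnorm_has_sup T.
apply: le_trans (ub_le_sup ub Ey); case: Ey => x _ <-; exact: l2norm_ge0.
Qed.

Lemma opnormZ_le (a : C) T : opnorm (a *: T) <= normc a * opnorm T.
Proof.
have [ne ub] := opnorm_has_sup T.
apply: ge_sup; first by have [] := opnorm_has_sup (a *: T).
move=> _ [x /= x1 <-]; apply: le_trans (l2normZ_le _ _) _.
rewrite ler_wpM2l ?normc_ge0//; apply: ub_le_sup => //; by exists x.
Qed.

End operators.

Section schatten.
Variables (R : realType) (G : groupType).
Local Notation C := R[i].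
Local Notation H := (l2 R G).
Local Notation B := (bop R G).
Implicit Types (S T : B) (p : \bar R).

(** The sequence [sg] lists the nonzero eigenvalues of |S| with multiplicity,
    padded by zeros: [(f n)] with [0 < sg n] is an orthonormal family of
    eigenvectors of S^*S, of eigenvalues [sg n ^+ 2], and S vanishes on the
    orthogonal complement of that family. Every compact operator has such a
    sequence; its order is irrelevant to Schatten norms. *)
Definition singular_values S (sg : nat -> R) : Prop :=
  exists f : nat -> H,
  [/\ forall n, 0 <= sg n,
      forall m n, 0 < sg m -> 0 < sg n -> inner (f m) (f n) = (m == n)%:R,
      forall n y, 0 < sg n ->
        inner (S y) (S (f n)) = (sg n ^+ 2)%:C * inner y (f n)
    & forall x, (forall n, 0 < sg n -> inner (f n) x = 0) -> S x = 0].

(** For finite [p] the infimum is over a set with at most one element; it is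
    +oo if there is no sequence of singular values. *)
Definition schatten_norm p S : \bar R :=
  if p is r%:E then
    ereal_inf [set ((\sum_(n <oo) (sg n `^ r)%:E) `^ r^-1)%E
              | sg in singular_values S]
  else (opnorm S)%:E.

Record schatten p := Schatten {
  schatten_op :> B;
  schatten_opP : (schatten_norm p schatten_op < +oo)%E }.

Lemma schatten_norm_ge0 p S : (0 <= schatten_norm p S)%E.
Proof.
case: p => [r| |] /=; [|by rewrite lee_fin opnorm_ge0..].
by apply: le_ereal_inf_tmp => _ [sg _ <-]; exact: poweR_ge0.
Qed.

End schatten.

Section tensor.
Variables (R : realType) (G : groupType) (p : \bar R).
Local Notation C := R[i].
Local Notation B := (bop R G).
Local Notation Sp := (schatten G p).

(** Bilinear forms on S_p x S_oo. Linearity in the first variable is expressed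
    without invoking the theorem that S_p is a linear subspace. *)
Record bilform := Bilform {
  bil :> Sp -> B -> C;
  bil_linear_l : forall (a : C) (S S' S'' : Sp) T,
    S'' = a *: (S : B) + S' :> B -> bil S'' T = a * bil S T + bil S' T;
  bil_linear_r : forall S, scalar (bil S) }.

Lemma bilZr (A : bilform) a S T : A S (a *: T) = a * A S T.
Proof.
have h := bil_linear_r A S.
have A0 : A S 0 = 0.
  by apply: (addIr (A S 0)); rewrite -{1}[A S 0]mul1r -h scale1r addr0 add0r.
by rewrite -[a *: T]addr0 h A0 addr0.
Qed.

(** The algebraic tensor product: the span of the elementary tensors, which
    are the evaluations A |-> A S T on bilinear forms. *)
Definition atens_pred : {pred bilform -> C} :=
  mem [set u | exists r : seq (Sp * B), u = \sum_(z <- r) (fun A : bilform => A z.1 z.2)].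

Lemma atens_submod_closed : submod_closed atens_pred.
Proof.
split=> [|a u v]; rewrite !inE /=; first by exists [::]; rewrite big_nil.
move=> [r ->] [r' ->].
exists ([seq (z.1, a *: z.2) | z <- r] ++ r').
rewrite big_cat /= big_map scaler_sumr; congr (_ + _).
apply: eq_bigr => z _; apply/funext => A /=.
by rewrite bilZr.
Qed.

HB.instance Definition _ :=
  GRing.isSubmodClosed.Build _ _ atens_pred atens_submod_closed.

Record atens := Atens { atens_fun : bilform -> C; _ : atens_fun \in atens_pred }.

HB.instance Definition _ := [isSub for atens_fun].
HB.instance Definition _ := [Choice of atens by <:].
HB.instance Definition _ := [SubChoice_isSubLmodule of atens by <:].

Lemma elem_subproof (S : Sp) (T : B) :
  (fun A : bilform => A S T) \in atens_pred.
Proof. by rewrite inE; exists [:: (S, T)]; rewrite big_seq1. Qed.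

Definition elem (S : Sp) (T : B) : atens := Atens (elem_subproof S T).

Definition represents (r : seq (Sp * B)) (u : atens) : Prop :=
  u = \sum_(z <- r) elem z.1 z.2.

Definition pi_norm (u : atens) : R :=
  inf [set \sum_(z <- r) fine (schatten_norm p z.1) * opnorm z.2
      | r in [set r | represents r u]].

Lemma representsP u : exists r, represents r u.
Proof.
case: u => u uP; have := uP; rewrite inE => -[r ur]; exists r.
by apply/val_inj; rewrite raddf_sum.
Qed.

Let pi_sum (r : seq (Sp * B)) :=
  \sum_(z <- r) fine (schatten_norm p z.1) * opnorm z.2.

Let pi_sum_ge0 r : 0 <= pi_sum r.
Proof.
apply: sumr_ge0 => z _.
by rewrite mulr_ge0 ?opnorm_ge0// fine_ge0// schatten_norm_ge0.
Qed.

Lemma pi_norm_has_inf u :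
  has_inf [set pi_sum r | r in [set r | represents r u]].
Proof.
split; last by exists 0 => _ [r _ <-]; exact: pi_sum_ge0.
by have [r ru] := representsP u; exists (pi_sum r), r.
Qed.

Lemma pi_norm_ge0 u : 0 <= pi_norm u.
Proof.
have [ne _] := pi_norm_has_inf u.
by apply: lb_le_inf => // _ [r _ <-]; exact: pi_sum_ge0.
Qed.

Lemma pi_norm_le u r : represents r u -> pi_norm u <= pi_sum r.
Proof.
have [_ lb] := pi_norm_has_inf u.
by move=> ru; apply: ge_inf => //; exists r.
Qed.

Lemma pi_normD u v : pi_norm (u + v) <= pi_norm u + pi_norm v.
Proof.
apply/ler_addgt0Pr => e e0.
have e2 : 0 < e / 2 by rewrite divr_gt0.
have [_ [r ru <-] hr] := inf_adherent e2 (pi_norm_has_inf u).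
have [_ [r' rv <-] hr'] := inf_adherent e2 (pi_norm_has_inf v).
have /pi_norm_le : represents (r ++ r') (u + v).
  by rewrite /represents big_cat /= ru rv.
rewrite /pi_sum big_cat /= -/(pi_sum r) -/(pi_sum r') => /le_trans; apply.
move: hr hr'; rewrite -/(pi_norm u) -/(pi_norm v) => hr hr'; lra.
Qed.

Lemma elemZr (a : C) S T : elem S (a *: T) = a *: elem S T.
Proof.
apply/val_inj/funext => A /=.
by rewrite bilZr.
Qed.

Lemma pi_normZ_le (a : C) u : pi_norm (a *: u) <= normc a * pi_norm u.
Proof.
apply/ler_addgt0Pr => e e0.
have d0 : 0 < e / (normc a + 1).
  by rewrite divr_gt0// ltr_wpDl ?normc_ge0.
have [_ [r ru <-] hr] := inf_adherent d0 (pi_norm_has_inf u).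
have /pi_norm_le : represents [seq (z.1, a *: z.2) | z <- r] (a *: u).
  rewrite /represents big_map ru scaler_sumr.
  by apply: eq_bigr => z _; rewrite elemZr.
move=> /le_trans; apply.
apply: (@le_trans _ _ (normc a * pi_sum r)).
  rewrite /pi_sum big_map mulr_sumr; apply: ler_sum => z _ /=.
  rewrite mulrCA ler_wpM2l ?opnormZ_le//.
  by rewrite fine_ge0// schatten_norm_ge0.
apply: (@le_trans _ _ (normc a * (pi_norm u + e / (normc a + 1)))).
  by rewrite ler_wpM2l ?normc_ge0// ltW.
rewrite mulrDr lerD2l mulrCA ler_piMr ?(ltW e0)//.
by rewrite ler_pdivrMr ?mul1r ?lerDl ?ltr_wpDl ?normc_ge0.
Qed.

(** The completed projective tensor product is presented by the pi-Cauchy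
    sequences of algebraic tensors, with the limit seminorm; the Banach space is
    the quotient by the sequences of seminorm 0. *)
Definition ptens_pred : {pred nat -> atens} :=
  mem [set U | forall e, 0 < e -> exists N, forall m n,
    (N <= m)%N -> (N <= n)%N -> pi_norm (U m - U n) < e].

Lemma pi_norm0 : pi_norm 0 = 0.
Proof.
apply/le_anti; rewrite pi_norm_ge0 andbT -[X in pi_norm X](scale0r (0 : atens)).
by apply: le_trans (pi_normZ_le _ _) _; rewrite normc0 mul0r.
Qed.

Lemma ptens_submod_closed : submod_closed ptens_pred.
Proof.
split=> [|a U V]; rewrite !inE /=.
  by move=> e e0; exists 0 => m n _ _; rewrite subrr pi_norm0.
move=> hU hV e e0.
have na : 0 < normc a + 1 by rewrite ltr_wpDl ?normc_ge0.
have [N hN] := hU (e / 2 / (normc a + 1)) (divr_gt0 (divr_gt0 e0 (ltr0Sn _ _)) na).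
have [M hM] := hV (e / 2) (divr_gt0 e0 (ltr0Sn _ _)).
exists (maxn N M) => m n; rewrite !geq_max => /andP[Nm Mm] /andP[Nn Mn].
rewrite !fctE opprD addrACA -scalerBr.
apply: le_lt_trans (pi_normD _ _) _.
rewrite [ltRHS](splitr e); apply: ler_ltD (hM _ _ Mm Mn).
apply: le_trans (pi_normZ_le _ _) _.
have := hN _ _ Nm Nn; rewrite ltr_pdivlMr// => /ltW; apply: le_trans.
by rewrite mulrC ler_wpM2l ?pi_norm_ge0 ?lerDl.
Qed.

HB.instance Definition _ :=
  GRing.isSubmodClosed.Build _ _ ptens_pred ptens_submod_closed.

Record ptens := Ptens { ptens_seq : nat -> atens; _ : ptens_seq \in ptens_pred }.

HB.instance Definition _ := [isSub for ptens_seq].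
HB.instance Definition _ := [Choice of ptens by <:].
HB.instance Definition _ := [SubChoice_isSubLmodule of ptens by <:].

Definition ptens_norm (U : ptens) : R :=
  limn (fun n => pi_norm (ptens_seq U n)).

Lemma ptens_elem_subproof S T : (fun=> elem S T) \in ptens_pred.
Proof. by rewrite inE => e e0; exists 0 => m n _ _; rewrite subrr pi_norm0. Qed.

Definition ptens_elem S T : ptens := Ptens (ptens_elem_subproof S T).

(** B_1^*, the unit ball of the dual of S_oo. *)
Record dual_ball := DualBall {
  dual_fun :> {linear B -> C};
  dual_funP : forall T, normc (dual_fun T) <= opnorm T }.

(** An element of the injective tensor product is identified with the family
    of its slices by B_1^*, so that the injective norm is a supremum. *)
Definition eps_norm (V : dual_ball -> B) : \bar R :=
  ereal_sup [set schatten_norm p (V phi) | phi in setT].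

Definition slice (r : seq (Sp * B)) : dual_ball -> B :=
  fun phi => \sum_(z <- r) phi z.2 *: (z.1 : B).

(** The completed injective tensor product: the limits of (the slice maps of)
    algebraic tensors for the injective norm. *)
Definition in_injective (V : dual_ball -> B) : Prop :=
  forall e : R, 0 < e ->
    exists r : seq (Sp * B), (eps_norm (V - slice r)%R < e%:E)%E.

End tensor.

(* Main.v *)
(** Fix [phi] and two finite Bessel families [l], [k]. By linearity of [phi], the
    pairing [\sum_i c_i <l_i, w_phi(S) k_i>] is [phi X] for a finite linear
    combination [X] of the operators [lambda_s T lambda_t^-1], hence is at most the
    norm of [X], and no representation of [phi] is needed. For unit vectors [x],
    [y], writing [a_s := lambda_s^* x] and [b_t := T lambda_t^-1 y],
      [<x, X y> = \sum_g \sum_i c_i <l_i a(g), S (k_i b(g))>].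
    If [S = \sum_n sg_n |h_n><f_n|] then the sums over [g] of
    [|<l_i a(g), h_n> <f_n, k_i b(g)>|] form a doubly substochastic matrix in [i], [n]
    (up to the factor |T|), so that Young's inequality bounds the pairing by the
    Schatten norm of [S] when [c] is in the unit ball of the dual of l^p.

    Conversely, for finite [p], an operator [W] all of whose pairings are bounded by
    [M] is compact; maximizing [|W x| / |x|] successively yields its singular
    values, whose l^p norm is itself a pairing and hence at most [M]. The bounds on
    pairings only involve finitely many matrix entries at a time, so they pass to
    limits in the completed projective tensor product. For finite [p] the image
    lies in the injective tensor product because the truncations [P_F S P_F] converge
    to [S] and their images are finite sums of elementary tensors. *)

Require Import Defs.
From HB Require Import structures.
From mathcomp Require Import all_boot all_order all_algebra.
From mathcomp Require Import complex finmap.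
From mathcomp Require Import all_classical all_reals all_analysis.
From mathcomp Require Import ring lra.

Set Implicit Arguments.
Unset Strict Implicit.
Unset Printing Implicit Defensive.

Import Order.TTheory GRing.Theory Num.Theory.
Import numFieldNormedType.Exports.
Import ComplexField.Normc.

Local Open Scope classical_set_scope.
Local Open Scope ring_scope.

(** * Summation over the group *)

(** The Schatten norm is an infimum over sequences of singular values, a definition from which not
    even the triangle inequality is visible. Estimates are therefore carried by bounds on pairings,
    which are additive in the operator at sight. Bessel families replace orthonormal ones because
    the vectors [l_i a(g)] need not be orthonormal even when the [l_i] are. Three forms of the bound
    coexist: [rows_bound] carries the extra index [g], [pairing_bound] is the form from which
    singular values are extracted, and [matrix_bound] makes sense for entries that are not yet known
    to define an operator.

    The delicate point of the converse is that the supremum of [|W x| / |x|] is attained. An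
    ultrafilter of near-maximizers takes the place of weak compactness of the ball: bounded pairings
    confine [W], up to a small error, to finitely many coefficients; these are nearly constant along
    the ultrafilter, and the parallelogram identity then makes the near-maximizers themselves nearly
    constant, so that a Cauchy sequence can be selected. *)

Section complex_modulus.
Variable R : realType.
Local Notation C := R[i].
Implicit Types (a b z : C).

Lemma sqr_normc z : normc z ^+ 2 = complex.Re z ^+ 2 + complex.Im z ^+ 2.
Proof. by case: z => u v /=; rewrite sqr_sqrtr// addr_ge0// sqr_ge0. Qed.

Lemma RecM a b : complex.Re (a * b) =
  complex.Re a * complex.Re b - complex.Im a * complex.Im b.
Proof. by case: a b => [? ?] [? ?]. Qed.

Lemma ImcM a b : complex.Im (a * b) =
  complex.Re a * complex.Im b + complex.Im a * complex.Re b.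
Proof. by case: a b => [? ?] [? ?]. Qed.

Lemma RecD a b : complex.Re (a + b) = complex.Re a + complex.Re b.
Proof. by case: a b => [? ?] [? ?]. Qed.

Lemma ImcD a b : complex.Im (a + b) = complex.Im a + complex.Im b.
Proof. by case: a b => [? ?] [? ?]. Qed.

Lemma Re_realM (r : R) z : complex.Re (r%:C%C * z) = r * complex.Re z.
Proof. by rewrite RecM/= mul0r subr0. Qed.

Lemma Im_realM (r : R) z : complex.Im (r%:C%C * z) = r * complex.Im z.
Proof. by rewrite ImcM/= mul0r addr0. Qed.

Lemma RecN a : complex.Re (- a) = - complex.Re a.
Proof. by case: a. Qed.

Lemma ImcN a : complex.Im (- a) = - complex.Im a.
Proof. by case: a. Qed.

Lemma Rec_conj a : complex.Re a^* = complex.Re a.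
Proof. by case: a. Qed.

Lemma Imc_conj a : complex.Im a^* = - complex.Im a.
Proof. by case: a. Qed.

Lemma Re_conj_iM z : complex.Re (('i%C)^* * z) = complex.Im z.
Proof. by rewrite RecM Rec_conj Imc_conj/= mul0r sub0r mulN1r opprK. Qed.

Lemma conj_mul a b : (a * b)^* = a^* * b^*.
Proof. exact: (rmorphM Num.conj). Qed.

Lemma conj_realC (r : R) : (r%:C%C)^* = r%:C%C.
Proof. exact: conjc_real. Qed.

Lemma normc_conj a : normc a^* = normc a.
Proof. by case: a => u v /=; rewrite sqrrN. Qed.

Lemma mulc_conj z : z^* * z = (normc z ^+ 2)%:C%C.
Proof.
case: z => u v; apply/eqP; rewrite eq_complex/= sqr_sqrtr ?addr_ge0 ?sqr_ge0//.
by apply/andP; split; apply/eqP; ring.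
Qed.

Lemma normc_real (r : R) : normc r%:C%C = `|r|.
Proof. by rewrite /= expr0n/= addr0 sqrtr_sqr. Qed.

Lemma normc_Re z : `|complex.Re z| <= normc z.
Proof.
rewrite -[leRHS]ger0_norm ?normc_ge0// -ler_sqr ?nnegrE// !real_normK ?num_real//.
by rewrite sqr_normc lerDl sqr_ge0.
Qed.

Lemma normc_Im z : `|complex.Im z| <= normc z.
Proof.
rewrite -[leRHS]ger0_norm ?normc_ge0// -ler_sqr ?nnegrE// !real_normK ?num_real//.
by rewrite sqr_normc lerDr sqr_ge0.
Qed.

Lemma normc_le_ReIm z : normc z <= `|complex.Re z| + `|complex.Im z|.
Proof.
rewrite -ler_sqr ?nnegrE ?normc_ge0 ?addr_ge0// sqr_normc sqrrD.
by rewrite !real_normK ?num_real// lerD2r lerDl mulrn_wge0// mulr_ge0.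
Qed.

Lemma normc_sum (I : Type) (r : seq I) (P : pred I) (F : I -> C) :
  normc (\sum_(i <- r | P i) F i) <= \sum_(i <- r | P i) normc (F i).
Proof.
elim/big_rec2: _ => [|i y x _ h]; first by rewrite normc0.
by apply: le_trans (le_normcD _ _) _; rewrite lerD2l.
Qed.

(** Such phases turn bounds on real parts into bounds on moduli and make all the terms of a pairing
    nonnegative. *)
Lemma exists_phase z : exists2 u, normc u = 1 & u * z = (normc z)%:C%C.
Proof.
have [->|z0] := eqVneq z 0; first by exists 1; rewrite ?normc1// mulr0 normc0.
have nz : normc z != 0 by apply: contra z0 => /eqP/eq0_normc ->.
have nz' : (normc z)%:C%C != 0 :> C by rewrite (inj_eq (@complexI R) _ 0).
exists (z^* / (normc z)%:C%C).
  by rewrite normcM normcV normc_conj normc_real ger0_norm ?normc_ge0// divff.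
by rewrite mulrAC mulc_conj rmorphXn/= expr2 mulfK.
Qed.

End complex_modulus.

(** * Absolutely summable real and complex families *)

Section sums.
Variables (R : realType) (G : groupType).
Local Notation C := R[i].
Implicit Types (f g : G -> R).

Definition abs_summable f := (\esum_(s in setT) `|f s|%:E < +oo)%E.

Lemma abs_summable_le f g :
  (forall s, `|f s| <= g s) -> abs_summable g -> abs_summable f.
Proof.
move=> fg; apply: le_lt_trans; apply: le_esum => s _; rewrite lee_fin.
exact: le_trans (fg s) (ler_norm _).
Qed.

Lemma abs_summableD f g :
  abs_summable f -> abs_summable g -> abs_summable (fun s => f s + g s).
Proof.
rewrite /abs_summable => hf hg.
apply: (@le_lt_trans _ _ (\esum_(s in setT) (`|f s|%:E + `|g s|%:E))%E).
  by apply: le_esum => s _; rewrite -EFinD lee_fin ler_normD.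
by rewrite esumD ?lte_add_pinfty// => s _; rewrite lee_fin.
Qed.

Lemma abs_summableZ (c : R) f :
  abs_summable f -> abs_summable (fun s => c * f s).
Proof.
rewrite /abs_summable => hf.
apply: (@le_lt_trans _ _ (`|c|%:E * \esum_(s in setT) `|f s|%:E)%E); last first.
  by rewrite lte_mul_pinfty ?lee_fin//; apply: esum_ge0 => s _; rewrite lee_fin.
apply: ge_ereal_sup => _ [A [finA _]] <-.
rewrite (eq_fsbigr (fun s => (`|c|%:E * `|f s|%:E)%E)); last first.
  by move=> s _; rewrite normrM EFinM.
rewrite -ge0_mule_fsumr; last by move=> s; rewrite lee_fin.
by rewrite lee_wpmul2l ?lee_fin//; apply: ereal_sup_ubound; exists A.
Qed.

Lemma esum_fin f : abs_summable f -> (forall s, 0 <= f s) ->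
  \esum_(s in setT) (f s)%:E \is a fin_num.
Proof.
move=> hf f0; rewrite ge0_fin_numE; last by apply: esum_ge0 => s _; rewrite lee_fin.
by move: hf; rewrite /abs_summable; under eq_esum do rewrite ger0_norm//.
Qed.

Lemma maxr0_ge0 (x : R) : 0 <= Num.max x 0.
Proof. by rewrite le_max lexx orbT. Qed.

Lemma abs_summable_max f : abs_summable f -> abs_summable (fun s => Num.max (f s) 0).
Proof.
apply: le_lt_trans; apply: le_esum => s _; rewrite lee_fin ger0_norm ?maxr0_ge0//.
by rewrite ge_max ler_norm normr_ge0.
Qed.

Lemma abs_summableN f : abs_summable f -> abs_summable (fun s => - f s).
Proof. by apply: le_lt_trans; apply: le_esum => s _; rewrite normrN. Qed.

Lemma fine_esumD f g : abs_summable f -> abs_summable g ->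
  (forall s, 0 <= f s) -> (forall s, 0 <= g s) ->
  fine (\esum_(s in setT) (f s + g s)%:E) =
  fine (\esum_(s in setT) (f s)%:E) + fine (\esum_(s in setT) (g s)%:E).
Proof.
move=> hf hg f0 g0; rewrite -fineD ?esum_fin// -esumD//;
  by move=> s _; rewrite lee_fin.
Qed.

(** Frees [rsum] from the canonical splitting into positive and negative parts: any splitting into
    summable nonnegative families will do. Additivity and homogeneity follow by adding or scaling
    splittings. *)
Lemma rsum_sub f g : abs_summable f -> abs_summable g ->
  (forall s, 0 <= f s) -> (forall s, 0 <= g s) ->
  rsum (fun s => f s - g s) =
  fine (\esum_(s in setT) (f s)%:E) - fine (\esum_(s in setT) (g s)%:E).
Proof.
move=> hf hg f0 g0.
have hd : abs_summable (fun s => f s - g s).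
  apply: abs_summable_le (abs_summableD hf hg) => s.
  by apply: le_trans (ler_normB _ _) _; rewrite !ger0_norm.
have h1 := abs_summable_max hd; have h2 := abs_summable_max (abs_summableN hd).
(* Moving the subtracted sums across leaves the pointwise identity
   [(f - g)^+ + g = f + (f - g)^-]. *)
rewrite /rsum; apply/eqP; rewrite subr_eq addrAC eq_sym subr_eq eq_sym.
rewrite -!fine_esumD//; try by move=> s; rewrite maxr0_ge0.
apply/eqP; congr fine; apply: eq_esum => s _; congr EFin.
by have [h|h] := leP (f s - g s) 0;
  [rewrite [X in _ = _ + X]max_l|rewrite [X in _ = _ + X]max_r]; lra.
Qed.

Lemma maxr0_sub (x : R) : Num.max x 0 - Num.max (- x) 0 = x.
Proof.
have [h|h] := leP x 0; first by rewrite max_l ?oppr_ge0// sub0r opprK.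
by rewrite max_r ?oppr_le0 ?subr0// ltW.
Qed.

Lemma rsumD f g : abs_summable f -> abs_summable g ->
  rsum (fun s => f s + g s) = rsum f + rsum g.
Proof.
move=> hf hg.
have hf' := abs_summable_max hf; have hg' := abs_summable_max hg.
have hfN := abs_summable_max (abs_summableN hf).
have hgN := abs_summable_max (abs_summableN hg).
rewrite (_ : (fun s => _) = fun s => (Num.max (f s) 0 + Num.max (g s) 0) -
    (Num.max (- f s) 0 + Num.max (- g s) 0)); last first.
  by apply/funext => s; rewrite opprD addrACA !maxr0_sub.
have m0 (h : G -> R) s : 0 <= Num.max (h s) 0 by exact: maxr0_ge0.
rewrite (rsum_sub (abs_summableD hf' hg') (abs_summableD hfN hgN)); last 2 first.
- by move=> s; rewrite addr_ge0 ?m0.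
- by move=> s; rewrite addr_ge0 ?maxr0_ge0.
rewrite (fine_esumD hf' hg' (m0 f) (m0 g)) (fine_esumD hfN hgN); last 2 first.
- by move=> s; rewrite maxr0_ge0.
- by move=> s; rewrite maxr0_ge0.
by rewrite opprD addrACA.
Qed.

Lemma rsumN f : rsum (fun s => - f s) = - rsum f.
Proof.
rewrite /rsum opprB; congr (_ - fine _).
by apply: eq_esum => s _; rewrite opprK.
Qed.

Lemma rsum_ge0E f : (forall s, 0 <= f s) ->
  rsum f = fine (\esum_(s in setT) (f s)%:E).
Proof.
move=> f0; rewrite /rsum [X in _ - fine X]esum1 ?subr0.
  by congr fine; apply: eq_esum => s _; rewrite max_l.
by move=> s _; rewrite max_r// oppr_le0.
Qed.

Lemma fine_esumZ (c : R) f : 0 <= c -> (forall s, 0 <= f s) -> abs_summable f ->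
  fine (\esum_(s in setT) (c * f s)%:E) = c * fine (\esum_(s in setT) (f s)%:E).
Proof.
move=> c0 f0 hf; apply: EFin_inj; rewrite EFinM !fineK ?esum_fin//; last 2 first.
- exact: abs_summableZ.
- by move=> s; rewrite mulr_ge0.
(* One inequality suffices: applied to the inverse of [c] it yields the converse. *)
have key (d : R) (h : G -> R) : 0 <= d -> (forall s, 0 <= h s) ->
    (\esum_(s in setT) (d * h s)%:E <= d%:E * \esum_(s in setT) (h s)%:E)%E.
  move=> d0 h0; apply: ge_ereal_sup => _ [A [finA _]] <-.
  rewrite (eq_fsbigr (fun s => (d%:E * (h s)%:E)%E))//.
  rewrite -ge0_mule_fsumr; last by move=> s; rewrite lee_fin.
  by rewrite lee_wpmul2l ?lee_fin//; apply: ereal_sup_ubound; exists A.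
apply/le_anti; rewrite key//=.
have [->|cn0] := eqVneq c 0.
  by rewrite mul0e esum_ge0// => s _; rewrite mul0r.
have cp : 0 < c by rewrite lt0r cn0.
rewrite muleC -lee_pdivlMr// muleC.
apply: le_trans (key c^-1 (fun s => c * f s) _ _); rewrite ?invr_ge0//.
  by apply: le_esum => s _; rewrite mulKf.
by move=> s; rewrite mulr_ge0.
Qed.

Lemma rsumZ (c : R) f : abs_summable f -> rsum (fun s => c * f s) = c * rsum f.
Proof.
have pos (d : R) h : 0 <= d -> abs_summable h -> rsum (fun s => d * h s) = d * rsum h.
  move=> d0 hh; rewrite (_ : (fun s => _) = fun s => d * Num.max (h s) 0 -
      d * Num.max (- h s) 0); last first.
    by apply/funext => s; rewrite -mulrBr maxr0_sub.
  have h1 := abs_summable_max hh; have h2 := abs_summable_max (abs_summableN hh).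
  rewrite (rsum_sub (abs_summableZ d h1) (abs_summableZ d h2)); last 2 first.
  - by move=> s; rewrite mulr_ge0// maxr0_ge0.
  - by move=> s; rewrite mulr_ge0// maxr0_ge0.
  rewrite (fine_esumZ d0 _ h1); last by move=> s; rewrite maxr0_ge0.
  rewrite (fine_esumZ d0 _ h2); last by move=> s; rewrite maxr0_ge0.
  by rewrite mulrBr.
move=> hf; have [c0|c0] := leP 0 c; first exact: pos.
rewrite -[c]opprK mulNr -pos ?oppr_ge0 1?ltW// -rsumN.
by congr rsum; apply/funext => s; rewrite mulNr.
Qed.

Definition csummable (f : G -> C) := abs_summable (fun s => normc (f s)).

Lemma csummable_Re (f : G -> C) : csummable f -> abs_summable (fun s => complex.Re (f s)).
Proof. by apply: abs_summable_le => s; exact: normc_Re. Qed.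

Lemma csummable_Im (f : G -> C) : csummable f -> abs_summable (fun s => complex.Im (f s)).
Proof. by apply: abs_summable_le => s; exact: normc_Im. Qed.

Lemma csumD (f g : G -> C) : csummable f -> csummable g ->
  csum (fun s => f s + g s) = csum f + csum g.
Proof.
move=> hf hg; rewrite /csum.
have -> : (fun s => complex.Re (f s + g s)) =
    fun s => complex.Re (f s) + complex.Re (g s) by apply/funext => s; rewrite RecD.
have -> : (fun s => complex.Im (f s + g s)) =
    fun s => complex.Im (f s) + complex.Im (g s) by apply/funext => s; rewrite ImcD.
by rewrite (rsumD (csummable_Re hf) (csummable_Re hg))
  (rsumD (csummable_Im hf) (csummable_Im hg)).
Qed.

Lemma csumZ (a : C) (f : G -> C) : csummable f ->
  csum (fun s => a * f s) = a * csum f.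
Proof.
move=> hf; have hR := csummable_Re hf; have hI := csummable_Im hf; rewrite /csum.
have -> : (fun s => complex.Re (a * f s)) = fun s =>
    complex.Re a * complex.Re (f s) + (- complex.Im a) * complex.Im (f s).
  by apply/funext => s; rewrite RecM mulNr.
have -> : (fun s => complex.Im (a * f s)) = fun s =>
    complex.Re a * complex.Im (f s) + complex.Im a * complex.Re (f s).
  by apply/funext => s; rewrite ImcM.
rewrite (rsumD (abs_summableZ _ hR) (abs_summableZ _ hI)).
rewrite (rsumD (abs_summableZ _ hI) (abs_summableZ _ hR)).
rewrite !(rsumZ _ hR) !(rsumZ _ hI).
by case: (a) => u v /=; rewrite mulNr.
Qed.

Lemma csum_conj (f : G -> C) : csum (fun s => (f s)^*) = (csum f)^*.
Proof.
rewrite /csum.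
rewrite -[RHS]/(rsum (fun s => complex.Re (f s)) -i*
  rsum (fun s => complex.Im (f s)))%C -rsumN; congr (_ +i* _)%C; congr rsum; apply/funext => s.
  exact: Rec_conj.
exact: Imc_conj.
Qed.

End sums.

Arguments inner : simpl never.
Arguments normc : simpl never.

(** * The Hilbert space l^2(G) *)

Section hilbert.
Variables (R : realType) (G : groupType).
Local Notation C := R[i].
Local Notation H := (l2 R G).
Implicit Types (x y z : H) (a b : C).

Lemma l2_addE x y s : (x + y) s = x s + y s. Proof. by []. Qed.
Lemma l2_scaleE a x s : (a *: x) s = a * x s. Proof. by []. Qed.
Lemma l2_oppE x s : (- x) s = - x s. Proof. by []. Qed.

Lemma l2P x y : (forall s, x s = y s) -> x = y.
Proof. by move=> h; apply/val_inj/funext. Qed.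

Lemma sqr_l2norm x : (l2norm x ^+ 2)%:E = sqsum x.
Proof. by rewrite sqr_sqrtr ?fineK ?l2_fin// fine_ge0// sqsum_ge0. Qed.

Lemma inner_summable x y : csummable (fun s => (x s)^* * y s).
Proof.
have h z : abs_summable (fun s => normc (z s : C) ^+ 2).
  apply: (@le_lt_trans _ _ (sqsum z)); last by have := l2_funP z; rewrite inE.
  by apply: le_esum => s _; rewrite ger0_norm// sqr_ge0.
apply: abs_summable_le (abs_summableD (h x) (h y)) => s.
rewrite normcM normc_conj normrM !ger0_norm ?normc_ge0//.
have := sqr_ge0 (normc (x s) - normc (y s)); nra.
Qed.

Lemma innerDr x y z : inner x (y + z) = inner x y + inner x z.
Proof.
rewrite /inner -csumD; try exact: inner_summable.
by congr csum; apply/funext => s; rewrite l2_addE mulrDr.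
Qed.

Lemma innerZr a x y : inner x (a *: y) = a * inner x y.
Proof.
rewrite /inner -csumZ; try exact: inner_summable.
by congr csum; apply/funext => s; rewrite l2_scaleE mulrCA.
Qed.

Lemma innerC x y : inner x y = (inner y x)^*.
Proof.
rewrite /inner -csum_conj; congr csum; apply/funext => s.
by rewrite rmorphM/= conjCK mulrC.
Qed.

Lemma innerDl x y z : inner (x + y) z = inner x z + inner y z.
Proof. by rewrite innerC innerDr rmorphD/= -!innerC. Qed.

Lemma innerZl a x y : inner (a *: x) y = a^* * inner x y.
Proof. by rewrite innerC innerZr rmorphM/= -innerC. Qed.

Lemma inner0r x : inner x 0 = 0.
Proof. by rewrite -[0](scale0r (0 : H)) innerZr mul0r. Qed.

Lemma inner0l x : inner 0 x = 0.
Proof. by rewrite innerC inner0r rmorph0. Qed.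

Lemma innerNr x y : inner x (- y) = - inner x y.
Proof. by rewrite -scaleN1r innerZr mulN1r. Qed.

Lemma innerNl x y : inner (- x) y = - inner x y.
Proof. by rewrite innerC innerNr rmorphN/= -innerC. Qed.

Lemma innerBr x y z : inner x (y - z) = inner x y - inner x z.
Proof. by rewrite innerDr innerNr. Qed.

Lemma innerBl x y z : inner (x - y) z = inner x z - inner y z.
Proof. by rewrite innerDl innerNl. Qed.

Lemma inner_sumr I (r : seq I) (P : pred I) (F : I -> H) x :
  inner x (\sum_(i <- r | P i) F i) = \sum_(i <- r | P i) inner x (F i).
Proof. exact: (big_morph _ (innerDr x) (inner0r x)). Qed.

Lemma inner_suml I (r : seq I) (P : pred I) (F : I -> H) x :
  inner (\sum_(i <- r | P i) F i) x = \sum_(i <- r | P i) inner (F i) x.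
Proof. by elim/big_rec2: _ => [|i y z _ <-]; rewrite ?inner0l ?innerDl. Qed.

Lemma innerxx x : inner x x = (l2norm x ^+ 2)%:C%C.
Proof.
have -> : inner x x = csum (fun s => (normc (x s) ^+ 2)%:C%C).
  by congr csum; apply/funext => s; rewrite -mulc_conj.
rewrite /csum; congr (_ +i* _)%C.
  rewrite rsum_ge0E => [|s]; last by rewrite sqr_ge0.
  by apply: EFin_inj; rewrite sqr_l2norm fineK// l2_fin.
rewrite rsum_ge0E => [|s]; last by [].
by rewrite esum1.
Qed.

Lemma delta_inner t x : inner x (delta R t) = (x t)^*.
Proof. by rewrite innerC inner_delta. Qed.

Lemma l2norm0 : l2norm (0 : H) = 0.
Proof.
have /eqP := innerxx 0; rewrite inner0l eq_complex /= eqxx andbT eq_sym.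
by rewrite sqrf_eq0 => /eqP.
Qed.

Lemma l2norm_eq0 x : l2norm x = 0 -> x = 0.
Proof.
move=> x0; have : sqsum x = 0%E by rewrite -sqr_l2norm x0 expr0n.
move=> h; apply: l2P => s; apply: eq0_normc; apply/eqP; rewrite -sqrf_eq0.
rewrite eq_le sqr_ge0 andbT -lee_fin -[leRHS]h.
apply: (@le_trans _ _ (\sum_(i \in [set s]) (normc (x i) ^+ 2)%:E)%E).
  by rewrite fsbig_set1.
by apply: ereal_sup_ubound; exists [set s] => //; split.
Qed.

Lemma sqr_l2normD x y : l2norm (x + y) ^+ 2 =
  l2norm x ^+ 2 + complex.Re (inner x y) *+ 2 + l2norm y ^+ 2.
Proof.
have e z : l2norm z ^+ 2 = complex.Re (inner z z) by rewrite innerxx.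
rewrite !e innerDl !innerDr !RecD [inner y x]innerC Rec_conj; ring.
Qed.

Lemma l2normZ a x : l2norm (a *: x) = normc a * l2norm x.
Proof.
apply/eqP; rewrite -(@eqrXn2 _ 2) ?mulr_ge0 ?l2norm_ge0 ?normc_ge0//.
have /eqP := innerxx (a *: x).
rewrite innerZl innerZr mulrA mulc_conj innerxx -rmorphM eq_complex/= eqxx andbT.
by rewrite exprMn eq_sym.
Qed.

Lemma l2normN x : l2norm (- x) = l2norm x.
Proof. by rewrite -scaleN1r l2normZ normcN normc1 mul1r. Qed.

Lemma l2norm_distC x y : l2norm (x - y) = l2norm (y - x).
Proof. by rewrite -l2normN opprB. Qed.

Lemma sqr_l2normB x y : l2norm (x - y) ^+ 2 =
  l2norm x ^+ 2 - complex.Re (inner x y) *+ 2 + l2norm y ^+ 2.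
Proof. by rewrite sqr_l2normD l2normN innerNr RecN mulNrn. Qed.

Lemma parallelogram x y : l2norm (x + y) ^+ 2 + l2norm (x - y) ^+ 2 =
  (l2norm x ^+ 2 + l2norm y ^+ 2) *+ 2.
Proof. rewrite sqr_l2normD sqr_l2normB; ring. Qed.

Lemma Re_inner_le x y : complex.Re (inner x y) <= l2norm x * l2norm y.
Proof.
have [x0|x0] := eqVneq (l2norm x) 0.
  by rewrite x0 mul0r (l2norm_eq0 x0) inner0l.
have [y0|y0] := eqVneq (l2norm y) 0.
  by rewrite y0 mulr0 (l2norm_eq0 y0) inner0r.
have xp : 0 < l2norm x by rewrite lt0r x0 l2norm_ge0.
have yp : 0 < l2norm y by rewrite lt0r y0 l2norm_ge0.
(* Expanding the squared norm of [|y| x - |x| y] gives the claim multiplied by [2 |x| |y|]. *)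
have := sqr_ge0 (l2norm ((l2norm y)%:C%C *: x - (l2norm x)%:C%C *: y)).
rewrite sqr_l2normB !l2normZ !normc_real !gtr0_norm//.
rewrite innerZl innerZr conj_realC !Re_realM.
move: (complex.Re (inner x y)) (l2norm x) (l2norm y) xp yp => c u v u0 v0 h.
have uv0 : 0 < u * v by rewrite mulr_gt0.
rewrite -(ler_pM2l uv0); nra.
Qed.

Lemma cauchy_schwarz x y : normc (inner x y) <= l2norm x * l2norm y.
Proof.
have [u u1 hu] := exists_phase (inner x y).
have := Re_inner_le x (u *: y).
by rewrite innerZr hu l2normZ u1 mul1r.
Qed.

Lemma ler_l2normD x y : l2norm (x + y) <= l2norm x + l2norm y.
Proof.
rewrite -ler_sqr ?nnegrE ?addr_ge0 ?l2norm_ge0// sqr_l2normD sqrrD.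
by rewrite lerD2r lerD2l lerMn2r Re_inner_le orbT.
Qed.

Lemma ler_l2normB x y : l2norm (x - y) <= l2norm x + l2norm y.
Proof. by rewrite -[l2norm y]l2normN ler_l2normD. Qed.

Lemma ler_l2norm_sum I (r : seq I) (P : pred I) (F : I -> H) :
  l2norm (\sum_(i <- r | P i) F i) <= \sum_(i <- r | P i) l2norm (F i).
Proof.
elim/big_rec2: _ => [|i y x _ h]; first by rewrite l2norm0.
by apply: le_trans (ler_l2normD _ _) _; rewrite lerD2l.
Qed.

Lemma l2norm_delta t : l2norm (delta R t : H) = 1.
Proof.
have e : l2norm (delta R t : H) ^+ 2 = 1.
  by apply: (@complexI R); rewrite -innerxx inner_delta/= eqxx.
by apply/eqP; rewrite -(@eqrXn2 _ 2) ?l2norm_ge0// e expr1n.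
Qed.

Lemma normc_coord x s : normc (x s) <= l2norm x.
Proof.
by rewrite -inner_delta (le_trans (cauchy_schwarz _ _))// l2norm_delta mul1r.
Qed.

Lemma inner_ext x y : (forall z, inner z x = inner z y) -> x = y.
Proof. by move=> h; apply: l2P => s; rewrite -!inner_delta h. Qed.

Lemma l2norm_le_inner x (c : R) : 0 <= c ->
  (forall y, l2norm y <= 1 -> normc (inner y x) <= c) -> l2norm x <= c.
Proof.
move=> c0 h; have [x0|x0] := eqVneq (l2norm x) 0; first by rewrite x0.
have xp : 0 < l2norm x by rewrite lt0r x0 l2norm_ge0.
have := h (((l2norm x)^-1)%:C%C *: x).
rewrite l2normZ innerZl conj_realC normcM !normc_real ger0_norm ?invr_ge0 ?l2norm_ge0//.
by rewrite mulVf// innerxx normc_real ger0_norm ?sqr_ge0// expr2 mulKf//; apply.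
Qed.

Definition fvec (F : {fset G}) (f : G -> C) : H := \sum_(s <- F) f s *: delta R s.

Lemma fvec_coord F f s : fvec F f s = if s \in F then f s else 0.
Proof.
rewrite -inner_delta inner_sumr; case: ifPn => sF.
  rewrite (bigD1_seq s) ?fset_uniq//= big1 => [|t ts].
    by rewrite addr0 innerZr inner_delta/= eqxx mulr1.
  by rewrite innerZr inner_delta/= eq_sym (negbTE ts) mulr0.
rewrite big_seq big1// => t tF; rewrite innerZr inner_delta/=.
by case: eqP => [st|]; [rewrite st tF in sF|rewrite mulr0].
Qed.

Lemma inner_fvecr F f x : inner x (fvec F f) = \sum_(s <- F) (x s)^* * f s.
Proof.
rewrite inner_sumr; apply: eq_bigr => s _.
by rewrite innerZr delta_inner mulrC.
Qed.

Lemma inner_fvecl F f x : inner (fvec F f) x = \sum_(s <- F) (f s)^* * x s.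
Proof.
rewrite inner_suml; apply: eq_bigr => s _.
by rewrite innerZl inner_delta.
Qed.

Lemma sqr_l2norm_fvec F f : l2norm (fvec F f) ^+ 2 = \sum_(s <- F) normc (f s) ^+ 2.
Proof.
transitivity (complex.Re (inner (fvec F f) (fvec F f))); first by rewrite innerxx.
rewrite inner_fvecl.
rewrite (_ : \sum_(s <- F) _ = (\sum_(s <- F) normc (f s) ^+ 2)%:C%C)//.
rewrite rmorph_sum big_seq [RHS]big_seq; apply: eq_bigr => s sF.
by rewrite /= fvec_coord sF mulc_conj.
Qed.

Definition fproj (F : {fset G}) x : H := fvec F x.

Lemma fproj_coord F x s : fproj F x s = if s \in F then x s else 0.
Proof. exact: fvec_coord. Qed.

Lemma inner_fprojr F x y : inner x (fproj F y) = \sum_(s <- F) (x s)^* * y s.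
Proof. exact: inner_fvecr. Qed.

Lemma inner_fproj F x y : inner (fproj F x) y = inner x (fproj F y).
Proof.
by rewrite inner_fprojr inner_fvecl.
Qed.

Lemma fproj_idem F x : fproj F (fproj F x) = fproj F x.
Proof. by apply: l2P => s; rewrite !fproj_coord; case: (s \in F). Qed.

Lemma sqr_l2norm_fproj F x : l2norm (fproj F x) ^+ 2 = \sum_(s <- F) normc (x s) ^+ 2.
Proof. exact: sqr_l2norm_fvec. Qed.

Lemma sqr_l2norm_fprojB F x :
  l2norm (x - fproj F x) ^+ 2 = l2norm x ^+ 2 - l2norm (fproj F x) ^+ 2.
Proof.
rewrite sqr_l2normB -[in inner x _]fproj_idem -inner_fproj innerxx /=; ring.
Qed.

Lemma l2norm_fproj F x : l2norm (fproj F x) <= l2norm x.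
Proof.
rewrite -ler_sqr ?nnegrE ?l2norm_ge0// -subr_ge0 -sqr_l2norm_fprojB; exact: sqr_ge0.
Qed.

Lemma fprojD F x y : fproj F (x + y) = fproj F x + fproj F y.
Proof. by apply: l2P => s; rewrite !(l2_addE, fproj_coord); case: ifP; rewrite ?addr0. Qed.

Lemma fprojZ F a x : fproj F (a *: x) = a *: fproj F x.
Proof. by apply: l2P => s; rewrite !(l2_scaleE, fproj_coord); case: ifP; rewrite ?mulr0. Qed.

(** The bound holds for every larger [F'], so that several vectors can be approximated with a common
    finite set. *)
Lemma fproj_approx x (e : R) : 0 < e ->
  exists F, forall F', (F `<=` F')%fset -> l2norm (x - fproj F' x) <= e.
Proof.
move=> e0.
have e2 : (0 < (e ^+ 2))%R by rewrite exprn_gt0.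
have fx : (ereal_sup [set (\sum_(i \in A) (normc (x i) ^+ 2)%:E)%E | A in fsets [set: G]]) \is a fin_num.
  exact: (l2_fin x).
have [_ [A [finA _] <-]] := ub_ereal_sup_adherent e2 fx.
rewrite -[ereal_sup _]/(sqsum x) -sqr_l2norm -EFinB => hA.
exists (fset_set A) => F' AF'.
rewrite -ler_sqr ?nnegrE ?l2norm_ge0 ?(ltW e0)// sqr_l2norm_fprojB lerBlDr -lerBlDl.
apply: ltW; rewrite -lte_fin; apply: lt_le_trans hA _.
rewrite fsbig_finite//= sumEFin lee_fin sqr_l2norm_fproj.
rewrite [leRHS](bigID (mem (fset_set A)))/=.
apply: (@le_trans _ _ (\sum_(i <- F' | i \in fset_set A) normc (x i) ^+ 2)).
  rewrite -big_filter [leRHS]big_mkcond -[leRHS]big_mkcond -[leRHS]big_filter.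
  rewrite le_eqVlt; apply/orP; left; apply/eqP/perm_big.
  apply: uniq_perm; rewrite ?filter_uniq ?fset_uniq// => s.
  rewrite !mem_filter; case: (boolP (s \in fset_set A)) => //= sA.
  by rewrite (fsubsetP AF').
by rewrite lerDl sumr_ge0// => s _; rewrite sqr_ge0.
Qed.

Lemma fproj_approx_fin (I : finType) (x : I -> H) (e : R) : 0 < e ->
  exists F, forall F', (F `<=` F')%fset -> forall i, l2norm (x i - fproj F' (x i)) <= e.
Proof.
move=> e0; have /choice[F hF] := fun i => fproj_approx (x i) e0.
exists (\bigcup_(i in I) F i)%fset => F' FF' i; apply: hF.
by apply: fsubset_trans FF'; apply: bigfcup_sup; rewrite ?mem_index_enum.
Qed.

End hilbert.

(** * Limits of complex numbers and completeness of l^2(G) *)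

Section limits.
Variables (R : realType) (G : groupType).
Local Notation C := R[i].
Local Notation H := (l2 R G).

Lemma real_cauchy_cvg (u : nat -> R) :
  (forall e, 0 < e -> exists N, forall m n, (N <= m)%N -> (N <= n)%N ->
    `|u m - u n| <= e) ->
  exists l, forall e, 0 < e -> exists N, forall n, (N <= n)%N -> `|u n - l| <= e.
Proof.
move=> hu.
have hc : cvg (u n @[n --> \oo]).
  apply/cauchy_cvgP/cauchy_ballP => e e0.
  have [N hN] := hu (e / 2) (divr_gt0 e0 (ltr0Sn _ _)).
  exists ([set u n | n in [set n | (N <= n)%N]],
          [set u n | n in [set n | (N <= n)%N]]).
    by split=> /=; exists N => // n /= Nn; exists n.
  move=> [_ _] /= [[m Nm <-] [n Nn <-]].
  rewrite -ball_normE/=; apply: le_lt_trans (hN _ _ Nm Nn) _.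
  by rewrite ltr_pdivrMr// ltr_pMr// ltr1n.
exists (lim (u n @[n --> \oo])) => e e0.
have /cvgrPdist_le /(_ e e0) [N _ hN] := hc.
by exists N => n Nn; rewrite distrC; apply: hN.
Qed.

Definition ccvg (z : nat -> C) (l : C) :=
  forall e : R, 0 < e -> exists N, forall n, (N <= n)%N -> normc (z n - l) <= e.

Definition ccauchy (z : nat -> C) := forall e : R, 0 < e ->
  exists N, forall m n, (N <= m)%N -> (N <= n)%N -> normc (z m - z n) <= e.

Lemma ccauchy_cvg z : ccauchy z -> exists l, ccvg z l.
Proof.
move=> hz.
have [|lr hr] := @real_cauchy_cvg (fun n => complex.Re (z n)).
  move=> e e0; have [N hN] := hz e e0; exists N => m n Nm Nn.
  by rewrite -RecN -RecD (le_trans (normc_Re _))// hN.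
have [|li hi] := @real_cauchy_cvg (fun n => complex.Im (z n)).
  move=> e e0; have [N hN] := hz e e0; exists N => m n Nm Nn.
  by rewrite -ImcN -ImcD (le_trans (normc_Im _))// hN.
exists (lr +i* li)%C => e e0; have e2 : 0 < e / 2 by rewrite divr_gt0.
have [N1 h1] := hr _ e2; have [N2 h2] := hi _ e2.
exists (maxn N1 N2) => n; rewrite geq_max => /andP[n1 n2].
apply: le_trans (normc_le_ReIm _) _; rewrite RecD ImcD RecN ImcN/=.
by rewrite [leRHS](splitr e) lerD ?h1 ?h2.
Qed.

Lemma normc_le_eps (z : C) : (forall e : R, 0 < e -> normc z <= e) -> z = 0.
Proof.
move=> h; apply/eq0_normc/le_anti; rewrite normc_ge0 andbT.
by apply/ler_addgt0Pr => e e0; rewrite add0r h.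
Qed.

Lemma ccvg_unique z l l' : ccvg z l -> ccvg z l' -> l = l'.
Proof.
move=> h h'; apply/eqP; rewrite -subr_eq0; apply/eqP/normc_le_eps => e e0.
have e2 : 0 < e / 2 by rewrite divr_gt0.
have [N1 h1] := h _ e2; have [N2 h2] := h' _ e2.
set n := maxn N1 N2.
have -> : l - l' = (z n - l') - (z n - l) by ring.
apply: le_trans (le_normcD _ _) _; rewrite normcN [leRHS](splitr e).
by rewrite lerD ?h1 ?h2// leq_max leqnn ?orbT.
Qed.

Lemma ccvg_cst (c : C) : ccvg (fun=> c) c.
Proof. by move=> e e0; exists 0 => n _; rewrite subrr normc0 ltW. Qed.

Lemma ccvgD z z' l l' : ccvg z l -> ccvg z' l' -> ccvg (fun n => z n + z' n) (l + l').
Proof.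
move=> h h' e e0; have e2 : 0 < e / 2 by rewrite divr_gt0.
have [N1 h1] := h _ e2; have [N2 h2] := h' _ e2.
exists (maxn N1 N2) => n; rewrite geq_max => /andP[n1 n2].
rewrite opprD addrACA; apply: le_trans (le_normcD _ _) _.
by rewrite [leRHS](splitr e) lerD ?h1 ?h2.
Qed.

Lemma ccvgZ (c : C) z l : ccvg z l -> ccvg (fun n => c * z n) (c * l).
Proof.
move=> h e e0; have c0 : 0 < normc c + 1 by rewrite ltr_wpDl ?normc_ge0.
have [N hN] := h _ (divr_gt0 e0 c0); exists N => n /hN.
rewrite -mulrBr normcM ler_pdivlMr// mulrC; apply: le_trans.
by rewrite ler_wpM2r ?normc_ge0// lerDl.
Qed.

Lemma ccvg_sum (I : Type) (r : seq I) (P : pred I) (z : I -> nat -> C) (l : I -> C) :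
  (forall i, P i -> ccvg (z i) (l i)) ->
  ccvg (fun n => \sum_(i <- r | P i) z i n) (\sum_(i <- r | P i) l i).
Proof.
move=> h; elim: r => [|i r ih].
  by rewrite big_nil; under eq_fun do rewrite big_nil; exact: ccvg_cst.
rewrite big_cons; under eq_fun do rewrite big_cons.
by case: ifP => // Pi; apply: ccvgD => //; exact: h.
Qed.

Lemma ccvg_norm_le z l (c : R) : ccvg z l ->
  (forall e, 0 < e -> exists N, forall n, (N <= n)%N -> normc (z n) <= c + e) ->
  normc l <= c.
Proof.
move=> h h'; apply/ler_addgt0Pr => e e0; have e2 : 0 < e / 2 by rewrite divr_gt0.
have [N1 h1] := h _ e2; have [N2 h2] := h' _ e2.
set n := maxn N1 N2.
have -> : l = z n - (z n - l) by ring.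
apply: le_trans (le_normcD _ _) _; rewrite normcN [e](splitr e) addrA.
by rewrite lerD ?h1 ?h2// leq_max leqnn ?orbT.
Qed.

Lemma eq_ccvg z z' l : (forall n, z n = z' n) -> ccvg z l -> ccvg z' l.
Proof. by move=> /funext ->. Qed.

Lemma sqsum_le (f : G -> C) (c : R) :
  (forall F : {fset G}, \sum_(s <- F) normc (f s) ^+ 2 <= c) -> (sqsum f <= c%:E)%E.
Proof.
move=> h; apply: ge_ereal_sup => _ [A [finA _] <-].
by rewrite fsbig_finite//= sumEFin lee_fin.
Qed.

Lemma l2_of_bounded (f : G -> C) (c : R) :
  (forall F : {fset G}, \sum_(s <- F) normc (f s) ^+ 2 <= c) ->
  exists2 x : H, (forall s, x s = f s) & l2norm x ^+ 2 <= c.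
Proof.
move=> h; have hf : f \in @l2_pred R G.
  by rewrite inE /=; apply: le_lt_trans (sqsum_le h) (ltry _).
exists (L2 hf) => //; rewrite -lee_fin sqr_l2norm; exact: sqsum_le.
Qed.

Lemma l2norm_le_fin (x : H) (c : R) : 0 <= c ->
  (forall F : {fset G}, \sum_(s <- F) normc (x s) ^+ 2 <= c ^+ 2) -> l2norm x <= c.
Proof.
move=> c0 h; rewrite -ler_sqr ?nnegrE ?l2norm_ge0// -lee_fin sqr_l2norm.
exact: sqsum_le.
Qed.

Lemma sum_normc_le (x : H) (F : {fset G}) :
  \sum_(s <- F) normc (x s) ^+ 2 <= l2norm x ^+ 2.
Proof. by rewrite -sqr_l2norm_fproj ler_sqr ?nnegrE ?l2norm_ge0// l2norm_fproj. Qed.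

Definition hcvg (x : nat -> H) (l : H) :=
  forall e : R, 0 < e -> exists N, forall n, (N <= n)%N -> l2norm (x n - l) <= e.

Definition hcauchy (x : nat -> H) := forall e : R, 0 < e ->
  exists N, forall m n, (N <= m)%N -> (N <= n)%N -> l2norm (x m - x n) <= e.

(** The coordinatewise limit [y] is not known to be square summable, so only finite restrictions of
    [x m - y] are estimated at the start. Those of [x N0 - y] have norm at most 1, which yields a
    vector [z], and the limit is [x N0 - z]. *)
Lemma l2_complete x : hcauchy x -> exists l, hcvg x l.
Proof.
move=> hx.
have /choice[y hy] : forall s, exists l, ccvg (fun n => x n s) l.
  move=> s; apply: ccauchy_cvg => e /hx[N hN]; exists N => m n Nm Nn.
  rewrite -l2_oppE -l2_addE; apply: le_trans (normc_coord _ _) (hN _ _ Nm Nn).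
have key (e : R) N : 0 < e ->
    (forall m n, (N <= m)%N -> (N <= n)%N -> l2norm (x m - x n) <= e) ->
    forall m, (N <= m)%N -> forall F : {fset G},
      l2norm (fvec F (fun s => x m s - y s)) <= e.
  move=> e0 hN m Nm F; apply/ler_addgt0Pr => d d0.
  have cF : ccvg (fun n => \sum_(s <- F) (normc (x n s - y s))%:C%C) 0.
    have := @ccvg_sum _ F predT (fun s n => (normc (x n s - y s))%:C%C) (fun=> 0).
    rewrite big1//; apply => s _.
    move=> d' /(hy s)[M hM]; exists M => n Mn.
    by rewrite subr0 normc_real ger0_norm ?normc_ge0 ?hM.
  have [M hM] := cF _ d0; set n := maxn N M.
  have -> : fvec F (fun s => x m s - y s) =
      fproj F (x m - x n) + fvec F (fun s => x n s - y s).
    rewrite /fproj /fvec -big_split; apply: eq_bigr => s _ /=.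
    by rewrite -scalerDl; congr (_ *: _); rewrite addrA subrK.
  apply: le_trans (ler_l2normD _ _) _; apply: lerD.
    by apply: le_trans (l2norm_fproj _ _) _; rewrite hN// leq_maxl.
  apply: le_trans (ler_l2norm_sum _ _ _) _.
  have := hM n (leq_maxr _ _).
  rewrite subr0 -rmorph_sum normc_real => /(le_trans (ler_norm _)); apply: le_trans.
  by apply: ler_sum => s _; rewrite l2normZ l2norm_delta mulr1.
have [N0 h0] := hx 1 ltr01.
have [|z hz _] := @l2_of_bounded (fun s => x N0 s - y s) (1 ^+ 2).
  move=> F; rewrite -sqr_l2norm_fvec ler_sqr ?nnegrE ?l2norm_ge0//.
  exact: key (h0) _ _ _.
exists (x N0 - z) => e e0; have [N hN] := hx e e0; exists N => m Nm.
apply: l2norm_le_fin; first exact: ltW.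
move=> F; have := key _ _ e0 hN m Nm F.
rewrite -ler_sqr ?nnegrE ?l2norm_ge0 ?(ltW e0)// sqr_l2norm_fvec; apply: le_trans.
rewrite le_eqVlt; apply/orP; left; apply/eqP; apply: eq_bigr => s _.
by rewrite !l2_addE !l2_oppE l2_addE l2_oppE hz; congr (normc _ ^+ 2); ring.
Qed.

Lemma hcvg_inner x l (y : H) : hcvg x l -> ccvg (fun n => inner y (x n)) (inner y l).
Proof.
move=> h e e0; have c0 : 0 < l2norm y + 1 by rewrite ltr_wpDl ?l2norm_ge0.
have [N hN] := h _ (divr_gt0 e0 c0); exists N => n /hN.
rewrite -innerBr ler_pdivlMr// mulrC; apply: le_trans.
apply: le_trans (cauchy_schwarz _ _) _.
by rewrite ler_wpM2r ?l2norm_ge0// lerDl.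
Qed.

End limits.

(** * Bounded operators, matrix entries and translations *)

Section bounded_operators.
Variables (R : realType) (G : groupType).
Local Notation C := R[i].
Local Notation H := (l2 R G).
Local Notation B := (bop R G).
Implicit Types (S T : B) (x y : H).

Lemma bopD T x y : T (x + y) = T x + T y.
Proof. by have [h _] := bopP T; rewrite -[x]scale1r h !scale1r. Qed.

Lemma bop0 T : T 0 = 0.
Proof. by apply: (addIr (T 0)); rewrite -bopD !add0r. Qed.

Lemma bopZ T (a : C) x : T (a *: x) = a *: T x.
Proof. by have [h _] := bopP T; rewrite -[a *: x]addr0 h bop0 addr0. Qed.

Lemma bopN T x : T (- x) = - T x.
Proof. by rewrite -scaleN1r bopZ scaleN1r. Qed.

Lemma bopB T x y : T (x - y) = T x - T y.
Proof. by rewrite bopD bopN. Qed.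

Lemma bop_sum T I (r : seq I) (P : pred I) (F : I -> H) :
  T (\sum_(i <- r | P i) F i) = \sum_(i <- r | P i) T (F i).
Proof. by elim/big_rec2: _ => [|i y z _ <-]; rewrite ?bop0 ?bopD. Qed.

Lemma bop_addE S T x : (S + T) x = S x + T x. Proof. by []. Qed.
Lemma bop_scaleE (a : C) T x : (a *: T) x = a *: T x. Proof. by []. Qed.
Lemma bop_oppE T x : (- T) x = - T x. Proof. by []. Qed.

Lemma bop_sumE I (r : seq I) (P : pred I) (F : I -> B) x :
  (\sum_(i <- r | P i) F i) x = \sum_(i <- r | P i) F i x.
Proof. by elim/big_rec2: _ => [//|i y z _ <-]. Qed.

Lemma bop_ext S T : (forall x, S x = T x) -> S = T.
Proof. by move=> h; apply/val_inj/funext. Qed.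

Lemma opnorm_le T (c : R) : 0 <= c ->
  (forall x, l2norm x <= 1 -> l2norm (T x) <= c) -> opnorm T <= c.
Proof.
move=> c0 h; apply: ge_sup; first by have [] := opnorm_has_sup T.
by move=> _ [x /= x1 <-]; exact: h.
Qed.

Lemma l2norm_bop T x : l2norm (T x) <= opnorm T * l2norm x.
Proof.
have [x0|x0] := eqVneq (l2norm x) 0.
  by rewrite (l2norm_eq0 x0) bop0 l2norm0 mulr0.
have xp : 0 < l2norm x by rewrite lt0r x0 l2norm_ge0.
rewrite -ler_pdivrMr// mulrC.
have [_ ub] := opnorm_has_sup T; apply: ub_le_sup => //.
exists (((l2norm x)^-1)%:C%C *: x) => /=.
  by rewrite l2normZ normc_real ger0_norm ?invr_ge0 ?l2norm_ge0// mulVf.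
by rewrite bopZ l2normZ normc_real ger0_norm// invr_ge0 l2norm_ge0.
Qed.

Lemma normc_inner_bop T x y : normc (inner x (T y)) <= opnorm T * (l2norm x * l2norm y).
Proof.
apply: le_trans (cauchy_schwarz _ _) _.
by rewrite mulrCA ler_wpM2l ?l2norm_ge0// l2norm_bop.
Qed.

Lemma opnorm_le_inner T (c : R) : 0 <= c ->
  (forall x y, l2norm x <= 1 -> l2norm y <= 1 -> normc (inner x (T y)) <= c) ->
  opnorm T <= c.
Proof.
move=> c0 h; apply: opnorm_le => // y y1.
by apply: l2norm_le_inner => // x x1; exact: h.
Qed.

Lemma bop_delta_ext S T :
  (forall s t, (S (delta R t)) s = (T (delta R t)) s) -> S = T.
Proof.
move=> h.
have hd t : S (delta R t) = T (delta R t) by apply: l2P.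
have hf F x : S (fproj F x) = T (fproj F x).
  by rewrite !bop_sum; apply: eq_bigr => s _; rewrite !bopZ hd.
apply: bop_ext => x; apply/eqP; rewrite -subr_eq0; apply/eqP/l2norm_eq0/le_anti.
rewrite l2norm_ge0 andbT; apply/ler_addgt0Pr => e e0; rewrite add0r.
have c0 : 0 < opnorm S + opnorm T + 1 by rewrite ltr_wpDl ?addr_ge0 ?opnorm_ge0.
have [F hF] := fproj_approx x (divr_gt0 e0 c0).
have := hF F (fsubset_refl F).
have -> : S x - T x = S (x - fproj F x) - T (x - fproj F x).
  by rewrite !bopB hf opprB addrA subrK.
rewrite ler_pdivlMr// mulrC; apply: le_trans.
apply: le_trans (ler_l2normB _ _) _.
apply: le_trans (lerD (l2norm_bop S _) (l2norm_bop T _)) _.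
by rewrite -mulrDl ler_wpM2r ?l2norm_ge0// lerDl.
Qed.

Lemma l2norm_transl g x : l2norm (transl R g x) = l2norm x.
Proof. by rewrite /l2norm /= sqsum_transl. Qed.

(** Polarization: preservation of norms gives the real parts, and the real parts at ['i x] give the
    imaginary parts. *)
Lemma inner_transl g x y : inner (transl R g x) (transl R g y) = inner x y.
Proof.
have h u v : complex.Re (inner (transl R g u) (transl R g v)) = complex.Re (inner u v).
  have := sqr_l2normD (transl R g u) (transl R g v).
  rewrite -bopD !l2norm_transl sqr_l2normD => /addIr/addrI/eqP.
  by rewrite eqrMn2r /= => /eqP.
have := h ('i%C *: x) y; rewrite bopZ !innerZl !Re_conj_iM => h'.
by apply/eqP; rewrite eq_complex h h' !eqxx.
Qed.

Lemma inner_transl_inv g x y : inner (transl R (g^-1)%g x) y = inner x (transl R g y).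
Proof.
have e : transl R g (transl R (g^-1)%g x) = x.
  by apply: l2P => s /=; rewrite invgK mulVKg.
by rewrite -(inner_transl g _ y) e.
Qed.

End bounded_operators.

(** The common ending of approximation arguments: [K] collects the constants that do not depend on
    [e]. *)
Lemma ler_addeps (R : realType) (a b K : R) :
  (forall e : R, 0 < e -> a <= b + e * K) -> a <= b.
Proof.
move=> h; apply/ler_addgt0Pr => e e0.
have K0 : 0 < `|K| + 1 by rewrite ltr_wpDl.
apply: le_trans (h _ (divr_gt0 e0 K0)) _; rewrite lerD2l -mulrA ler_piMr ?(ltW e0)//.
by rewrite mulrC ler_pdivrMr// mul1r (le_trans (ler_norm K))// lerDl.
Qed.

(** * Schur multipliers on Bessel families *)

Section bessel_families.
Variables (R : realType) (G : groupType).
Local Notation C := R[i].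
Local Notation H := (l2 R G).
Local Notation B := (bop R G).

(** The coefficient map into l^2(I) is a contraction, a property stable under projections. *)
Definition bessel (I : finType) (l : I -> H) :=
  forall x, \sum_i normc (inner (l i) x) ^+ 2 <= l2norm x ^+ 2.

(** The second index is the group element [g] over which the Gram matrix of the
    Schur multiplier is summed. *)
Definition bessel_rows (I J : finType) (l : I -> J -> H) :=
  (forall x, \sum_i \sum_j normc (inner (l i j) x) ^+ 2 <= l2norm x ^+ 2) /\
  (forall i, \sum_j l2norm (l i j) ^+ 2 <= 1).

(** The unit ball of the dual of l^p(I), in the shape in which Young's inequality
    applies to it: [b ^ (r - 1)] is the generic weight of l^q, [q] being the
    exponent conjugate to [r]. For [r = 1] it is 1, also where [b] vanishes. *)
Definition weights (p : \bar R) (I : finType) (c : I -> C) : Prop :=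
  if p is r%:E then
    exists b : I -> R, [/\ forall i, 0 <= b i,
      forall i, normc (c i) <= b i `^ (r - 1) & \sum_i b i `^ r <= 1]
  else \sum_i normc (c i) <= 1.

(** Each coefficient of a pairing becomes a sum over [j]: this is what a single pairing turns into
    under Schur multiplication by a Gram matrix. *)
Definition rows_bound p (S : B) (M : R) :=
  forall (I J : finType) (l k : I -> J -> H) (c : I -> C),
  bessel_rows l -> bessel_rows k -> weights p c ->
  normc (\sum_i c i * \sum_j inner (l i j) (S (k i j))) <= M.

Definition pairing_bound p (S : B) (M : R) :=
  forall (I : finType) (l k : I -> H) (c : I -> C),
  bessel l -> bessel k -> weights p c ->
  normc (\sum_i c i * inner (l i) (S (k i))) <= M.

(** The pairing read off finite squares of entries, meaningful before [K] is known to be the matrix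
    of a bounded operator. *)
Definition matrix_bound p (K : G -> G -> C) (M : R) :=
  forall (F : {fset G}) (I : finType) (l k : I -> H) (c : I -> C),
  bessel l -> bessel k -> weights p c ->
  normc (\sum_i c i * \sum_(s <- F) \sum_(t <- F) (l i s)^* * K s t * k i t) <= M.

(** Testing at [l i] itself gives [|l i|^4 <= |l i|^2]. *)
Lemma bessel_l2norm (I : finType) (l : I -> H) i : bessel l -> l2norm (l i) <= 1.
Proof.
move=> /(_ (l i)) h; have [->|n0] := eqVneq (l2norm (l i)) 0; first exact: ler01.
have np : 0 < l2norm (l i) by rewrite lt0r n0 l2norm_ge0.
have : normc (inner (l i) (l i)) ^+ 2 <= l2norm (l i) ^+ 2.
  apply: le_trans h; rewrite (bigD1 i)//= lerDl sumr_ge0// => j _.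
  exact: sqr_ge0.
rewrite innerxx normc_real ger0_norm ?sqr_ge0// expr2.
by rewrite ger_pMl ?exprn_gt0// expr_le1// l2norm_ge0.
Qed.

Lemma sqr_normc_inner_le1 x y : l2norm x <= 1 ->
  normc (inner x y) ^+ 2 <= l2norm (y : H) ^+ 2.
Proof.
move=> x1; rewrite ler_sqr ?nnegrE ?normc_ge0 ?l2norm_ge0//.
by apply: le_trans (cauchy_schwarz _ _) _; rewrite ler_piMl ?l2norm_ge0.
Qed.

Lemma bessel_unit (x : H) : l2norm x <= 1 -> bessel (fun _ : unit => x).
Proof.
by move=> x1 y; rewrite big_const card_unit /= addr0 sqr_normc_inner_le1.
Qed.

(** Let [v] be the sum of the [a i *: l i]. Then [<v, x>] is the sum of the [normc (a i) ^+ 2],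
    which also bounds [|v|^2] because the norms are at most 1; expand [|v - x|^2 >= 0]. *)
Lemma bessel_orthogonal (I : finType) (l : I -> H) :
  (forall i j, i != j -> inner (l i) (l j) = 0) ->
  (forall i, l2norm (l i) <= 1) -> bessel l.
Proof.
move=> ol l1 x; set a := fun i => inner (l i) x.
pose v := \sum_i a i *: l i.
have vx : inner v x = (\sum_i normc (a i) ^+ 2)%:C%C.
  rewrite inner_suml rmorph_sum; apply: eq_bigr => i _.
  by rewrite innerZl mulc_conj.
have vv : inner v v = (\sum_i normc (a i) ^+ 2 * l2norm (l i) ^+ 2)%:C%C.
  rewrite inner_suml rmorph_sum; apply: eq_bigr => i _.
  rewrite inner_sumr (bigD1 i)//= big1 => [|j ji].
    by rewrite addr0 innerZl innerZr innerxx mulrA mulc_conj [RHS]rmorphM.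
  by rewrite innerZl innerZr ol 1?eq_sym// !mulr0.
have := sqr_ge0 (l2norm (v - x)); rewrite sqr_l2normB vx /=.
have -> : l2norm v ^+ 2 = \sum_i normc (a i) ^+ 2 * l2norm (l i) ^+ 2.
  by apply: (@complexI R); rewrite -innerxx vv.
have : \sum_i normc (a i) ^+ 2 * l2norm (l i) ^+ 2 <= \sum_i normc (a i) ^+ 2.
  by apply: ler_sum => i _; rewrite ler_piMr ?sqr_ge0// expr_le1 ?l2norm_ge0.
by rewrite mulr2n; lra.
Qed.

Lemma bessel_rows_unit (I : finType) (l : I -> H) :
  bessel l -> bessel_rows (fun i (_ : unit) => l i).
Proof.
move=> bl; split=> [x|i]; last first.
  by rewrite big_const card_unit /= addr0 expr_le1 ?l2norm_ge0// bessel_l2norm.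
by under eq_bigr do rewrite big_const card_unit /= addr0; exact: bl.
Qed.

Lemma bessel_rows_fproj (I J : finType) (l : I -> J -> H) F :
  bessel_rows l -> bessel_rows (fun i j => fproj F (l i j)).
Proof.
move=> [b1 b2]; split=> [x|i].
  under eq_bigr do under eq_bigr do rewrite inner_fproj.
  by apply: le_trans (b1 _) _; rewrite ler_sqr ?nnegrE ?l2norm_ge0// l2norm_fproj.
apply: le_trans (b2 i); apply: ler_sum => j _.
by rewrite ler_sqr ?nnegrE ?l2norm_ge0// l2norm_fproj.
Qed.

Lemma rows_bound_pairing p S M : rows_bound p S M -> pairing_bound p S M.
Proof.
move=> h I l k c bl bk wc.
have := h I unit _ _ c (bessel_rows_unit bl) (bessel_rows_unit bk) wc.
by under eq_bigr do rewrite big_const card_unit /= addr0.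
Qed.

Lemma weights_le1 (p : \bar R) (I : finType) (c : I -> C) i :
  (1 <= p)%E -> weights p c -> normc (c i) <= 1.
Proof.
have le_sum (f : I -> R) : (forall j, 0 <= f j) -> f i <= \sum_j f j.
  by move=> f0; rewrite (bigD1 i)//= lerDl sumr_ge0.
case: p => [r| |]//=.
  rewrite lee_fin => r1 [b [b0 hc hb]].
  have bi1 : b i <= 1.
    rewrite leNgt; apply/negP => bi1.
    have : 1 `^ r < b i `^ r.
      by rewrite gt0_ltr_powR ?nnegrE ?(lt_le_trans _ r1)// ltW.
    rewrite powR1.
    rewrite ltNge; apply/negP; rewrite negbK; apply: le_trans hb.
    by apply: (le_sum (fun i => b i `^ r)) => j; rewrite powR_ge0.
  apply: le_trans (hc i) _.
  suff : b i `^ (r - 1) <= 1 `^ (r - 1) by rewrite powR1.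
  by rewrite ge0_ler_powR ?nnegrE ?subr_ge0.
move=> _ /(le_trans _); apply.
by apply: (le_sum (fun i => normc (c i))) => j; exact: normc_ge0.
Qed.

Lemma weights_unit (p : \bar R) : weights p (fun _ : unit => 1).
Proof.
case: p => [r| |] /=; last 2 first.
- by rewrite big_const card_unit /= addr0 normc1.
- by rewrite big_const card_unit /= addr0 normc1.
exists (fun=> 1); split=> [//|_|]; first by rewrite powR1 normc1.
by rewrite big_const card_unit /= addr0 powR1.
Qed.

Lemma matrix_bound_ge0 p K M : matrix_bound p K M -> 0 <= M.
Proof.
move=> h; have n0 : l2norm (0 : H) <= 1 by rewrite l2norm0.
apply: le_trans (h fset0 _ _ _ _ (bessel_unit n0) (bessel_unit n0) (weights_unit p)).
exact: normc_ge0.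
Qed.

Lemma rows_bound_ge0 p S M : rows_bound p S M -> 0 <= M.
Proof.
move=> h; have n0 : l2norm (0 : H) <= 1 by rewrite l2norm0.
have bu := bessel_rows_unit (bessel_unit n0).
apply: le_trans (h _ _ _ _ _ bu bu (weights_unit p)).
exact: normc_ge0.
Qed.

Lemma bop_fvec (S : B) (F : {fset G}) (f : G -> C) s :
  S (fvec F f) s = \sum_(t <- F) f t * S (delta R t) s.
Proof.
rewrite bop_sum -inner_delta inner_sumr; apply: eq_bigr => t _.
by rewrite bopZ innerZr inner_delta.
Qed.

Lemma inner_fvec_bop (S : B) (F1 F2 : {fset G}) (f h : G -> C) :
  inner (fvec F1 f) (S (fvec F2 h)) =
  \sum_(s <- F1) \sum_(t <- F2) (f s)^* * S (delta R t) s * h t.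
Proof.
rewrite inner_fvecl; apply: eq_bigr => s _; rewrite bop_fvec mulr_sumr.
by apply: eq_bigr => t _; rewrite mulrA mulrAC.
Qed.

(** These are the vectors [l_i a(g)]. In the inner product with [x] the factor [a] moves from [l i]
    to [x]; the sum over [i] is then controlled by the Bessel property of [l], the sum over [g] by
    [|a s| <= 1]. *)
Lemma bessel_rows_schur (I : finType) (l : I -> H) (a : G -> H) (F F' : {fset G}) :
  bessel l -> (forall s, l2norm (a s) <= 1) ->
  bessel_rows (fun i (g : F') => fvec F (fun s => l i s * a s (val g))).
Proof.
move=> bl a1.
have sum1 s : \sum_(g : F') normc (a s (val g)) ^+ 2 <= 1.
  rewrite -(big_seq_fsetE _ _ predT (fun g => normc (a s g) ^+ 2))/=.
  by apply: le_trans (sum_normc_le _ _) _; rewrite expr_le1 ?l2norm_ge0.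
split=> [x|i]; last first.
  under eq_bigr do rewrite sqr_l2norm_fvec; rewrite exchange_big/=.
  apply: (@le_trans _ _ (\sum_(s <- F) normc (l i s) ^+ 2)).
    apply: ler_sum => s _; under eq_bigr do rewrite normcM exprMn.
    by rewrite -mulr_sumr ler_piMr ?sqr_ge0.
  by apply: le_trans (sum_normc_le _ _) _; rewrite expr_le1 ?l2norm_ge0// bessel_l2norm.
rewrite exchange_big/=.
apply: (@le_trans _ _ (\sum_(g : F') \sum_(s <- F) normc ((a s (val g))^* * x s) ^+ 2)).
  apply: ler_sum => g _; rewrite -sqr_l2norm_fvec; apply: le_trans (bl _).
  rewrite le_eqVlt; apply/orP; left; apply/eqP; apply: eq_bigr => i _.
  rewrite inner_fvecl inner_fvecr; congr (normc _ ^+ 2); apply: eq_bigr => s _.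
  by rewrite rmorphM/= mulrA.
rewrite exchange_big/=; apply: le_trans (sum_normc_le x F); apply: ler_sum => s _.
under eq_bigr do rewrite normcM exprMn normc_conj.
by rewrite -mulr_suml ler_piMl ?sqr_ge0.
Qed.

Lemma schur_gram p (S : B) M (F : {fset G}) (I : finType) (l k : I -> H) (c : I -> C)
    (a b : G -> H) :
  rows_bound p S M -> bessel l -> bessel k -> weights p c ->
  (forall s, l2norm (a s) <= 1) -> (forall s, l2norm (b s) <= 1) ->
  normc (\sum_i c i * \sum_(s <- F) \sum_(t <- F)
    (l i s)^* * (S (delta R t) s * inner (a s) (b t)) * k i t) <= M.
Proof.
move=> hS bl bk wc a1 b1.
(* With [a s] cut down to [F'] the Gram entries are sums over [g] in [F'], and the pairing is an
   instance of [rows_bound]. *)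
have fin F' : normc (\sum_i c i * \sum_(s <- F) \sum_(t <- F)
    (l i s)^* * (S (delta R t) s * inner (fproj F' (a s)) (b t)) * k i t) <= M.
  apply: le_trans (hS _ _ _ _ c (bessel_rows_schur F F' bl a1)
    (bessel_rows_schur F F' bk b1) wc).
  rewrite le_eqVlt; apply/orP; left; apply/eqP; congr normc.
  apply: eq_bigr => i _; congr (_ * _).
  under [RHS]eq_bigr do rewrite inner_fvec_bop.
  rewrite [RHS]exchange_big/=; apply: eq_bigr => s _.
  rewrite [RHS]exchange_big/=; apply: eq_bigr => t _.
  rewrite inner_fvecl big_seq_fsetE/= !mulr_sumr mulr_suml; apply: eq_bigr => g _.
  rewrite rmorphM/=; ring.
pose K := \sum_i \sum_(s <- F) \sum_(t <- F)
  normc (c i * (l i s)^* * S (delta R t) s * k i t).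
apply: (@ler_addeps _ _ _ K) => e e0.
have [F' hF'] := fproj_approx_fin (fun s : F => a (val s)) e0.
have {}hF' := hF' _ (fsubset_refl F').
set u := (X in normc X <= _).
rewrite -[u](subrK (\sum_i c i * \sum_(s <- F) \sum_(t <- F)
    (l i s)^* * (S (delta R t) s * inner (fproj F' (a s)) (b t)) * k i t)).
rewrite addrC; apply: le_trans (le_normcD _ _) _; apply: lerD (fin F') _.
rewrite /u /K -sumrB mulr_sumr; apply: le_trans (normc_sum _ _ _) _.
apply: ler_sum => i _; rewrite -mulrBr -sumrB !mulr_sumr.
apply: le_trans (normc_sum _ _ _) _; rewrite big_seq [leRHS]big_seq.
apply: ler_sum => s sF; rewrite -sumrB !mulr_sumr.
apply: le_trans (normc_sum _ _ _) _; apply: ler_sum => t _.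
have -> : c i * ((l i s)^* * (S (delta R t) s * inner (a s) (b t)) * k i t -
   (l i s)^* * (S (delta R t) s * inner (fproj F' (a s)) (b t)) * k i t) =
   inner (a s - fproj F' (a s)) (b t) * (c i * (l i s)^* * S (delta R t) s * k i t).
  rewrite innerBl; ring.
rewrite normcM ler_wpM2r ?normc_ge0//.
apply: le_trans (cauchy_schwarz _ _) _.
apply: le_trans (hF' [` sF]%fset); rewrite ler_piMr ?l2norm_ge0//.
Qed.

Lemma inner_transl_comp (T : B) (s t : G) (x y : H) :
  inner x (bop_comp (transl R s) (bop_comp T (transl R (t^-1)%g)) y) =
  inner (transl R (s^-1)%g x) (T (transl R (t^-1)%g y)).
Proof. by rewrite inner_transl_inv. Qed.

Lemma schur_bound p (S T : B) M (phi : dual_ball R G) : rows_bound p S M ->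
  matrix_bound p (fun s t => S (delta R t) s *
    phi (bop_comp (transl R s) (bop_comp T (transl R (t^-1)%g)))) (M * opnorm T).
Proof.
move=> hS F I l k c bl bk wc.
pose L s t := bop_comp (transl R s) (bop_comp T (transl R (t^-1)%g)).
pose X : B := \sum_i c i *: \sum_(s <- F) \sum_(t <- F)
  ((l i s)^* * S (delta R t) s * k i t) *: L s t.
have -> : \sum_i c i * \sum_(s <- F) \sum_(t <- F)
    (l i s)^* * (S (delta R t) s * phi (L s t)) * k i t = phi X.
  rewrite linear_sum; apply: eq_bigr => i _; rewrite linearZ; congr (_ * _).
  rewrite linear_sum; apply: eq_bigr => s _; rewrite linear_sum.
  by apply: eq_bigr => t _; rewrite linearZ /= -[RHS]/(_ * _); ring.
apply: le_trans (dual_funP phi X) _.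
have M0 := rows_bound_ge0 hS.
apply: opnorm_le_inner; first by rewrite mulr_ge0 ?opnorm_ge0.
move=> x y x1 y1.
have -> : inner x (X y) = \sum_i c i * \sum_(s <- F) \sum_(t <- F)
    (l i s)^* * (S (delta R t) s *
      inner (transl R (s^-1)%g x) (T (transl R (t^-1)%g y))) * k i t.
  rewrite bop_sumE inner_sumr; apply: eq_bigr => i _.
  rewrite bop_scaleE innerZr; congr (_ * _).
  rewrite bop_sumE inner_sumr; apply: eq_bigr => s _.
  rewrite bop_sumE inner_sumr; apply: eq_bigr => t _.
  rewrite bop_scaleE innerZr inner_transl_comp; ring.
(* The images under [T] are divided by [opnorm T + e], since [opnorm T] may vanish. *)
apply: (@ler_addeps _ _ _ M) => e e0.
have t0 : 0 < opnorm T + e by rewrite ltr_wpDl ?opnorm_ge0.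
pose b t := ((opnorm T + e)^-1)%:C%C *: T (transl R (t^-1)%g y).
have hb t : T (transl R (t^-1)%g y) = (opnorm T + e)%:C%C *: b t.
  by rewrite scalerA -rmorphM divff ?gt_eqF// scale1r.
have b1 t : l2norm (b t) <= 1.
  rewrite l2normZ normc_real ger0_norm ?invr_ge0 ?(ltW t0)// mulrC ler_pdivrMr//.
  rewrite mul1r; apply: le_trans (l2norm_bop _ _) _; rewrite l2norm_transl.
  by apply: le_trans (ler_piMr (opnorm_ge0 _) y1) _; rewrite lerDl ltW.
have a1 s : l2norm (transl R (s^-1)%g x) <= 1 by rewrite l2norm_transl.
have := schur_gram F hS bl bk wc a1 b1.
rewrite -(ler_pM2l t0) -[opnorm T + e in X in X <= _]ger0_norm ?(ltW t0)//.
rewrite -normc_real -normcM mulr_sumr mulrDl [opnorm T * M]mulrC; apply: le_trans.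
rewrite le_eqVlt; apply/orP; left; apply/eqP; congr normc.
apply: eq_bigr => i _; rewrite !mulr_sumr; apply: eq_bigr => s _.
rewrite !mulr_sumr; apply: eq_bigr => t _; rewrite hb innerZr; ring.
Qed.

End bessel_families.

(** * Operators defined by bounded matrices *)

Section operators_from_matrices.
Variables (R : realType) (G : groupType).
Local Notation C := R[i].
Local Notation H := (l2 R G).
Local Notation B := (bop R G).
Variables (p : \bar R) (K : G -> G -> C) (M : R).
Hypothesis hK : matrix_bound p K M.

Let M0 : 0 <= M. Proof. exact: matrix_bound_ge0 hK. Qed.

Lemma matrix_form_unit (F : {fset G}) (x y : H) : l2norm x <= 1 -> l2norm y <= 1 ->
  normc (\sum_(s <- F) \sum_(t <- F) (x s)^* * K s t * y t) <= M.
Proof.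
move=> x1 y1; have := hK F (bessel_unit x1) (bessel_unit y1) (weights_unit p).
by rewrite big_const card_unit /= addr0 mul1r.
Qed.

Lemma matrix_form (F : {fset G}) (x y : H) :
  normc (\sum_(s <- F) \sum_(t <- F) (x s)^* * K s t * y t) <=
  M * (l2norm x * l2norm y).
Proof.
have z0 (u v : H) : u = 0 \/ v = 0 ->
    \sum_(s <- F) \sum_(t <- F) (u s)^* * K s t * v t = 0.
  move=> uv; rewrite big1// => s _; rewrite big1// => t _.
  by case: uv => ->; [rewrite (rmorph0 Num.conj) !mul0r|rewrite mulr0].
have [x0|x0] := eqVneq (l2norm x) 0.
  by rewrite x0 mul0r mulr0 z0 ?normc0//; left; exact: l2norm_eq0.
have [y0|y0] := eqVneq (l2norm y) 0.
  by rewrite y0 !mulr0 z0 ?normc0//; right; exact: l2norm_eq0.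
have xp : 0 < l2norm x by rewrite lt0r x0 l2norm_ge0.
have yp : 0 < l2norm y by rewrite lt0r y0 l2norm_ge0.
have h (u : H) : l2norm u != 0 -> l2norm ((l2norm u)^-1%:C%C *: u) <= 1.
  by move=> u0; rewrite l2normZ normc_real ger0_norm ?invr_ge0 ?l2norm_ge0// mulVf.
have := matrix_form_unit F (h _ x0) (h _ y0).
have -> : \sum_(s <- F) \sum_(t <- F) (((l2norm x)^-1%:C%C *: x) s)^* * K s t *
    ((l2norm y)^-1%:C%C *: y) t =
    (l2norm x * l2norm y)^-1%:C%C * \sum_(s <- F) \sum_(t <- F) (x s)^* * K s t * y t.
  rewrite mulr_sumr; apply: eq_bigr => s _; rewrite mulr_sumr; apply: eq_bigr => t _.
  by rewrite !l2_scaleE conj_mul conj_realC invfM rmorphM/=; ring.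
rewrite normcM normc_real ger0_norm ?invr_ge0 ?mulr_ge0 ?l2norm_ge0//.
by rewrite mulrC ler_pdivrMr// mulr_gt0.
Qed.

(** Vectors supported on [F1] and [F2] cut the rectangle out of the square over the union. *)
Lemma matrix_form2 (F1 F2 : {fset G}) (f h : G -> C) :
  normc (\sum_(s <- F1) \sum_(t <- F2) (f s)^* * K s t * h t) <=
  M * (l2norm (fvec F1 f : H) * l2norm (fvec F2 h : H)).
Proof.
apply: le_trans (matrix_form (F1 `|` F2)%fset (fvec F1 f) (fvec F2 h)).
rewrite le_eqVlt; apply/orP; left; apply/eqP; congr normc.
transitivity (\sum_(s <- F1) \sum_(t <- F2) (fvec F1 f s)^* * K s t * fvec F2 h t).
  rewrite big_seq [RHS]big_seq; apply: eq_bigr => s sF.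
  rewrite big_seq [RHS]big_seq; apply: eq_bigr => t tF.
  by rewrite !fvec_coord sF tF.
transitivity (\sum_(s <- F1) \sum_(t <- (F1 `|` F2)%fset)
    (fvec F1 f s)^* * K s t * fvec F2 h t).
  apply: eq_bigr => s _; apply: big_fset_incl; first exact: fsubsetUr.
  by move=> t _ tF; rewrite [fvec F2 h t]fvec_coord (negbTE tF) mulr0.
apply: big_fset_incl; first exact: fsubsetUl.
move=> s _ sF; rewrite big1// => t _.
by rewrite [fvec F1 f s]fvec_coord (negbTE sF) (rmorph0 Num.conj) !mul0r.
Qed.

Lemma matrix_entry s t : normc (K s t) <= M.
Proof.
have := matrix_form2 [fset s]%fset [fset t]%fset (fun=> 1) (fun=> 1).
by rewrite !big_seq_fset1 /fvec !big_seq_fset1 !scale1r !l2norm_delta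
  (rmorph1 Num.conj) !mulr1 mul1r.
Qed.

(** Testing row [s] against its own conjugate gives [|f|^2 <= M |f|]. With the conjugation,
    [inner r x] is the coordinate at [s] of the image of [x]. *)
Lemma matrix_row s : exists2 r : H, (forall t, r t = (K s t)^*) & l2norm r ^+ 2 <= M ^+ 2.
Proof.
apply: l2_of_bounded => F; set f := fun t => (K s t)^*.
rewrite -(sqr_l2norm_fvec F f) ler_sqr ?nnegrE ?l2norm_ge0//.
have := matrix_form2 [fset s]%fset F (fun=> 1) f.
rewrite big_seq_fset1 /(fvec [fset s]%fset) big_seq_fset1 scale1r l2norm_delta mul1r.
have -> : \sum_(t <- F) 1^* * K s t * f t = (l2norm (fvec F f : H) ^+ 2)%:C%C.
  rewrite sqr_l2norm_fvec rmorph_sum; apply: eq_bigr => t _ /=.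
  by rewrite (rmorph1 Num.conj) mul1r -mulc_conj conjCK.
rewrite normc_real ger0_norm ?sqr_ge0// expr2.
have [->//|n0] := eqVneq (l2norm (fvec F f : H)) 0.
by rewrite ler_pM2r// lt0r n0 l2norm_ge0.
Qed.

Lemma operator_of_matrix : exists2 W : B,
  (forall s t, W (delta R t) s = K s t) & opnorm W <= M.
Proof.
have /choice[r hr] : forall s, exists r : H, forall t, r t = (K s t)^*.
  by move=> s; have [r h _] := matrix_row s; exists r.
have bnd (x : H) (F : {fset G}) :
    \sum_(s <- F) normc (inner (r s) x) ^+ 2 <= (M * l2norm x) ^+ 2.
  set f := fun s => inner (r s) x.
  rewrite -(sqr_l2norm_fvec F f) ler_sqr ?nnegrE ?l2norm_ge0 ?mulr_ge0 ?l2norm_ge0//.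
  (* [<z, x>] is the squared norm of the coordinates in [F]. Bounding it by the matrix form produces
     that norm once more on the right, and one factor cancels. *)
  pose z := \sum_(s <- F) f s *: r s.
  have zx : inner z x = (l2norm (fvec F f : H) ^+ 2)%:C%C.
    rewrite sqr_l2norm_fvec rmorph_sum inner_suml; apply: eq_bigr => s _ /=.
    by rewrite innerZl mulc_conj.
  have hz : l2norm (fvec F f : H) ^+ 2 <= M * (l2norm (fvec F f : H) * l2norm x).
    (* The matrix form accepts finitely supported vectors only, so [x] is truncated; the error is at
       most [e] times the norm of [z]. *)
    apply: (@ler_addeps _ _ _ (l2norm z)) => e e0.
    have [F' /(_ F' (fsubset_refl _)) hF'] := fproj_approx x e0.
    have -> : l2norm (fvec F f : H) ^+ 2 = normc (inner z x).
      by rewrite zx normc_real ger0_norm// sqr_ge0.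
    rewrite -[x](subrK (fproj F' x)) addrC innerDr.
    apply: le_trans (le_normcD _ _) _; rewrite addrC subrK; apply: lerD.
      apply: (@le_trans _ _ (M * (l2norm (fvec F f : H) * l2norm (fproj F' x)))).
        apply: le_trans (matrix_form2 F F' f x).
        rewrite le_eqVlt; apply/orP; left; apply/eqP; congr normc.
        rewrite inner_suml; apply: eq_bigr => s _.
        rewrite innerZl inner_fvecr mulr_sumr; apply: eq_bigr => t _.
        by rewrite hr conjCK mulrA.
      by rewrite ler_wpM2l// ler_wpM2l ?l2norm_ge0// l2norm_fproj.
    apply: le_trans (cauchy_schwarz _ _) _.
    by rewrite mulrC ler_wpM2r ?l2norm_ge0.
  have [->|n0] := eqVneq (l2norm (fvec F f : H)) 0; first by rewrite mulr_ge0 ?l2norm_ge0.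
  move: hz; rewrite mulrCA expr2 ler_pM2l// lt0r n0 l2norm_ge0//.
have /choice[w hw] : forall x : H, exists y : H, (forall s, y s = inner (r s) x) /\
    l2norm y <= M * l2norm x.
  move=> x; have [y hy ny] := l2_of_bounded (bnd x).
  by exists y; split => //; rewrite -ler_sqr ?nnegrE ?l2norm_ge0 ?mulr_ge0 ?l2norm_ge0.
have wP : w \in @bop_pred R G.
  rewrite inE; split=> [a x y|]; last by exists M => x; have [] := hw x.
  apply: l2P => s; have [-> _] := hw (a *: x + y).
  rewrite innerDr innerZr l2_addE l2_scaleE.
  by have [-> _] := hw x; have [-> _] := hw y.
exists (Bop wP) => [s t|].
  by have [/= -> _] := hw (delta R t); rewrite delta_inner hr conjCK.
apply: opnorm_le => // x x1 /=; have [_ h] := hw x.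
by apply: le_trans h _; rewrite ler_piMr.
Qed.

(** All vectors are truncated to a common finite set [F]. The hypothesis applies to [l] and [k]
    themselves, because its sums only see their coordinates in [F]. *)
Lemma matrix_bound_pairing (W : B) :
  (forall s t, W (delta R t) s = K s t) -> pairing_bound p W M.
Proof.
move=> hW I l k c bl bk wc.
pose A := \sum_i normc (c i) * (opnorm W *+ 2).
apply: (@ler_addeps _ _ _ A) => e e0.
have [F1 h1] := fproj_approx_fin l e0.
have [F2 h2] := fproj_approx_fin k e0.
pose F := (F1 `|` F2)%fset.
have {}h1 := h1 F (fsubsetUl _ _); have {}h2 := h2 F (fsubsetUr _ _).
have hF : normc (\sum_i c i * inner (fproj F (l i)) (W (fproj F (k i)))) <= M.
  apply: le_trans (hK F bl bk wc).
  rewrite le_eqVlt; apply/orP; left; apply/eqP; congr normc.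
  apply: eq_bigr => i _; rewrite inner_fvec_bop; congr (_ * _).
  by apply: eq_bigr => s _; apply: eq_bigr => t _; rewrite hW.
set u := (X in normc X <= _).
rewrite -[u](subrK (\sum_i c i * inner (fproj F (l i)) (W (fproj F (k i))))).
rewrite addrC; apply: le_trans (le_normcD _ _) _; apply: lerD hF _.
rewrite /u /A -sumrB mulr_sumr; apply: le_trans (normc_sum _ _ _) _.
apply: ler_sum => i _; rewrite -mulrBr normcM mulrCA ler_wpM2l ?normc_ge0//.
have -> : inner (l i) (W (k i)) - inner (fproj F (l i)) (W (fproj F (k i))) =
    inner (l i - fproj F (l i)) (W (k i)) +
    inner (fproj F (l i)) (W (k i - fproj F (k i))).
  rewrite innerBl bopB innerBr; ring.
have W0 := opnorm_ge0 W.
apply: le_trans (le_normcD _ _) _; rewrite mulr2n mulrDr; apply: lerD.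
  apply: le_trans (normc_inner_bop _ _ _) _; rewrite mulrC ler_wpM2r//.
  apply: le_trans (h1 i); rewrite ler_piMr ?l2norm_ge0//.
  exact: bessel_l2norm bk.
apply: le_trans (normc_inner_bop _ _ _) _; rewrite mulrC ler_wpM2r//.
apply: le_trans (h2 i); rewrite ler_piMl ?l2norm_ge0//.
exact: le_trans (l2norm_fproj _ _) (bessel_l2norm i bl).
Qed.

End operators_from_matrices.

(** * Singular values from bounds on Bessel families *)

Section ultrafilter_oscillation.
Variables (R : realType) (T : Type) (U : set_system T).
Hypothesis ultraU : UltraFilter U.

(** Bisection: an ultrafilter contains a set or its complement, so the range, of length [2 b], can
    be halved repeatedly while its preimage stays in [U]. *)
Lemma ultra_oscillation (h : T -> R) (b e : R) : 0 < e ->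
  U [set x | `|h x| <= b] ->
  exists2 X, U X & forall x y, X x -> X y -> `|h x - h y| <= e.
Proof.
move=> e0 Ub; have pU := @ultra_proper _ _ ultraU.
have bisect n : exists a, U [set x | a <= h x <= a + b *+ 2 / 2 ^+ n].
  elim: n => [|n [a Ua]].
    exists (- b); apply: filterS Ub => x /=; rewrite ler_norml expr0 divr1 mulr2n.
    by rewrite addKr.
  have E : b *+ 2 / 2 ^+ n = b *+ 2 / 2 ^+ n.+1 + b *+ 2 / 2 ^+ n.+1.
    by rewrite exprS invfM mulrCA -mulrDl -[X in X + X]div1r -splitr mul1r.
  have [Um|Um] := in_ultra_setVsetC [set x | h x <= a + b *+ 2 / 2 ^+ n.+1] ultraU.
    exists a; apply: filterS (filterI Ua Um) => x [] /= /andP[-> _].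
    by [].
  exists (a + b *+ 2 / 2 ^+ n.+1); apply: filterS (filterI Ua Um) => x [] /=.
  by rewrite E addrA => /andP[_ ->] /negP; rewrite -ltNge => /ltW ->.
have [n hn] : exists n, b *+ 2 / 2 ^+ n <= e.
  exists (Num.bound `|b *+ 2 / e|).
  rewrite ler_pdivrMr ?exprn_gt0// mulrC -ler_pdivrMr//.
  apply: le_trans (ler_norm _) _.
  apply: (@le_trans _ _ (Num.bound `|b *+ 2 / e|)%:R).
    exact: ltW (archi_boundP (normr_ge0 _)).
  by rewrite -natrX ler_nat ltnW// ltn_expl.
have [a Ua] := bisect n.
exists [set x | a <= h x <= a + b *+ 2 / 2 ^+ n] => // x y /= /andP[x1 x2] /andP[y1 y2].
rewrite ler_norml; apply/andP; split; lra.
Qed.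

Lemma ultra_oscillationC (h : T -> R[i]) (b e : R) : 0 < e ->
  U [set x | normc (h x) <= b] ->
  exists2 X, U X & forall x y, X x -> X y -> normc (h x - h y) <= e.
Proof.
move=> e0 Ub; have e2 : 0 < e / 2 by rewrite divr_gt0.
have pU := @ultra_proper _ _ ultraU.
have [|X UX hX] := @ultra_oscillation (fun x => complex.Re (h x)) b _ e2.
  by apply: filterS Ub => x /=; apply: le_trans; exact: normc_Re.
have [|Y UY hY] := @ultra_oscillation (fun x => complex.Im (h x)) b _ e2.
  by apply: filterS Ub => x /=; apply: le_trans; exact: normc_Im.
exists (X `&` Y) => [|x y [Xx Yx] [Xy Yy]]; first exact: filterI.
apply: le_trans (normc_le_ReIm _) _; rewrite RecD ImcD RecN ImcN.
by rewrite [leRHS](splitr e) lerD ?hX ?hY.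
Qed.

Lemma ultra_oscillation_fin n (h : nat -> T -> R[i]) (b e : R) : 0 < e ->
  (forall i, U [set x | normc (h i x) <= b]) ->
  exists2 X, U X & forall i x y, (i < n)%N -> X x -> X y -> normc (h i x - h i y) <= e.
Proof.
move=> e0 Ub; have pU := @ultra_proper _ _ ultraU.
elim: n => [|n [X UX hX]]; first by exists setT => //; exact: filterT.
have [Y UY hY] := ultra_oscillationC e0 (Ub n).
exists (X `&` Y) => [|i x y]; first exact: filterI.
rewrite ltnS leq_eqVlt => /orP[/eqP->|i_n] [Xx Yx] [Xy Yy]; first exact: hY.
exact: hX.
Qed.

End ultrafilter_oscillation.

(** * Partial orthonormal systems and their projections *)

Section orthogonal_systems.
Variables (R : realType) (G : groupType).
Local Notation H := (l2 R G).

(** Null vectors pad the systems attached to operators of finite rank. *)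
Definition partial_onb n (f : nat -> H) :=
  (forall i j, (i < n)%N -> (j < n)%N -> i != j -> inner (f i) (f j) = 0) /\
  (forall i, (i < n)%N -> l2norm (f i) = 1 \/ f i = 0).

(** For a partial orthonormal system, the orthogonal projection onto the span of its first [n]
    vectors. *)
Definition onb_sum n (f : nat -> H) x : H := \sum_(i < n) inner (f i) x *: f i.

Lemma partial_onb_inner n f i x : partial_onb n f -> (i < n)%N ->
  inner (f i) (x - onb_sum n f x) = 0.
Proof.
move=> [of1 of2] i_n; rewrite innerBr inner_sumr (bigD1 (Ordinal i_n))//=.
rewrite big1 => [|j ji]; last first.
  by rewrite innerZr of1 ?mulr0//; apply: contra ji => /eqP h; apply/eqP/val_inj.
rewrite addr0 innerZr innerxx.
by have [->|->] := of2 _ i_n; rewrite ?expr1n ?mulr1 ?inner0l ?mul0r subrr.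
Qed.

Lemma inner_onb_sum0 n f x y : (forall i, (i < n)%N -> inner (f i) y = 0) ->
  inner (onb_sum n f x) y = 0.
Proof.
by move=> h; rewrite inner_suml big1// => i _; rewrite innerZl h ?mulr0.
Qed.

Lemma l2norm_onb_compl n f x : partial_onb n f -> l2norm (x - onb_sum n f x) <= l2norm x.
Proof.
move=> hf; have := sqr_l2normD (x - onb_sum n f x) (onb_sum n f x).
rewrite subrK innerC inner_onb_sum0; last by move=> i i_n; exact: partial_onb_inner.
rewrite (rmorph0 Num.conj) mul0rn addr0 => h.
by rewrite -ler_sqr ?nnegrE ?l2norm_ge0// h lerDl sqr_ge0.
Qed.

Lemma partial_onb_bessel n f : partial_onb n f -> bessel (fun i : 'I_n => f i).
Proof.
move=> [of1 of2]; apply: bessel_orthogonal => [i j ij|i]; first exact: of1.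
by have [->|->] := of2 _ (ltn_ord i); rewrite ?l2norm0.
Qed.

End orthogonal_systems.

(** * Compactness from bounds on pairings *)

Section compactness.
Variables (R : realType) (G : groupType).
Local Notation C := R[i].
Local Notation H := (l2 R G).
Local Notation B := (bop R G).

(** The weights are those of equality in Hölder's inequality: with [N] the l^r norm of [w] and
    [b = normc w / N], the coefficient [c] is the phase of [w] times [b ^ (r - 1)], and the pairing
    evaluates to [N]. *)
Lemma pairing_bound_sum (r : R) (W : B) M : 1 <= r -> pairing_bound r%:E W M ->
  forall (I : finType) (l k : I -> H), bessel l -> bessel k ->
  \sum_i normc (inner (l i) (W (k i))) `^ r <= M `^ r.
Proof.
move=> r1 hW I l k bl bk; have r0 : 0 < r by rewrite (lt_le_trans _ r1).
set w := fun i => inner (l i) (W (k i)).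
set S := \sum_i normc (w i) `^ r.
have S0 : 0 <= S by apply: sumr_ge0 => i _; exact: powR_ge0.
have [S_0|Sn0] := eqVneq S 0; first by rewrite -/S S_0 powR_ge0.
have Sp : 0 < S by rewrite lt0r Sn0.
pose N := S `^ r^-1.
have Np : 0 < N by rewrite powR_gt0.
have NS : N `^ r = S by rewrite -powRrM mulVf ?powRr1// gt_eqF.
pose b i := normc (w i) / N.
have b0 i : 0 <= b i by rewrite divr_ge0 ?normc_ge0// ltW.
have /choice[u hu] : forall i, exists u, normc u = 1 /\ u * w i = (normc (w i))%:C%C.
  by move=> i; have [u u1 u2] := exists_phase (w i); exists u.
pose c i := u i * (b i `^ (r - 1))%:C%C.
have sb : \sum_i b i `^ r = 1.
  have E i : b i `^ r = normc (w i) `^ r / S.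
    apply/(canRL (mulfK Sn0)); rewrite -NS -powRM ?(ltW Np)//.
    by rewrite /b divfK ?gt_eqF.
  by under eq_bigr do rewrite E; rewrite -mulr_suml divff.
have wc : weights r%:E c.
  exists b; split=> [//|i|]; last by rewrite sb.
  by have [u1 _] := hu i; rewrite normcM u1 mul1r normc_real ger0_norm ?powR_ge0.
have E : \sum_i c i * w i = N%:C%C.
  rewrite -[N]mulr1 -sb mulr_sumr rmorph_sum; apply: eq_bigr => i _.
  have [_ u2] := hu i; rewrite /c mulrAC u2 -rmorphM; congr (_%:C%C).
  rewrite -(mulr_powRB1 (b0 i) r0) mulrA; congr (_ * _).
  by rewrite /b mulrC divfK// gt_eqF.
have := hW _ _ _ _ bl bk wc.
rewrite E normc_real gtr0_norm// => NM.
by rewrite -NS ge0_ler_powR ?nnegrE ?(ltW r0) ?(ltW Np) ?(le_trans (ltW Np) NM).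
Qed.

(** Take systems of maximal length [n] whose coefficients are all at least [e]; they exist because
    [n e^r <= M^r]. A pair of orthogonal vectors violating the conclusion would, once normalized,
    extend them. *)
Lemma pairing_bound_small (r : R) (W : B) M (e : R) : 1 <= r ->
  pairing_bound r%:E W M -> 0 < e -> exists n (k l : nat -> H),
  [/\ partial_onb n k, partial_onb n l &
  forall x y, (forall i, (i < n)%N -> inner (k i) x = 0) ->
    (forall i, (i < n)%N -> inner (l i) y = 0) ->
    normc (inner y (W x)) <= e * (l2norm x * l2norm y)].
Proof.
move=> r1 hW e0; have r0 : 0 < r by rewrite (lt_le_trans _ r1).
pose Q n := exists k l : nat -> H, [/\ partial_onb n k, partial_onb n l &
  forall i, (i < n)%N -> e <= normc (inner (l i) (W (k i)))].
have Q0 : exists n, `[< Q n >].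
  by exists 0%N; apply/asboolP; exists (fun=> 0), (fun=> 0); split => //; split.
have Qb n : `[< Q n >] -> (n <= Num.bound (M `^ r / e `^ r))%N.
  move=> /asboolP[k [l [hk hl hkl]]]; apply: ltnW.
  rewrite -(ltr_nat R); apply: le_lt_trans (archi_boundP _); last first.
    by rewrite divr_ge0// powR_ge0.
  rewrite ler_pdivlMr ?powR_gt0//.
  have := pairing_bound_sum r1 hW (partial_onb_bessel hl) (partial_onb_bessel hk).
  apply: le_trans.
  rewrite -[n in n%:R]card_ord -sum1_card natr_sum mulr_suml; apply: ler_sum => i _.
  rewrite mul1r ge0_ler_powR ?nnegrE ?(ltW r0) ?(ltW e0) ?normc_ge0//.
  exact: hkl.
have [n /asboolP[k [l [hk hl hkl]]] nmax] := ex_maxnP Q0 Qb.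
exists n, k, l; split => // x y hx hy.
have [x0|x0] := eqVneq (l2norm x) 0.
  by rewrite (l2norm_eq0 x0) bop0 inner0r normc0 l2norm0 mul0r mulr0.
have [y0|y0] := eqVneq (l2norm y) 0.
  by rewrite (l2norm_eq0 y0) inner0l normc0 l2norm0 !mulr0.
have xp : 0 < l2norm x by rewrite lt0r x0 l2norm_ge0.
have yp : 0 < l2norm y by rewrite lt0r y0 l2norm_ge0.
rewrite leNgt; apply/negP => hlt.
suff /asboolP/nmax : Q n.+1 by rewrite ltnn.
pose ext (z : H) (f : nat -> H) i := if i == n then (l2norm z)^-1%:C%C *: z else f i.
have ext_onb z f : partial_onb n f -> l2norm z != 0 ->
    (forall i, (i < n)%N -> inner (f i) z = 0) -> partial_onb n.+1 (ext z f).
  move=> [f1 f2] z0 fz; split=> [i j|i]; rewrite !ltnS /ext.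
    have [-> _|ni] := eqVneq i n; have [->|nj] := eqVneq j n; rewrite ?eqxx// => hi hj.
    - by rewrite innerZl innerC fz ?(rmorph0 Num.conj) ?mulr0// ltn_neqAle nj.
    - by rewrite innerZr fz ?mulr0// ltn_neqAle ni.
    - by apply: f1; rewrite ltn_neqAle ?ni ?nj.
  have [->|ni] := eqVneq i n => hi; last by apply: f2; rewrite ltn_neqAle ni.
  by left; rewrite l2normZ normc_real ger0_norm ?invr_ge0 ?l2norm_ge0// mulVf.
exists (ext x k), (ext y l); split; [exact: ext_onb..|].
move=> i; rewrite ltnS /ext; have [-> _|ni] := eqVneq i n; last first.
  by move=> hi; apply: hkl; rewrite ltn_neqAle ni.
rewrite bopZ innerZl innerZr conj_realC !normcM !normc_real.
rewrite !ger0_norm ?invr_ge0 ?l2norm_ge0// mulrA -invfM.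
by rewrite mulrC ler_pdivlMr ?mulr_gt0// [l2norm y * _]mulrC ltW.
Qed.

(** A quantitative form of the compactness of [W]. *)
Lemma pairing_bound_compact (r : R) (W : B) M (e : R) : 1 <= r ->
  pairing_bound r%:E W M -> 0 < e -> exists n (k l : nat -> H) (K : R), 0 <= K /\
  [/\ forall i, l2norm (k i) <= 1, forall i, l2norm (l i) <= 1 & forall z,
  l2norm (W z) <= e * l2norm z + \sum_(i < n)
    (normc (inner (l i) (W z)) + K * normc (inner (k i) z))].
Proof.
move=> r1 hW e0; have [n [k [l [hk hl hkl]]]] := pairing_bound_small r1 hW e0.
(* Beyond the first [n] indices nothing is known of the vectors; they are replaced by 0 so that the
   norm bounds hold for every [i]. *)
have cut (f : nat -> H) : partial_onb n f -> exists2 f', (forall i, l2norm (f' i) <= 1) &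
    forall i, (i < n)%N -> f' i = f i.
  move=> [_ hf]; exists (fun i => if (i < n)%N then f i else 0) => i; last by move=> ->.
  by case: ifPn; rewrite ?l2norm0// => /hf[->|->]; rewrite ?l2norm0.
have [k' k'1 kk] := cut k hk; have [l' l'1 ll] := cut l hl.
have W0 := opnorm_ge0 W.
(* One [opnorm W] bounds the image of the projection of [z] on the [k]; the [n] others come from
   replacing [W z'] by [W z] in the [n] coefficients along the [l]. *)
exists n, k', l', ((1 + n%:R) * opnorm W); split; first by rewrite mulr_ge0 ?addr_ge0.
split => // z.
under eq_bigr do rewrite kk// ll//.
(* Removing the projections on the [k] and the [l] leaves a pair for which [<y, W z'>] is small; as
   it equals [|y|^2], the remainder [y] is small. *)
pose z' := z - onb_sum n k z; pose y := W z' - onb_sum n l (W z').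
have z'z : l2norm z' <= l2norm z by exact: l2norm_onb_compl.
have yl i : (i < n)%N -> inner (l i) y = 0 by exact: partial_onb_inner.
have ye : l2norm y <= e * l2norm z.
  have [->|y0] := eqVneq (l2norm y) 0; first by rewrite mulr_ge0 ?l2norm_ge0 ?(ltW e0).
  have yp : 0 < l2norm y by rewrite lt0r y0 l2norm_ge0.
  have yy : inner y y = inner y (W z').
    by rewrite {2}/y innerBr [X in _ - X]innerC inner_onb_sum0// (rmorph0 Num.conj) subr0.
  have := hkl z' y (fun i h => partial_onb_inner _ hk h) yl.
  rewrite -yy innerxx normc_real ger0_norm ?sqr_ge0// mulrA expr2 ler_pM2r//.
  by move=> /le_trans; apply; rewrite ler_wpM2l ?(ltW e0).
set A := \sum_(i < n) normc (inner (k i) z).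
have A0 : 0 <= A by apply: sumr_ge0 => i _; exact: normc_ge0.
have nk (f : nat -> H) : partial_onb n f -> forall i : 'I_n, l2norm (f i) <= 1.
  by move=> hf i; apply: (bessel_l2norm i (partial_onb_bessel hf)).
have onb_le (f : nat -> H) x : partial_onb n f ->
    l2norm (onb_sum n f x) <= \sum_(i < n) normc (inner (f i) x).
  move=> hf; apply: le_trans (ler_l2norm_sum _ _ _) _; apply: ler_sum => i _.
  by rewrite l2normZ ler_piMr ?normc_ge0// nk.
have Wk : l2norm (W (onb_sum n k z)) <= opnorm W * A.
  by apply: le_trans (l2norm_bop _ _) _; rewrite ler_wpM2l// onb_le.
have zE : W z = (y + onb_sum n l (W z')) + W (onb_sum n k z).
  by rewrite /y subrK -bopD subrK.
have lz' (i : 'I_n) : normc (inner (l i) (W z')) <=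
    normc (inner (l i) (W z)) + opnorm W * A.
  rewrite /z' bopB innerBr; apply: le_trans (le_normcD _ _) _.
  rewrite normcN lerD2l; apply: le_trans (cauchy_schwarz _ _) _.
  by apply: le_trans Wk; rewrite ler_piMl ?l2norm_ge0// nk.
have S1 : l2norm (onb_sum n l (W z')) <=
    \sum_(i < n) normc (inner (l i) (W z)) + n%:R * (opnorm W * A).
  apply: le_trans (onb_le _ _ hl) _.
  rewrite -[n in n%:R]card_ord -sum1_card natr_sum mulr_suml -big_split/=.
  by apply: ler_sum => i _; rewrite mul1r.
rewrite {1}zE; apply: le_trans (ler_l2normD _ _) _.
apply: le_trans (lerD (ler_l2normD _ _) Wk) _.
apply: le_trans (lerD (lerD ye S1) (lexx _)) _.
rewrite big_split/= -mulr_sumr -/A; lra.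
Qed.

End compactness.

(** * Attained suprema and their eigenvalue equation *)

Section maximizers.
Variables (R : realType) (G : groupType).
Local Notation C := R[i].
Local Notation H := (l2 R G).
Local Notation B := (bop R G).

Lemma hcvg_norm_le (x : nat -> H) l (c : R) : hcvg x l ->
  (forall n, l2norm (x n) <= c) -> l2norm l <= c.
Proof.
move=> hx hc; apply/ler_addgt0Pr => e e0; have [N /(_ N (leqnn N)) hN] := hx e e0.
rewrite -[l](subrK (x N)); apply: le_trans (ler_l2normD _ _) _.
by rewrite addrC lerD// l2norm_distC.
Qed.

(** The set [D] is a closed subspace, described by the two stability hypotheses. Compactness of [W]
    makes the images of near-maximizers close to each other along an ultrafilter; the parallelogram
    identity transfers this to the near-maximizers. *)
Lemma exists_maximizer (r : R) (W : B) M (D : set H) : 1 <= r ->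
  pairing_bound r%:E W M ->
  (forall (a : C) x y, D x -> D y -> D (a *: x + y)) ->
  (forall x l, (forall n, D (x n)) -> hcvg x l -> D l) ->
  (exists2 x, D x & W x != 0) ->
  exists x, [/\ D x, l2norm x = 1, W x != 0 &
    forall y, D y -> l2norm (W y) <= l2norm (W x) * l2norm y].
Proof.
move=> r1 hW Dlin Dcl [x0 Dx0 Wx0].
have D0 : D 0 by have := Dlin (-1) _ _ Dx0 Dx0; rewrite scaleN1r addNr.
have DZ a x : D x -> D (a *: x) by move=> Dx; have := Dlin a _ _ Dx D0; rewrite addr0.
have DD x y : D x -> D y -> D (x + y).
  by move=> Dx Dy; have := Dlin 1 _ _ Dx Dy; rewrite scale1r.
pose E := [set l2norm (W x) | x in [set x | D x /\ l2norm x <= 1]].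
have Esup : has_sup E.
  split; first by exists (l2norm (W 0)), 0 => //; split => //; rewrite l2norm0.
  exists (opnorm W) => _ [x [_ x1] <-].
  by apply: le_trans (l2norm_bop _ _) _; rewrite ler_piMr ?opnorm_ge0.
pose rho := sup E.
have ub x : D x -> l2norm (W x) <= rho * l2norm x.
  move=> Dx; have [xn|xn] := eqVneq (l2norm x) 0.
    by rewrite (l2norm_eq0 xn) bop0 l2norm0 mulr0.
  have xp : 0 < l2norm x by rewrite lt0r xn l2norm_ge0.
  rewrite -ler_pdivrMr// mulrC; apply: ub_le_sup; first by case: Esup.
  exists (((l2norm x)^-1)%:C%C *: x).
    split; first exact: DZ.
    by rewrite l2normZ normc_real ger0_norm ?invr_ge0 ?l2norm_ge0// mulVf.
  by rewrite bopZ l2normZ normc_real ger0_norm// invr_ge0 l2norm_ge0.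
have rp : 0 < rho.
  have Wp : 0 < l2norm (W x0).
    rewrite lt0r l2norm_ge0 andbT; apply: contra Wx0 => /eqP h.
    by rewrite (l2norm_eq0 h).
  have x0p : 0 < l2norm x0.
    rewrite lt0r l2norm_ge0 andbT; apply: contra Wx0 => /eqP h.
    by rewrite (l2norm_eq0 h) bop0.
  by have := lt_le_trans Wp (ub _ Dx0); rewrite pmulr_lgt0.
(* Near-maximizers need not converge as [d] tends to 0, if only because of their phases; an
   ultrafilter refining their filter selects among them. *)
pose A d := [set x | [/\ D x, l2norm x <= 1 & rho - d < l2norm (W x)]].
have Ane d : 0 < d -> A d !=set0.
  by move=> d0; have [_ [x [Dx x1] <-] hx] := sup_adherent d0 Esup; exists x; split.
have AS d d' : d <= d' -> A d `<=` A d'.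
  move=> dd x [Dx x1 hx]; split => //; apply: le_lt_trans hx.
  by rewrite lerD2l lerN2.
have pF : ProperFilter (filter_from [set d : R | 0 < d] A).
  apply: filter_from_proper; last by move=> d /= /Ane.
  apply: filter_from_filter; first by exists 1 => /=.
  move=> d d' /= d0 d'0; exists (Num.min d d'); first by rewrite lt_min d0.
  by move=> x Ax; split; apply: AS Ax; rewrite ge_min lexx ?orbT.
have [U [ultraU FU]] := ultraFilterLemma pF.
have pU := @ultra_proper _ _ ultraU.
have UA d : 0 < d -> U (A d) by move=> d0; apply: FU; exists d.
have Wosc e : 0 < e -> exists2 X, U X &
    forall x y, X x -> X y -> l2norm (W (x - y)) <= e.
  move=> e0; have e4 : 0 < e / 4 by rewrite divr_gt0.
  have [n [k [l [K [K0 [k1 l1 hcomp]]]]]] := pairing_bound_compact r1 hW e4.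
  (* The coefficients contribute at most [n (1 + K) d], to be kept below [e / 2]; the [+ 1] makes
     [c] positive when [n = 0]. The term [e / 4] is doubled by [|x - y| <= 2]. *)
  pose c := n%:R * (1 + K) + 1.
  have cp : 0 < c by rewrite ltr_wpDl// mulr_ge0// addr_ge0.
  pose d := e / 2 / c.
  have dp : 0 < d by rewrite !divr_gt0.
  have [|X UX hX] := @ultra_oscillation_fin _ _ _ ultraU n
      (fun i x => inner (l i) (W x)) (opnorm W) d dp.
    move=> i; apply: filterS (UA 1 ltr01) => x [_ x1 _] /=.
    apply: le_trans (normc_inner_bop _ _ _) _; rewrite ler_piMr ?opnorm_ge0//.
    by rewrite mulr_ile1 ?l2norm_ge0.
  have [|Y UY hY] := @ultra_oscillation_fin _ _ _ ultraU n
      (fun i x => inner (k i) x) 1 d dp.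
    move=> i; apply: filterS (UA 1 ltr01) => x [_ x1 _] /=.
    by apply: le_trans (cauchy_schwarz _ _) _; rewrite mulr_ile1 ?l2norm_ge0.
  exists (A 1 `&` (X `&` Y)).
    by apply: filterI; [exact: UA|exact: filterI].
  move=> x y [[_ x1 _] [Xx Yx]] [[_ y1 _] [Xy Yy]].
  apply: le_trans (hcomp _) _; rewrite [leRHS](splitr e); apply: lerD.
    rewrite (_ : e / 2 = e / 4 * 2); last by lra.
    rewrite ler_wpM2l ?(ltW e4)//; apply: le_trans (ler_l2normB _ _) _; lra.
  apply: (@le_trans _ _ (\sum_(i < n) (d + K * d))).
    apply: ler_sum => i _; rewrite bopB !innerBr lerD ?hX//.
    by rewrite ler_wpM2l// hY.
  rewrite sumr_const card_ord.
  have -> : (d + K * d) *+ n = n%:R * (1 + K) * d by rewrite -mulr_natl; ring.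
  rewrite (_ : e / 2 = c * d); last by rewrite /d [c * _]mulrC divfK// gt_eqF.
  by rewrite ler_wpM2r ?(ltW dp)// lerDl.
(* If [W x] and [W y] are close and both nearly of norm [rho], then [|W (x + y)|] is nearly [2 rho].
   This forces [|x + y|] to be nearly 2, hence [x - y] to be small. *)
have Uosc e : 0 < e -> exists2 X, U X & forall x y, X x -> X y -> l2norm (x - y) <= e.
  move=> e0; have re : 0 < rho * e by rewrite mulr_gt0.
  pose eta := rho * e / 2; have etap : 0 < eta by rewrite divr_gt0.
  (* The total loss in [rho^2 |x - y|^2] is [8 rho d + eta^2], that is
     [rho^2 e^2 / 2 + rho^2 e^2 / 4]. Taking the minimum with [rho] keeps [rho - d'] nonnegative, so
     that it can be squared. *)
  pose d := rho * e ^+ 2 / 16; have dp : 0 < d.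
    by rewrite divr_gt0// mulr_gt0// exprn_gt0.
  pose d' := Num.min d rho; have d'p : 0 < d' by rewrite lt_min dp.
  have [X UX hX] := Wosc _ etap.
  exists (A d' `&` X); first by apply: filterI => //; exact: UA.
  move=> x y [[Dx x1 hx] Xx] [[Dy y1 hy] Xy].
  rewrite -ler_sqr ?nnegrE ?l2norm_ge0 ?(ltW e0)//.
  have h1 := hX _ _ Xx Xy; have h2 := ub _ (DD _ _ Dx Dy).
  have h3 := parallelogram x y.
  have h4 := parallelogram (W x) (W y); rewrite -bopB -bopD in h4.
  have dr : d' <= rho by rewrite ge_min lexx orbT.
  have dd : d' <= d by rewrite ge_min lexx.
  have x2 : l2norm x ^+ 2 <= 1 by rewrite expr_le1// l2norm_ge0.
  have y2 : l2norm y ^+ 2 <= 1 by rewrite expr_le1// l2norm_ge0.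
  have sq0 : 0 <= rho - d' by rewrite subr_ge0.
  have hx2 : (rho - d') ^+ 2 <= l2norm (W x) ^+ 2.
    by rewrite ler_sqr ?nnegrE ?l2norm_ge0// ltW.
  have hy2 : (rho - d') ^+ 2 <= l2norm (W y) ^+ 2.
    by rewrite ler_sqr ?nnegrE ?l2norm_ge0// ltW.
  have h12 : l2norm (W (x - y)) ^+ 2 <= eta ^+ 2.
    by rewrite ler_sqr ?nnegrE ?l2norm_ge0// ltW.
  have h22 : l2norm (W (x + y)) ^+ 2 <= rho ^+ 2 * l2norm (x + y) ^+ 2.
    by rewrite -exprMn ler_sqr ?nnegrE ?mulr_ge0 ?l2norm_ge0// ltW.
  have key : rho ^+ 2 * l2norm (x - y) ^+ 2 <= rho ^+ 2 * e ^+ 2.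
    have a1 : rho ^+ 2 * l2norm (x - y) ^+ 2 <= rho ^+ 2 * 4 - rho ^+ 2 * l2norm (x + y) ^+ 2.
      rewrite -mulrBr ler_wpM2l ?sqr_ge0//; lra.
    have a2 : (rho - d') ^+ 2 *+ 4 - eta ^+ 2 <= rho ^+ 2 * l2norm (x + y) ^+ 2 by lra.
    have a3 : rho ^+ 2 - 2 * rho * d <= (rho - d') ^+ 2.
      have : 0 <= d' ^+ 2 by rewrite sqr_ge0.
      have : rho * d' <= rho * d by rewrite ler_wpM2l// ltW.
      rewrite sqrrB; lra.
    have a4 : eta ^+ 2 = rho ^+ 2 * e ^+ 2 / 4 by rewrite /eta; field.
    have a5 : 2 * rho * d = rho ^+ 2 * e ^+ 2 / 8 by rewrite /d; field.
    have a6 : 0 <= rho ^+ 2 * e ^+ 2 by rewrite mulr_ge0 ?sqr_ge0.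
    lra.
  by rewrite ler_pM2l ?exprn_gt0 in key.
have /choice[X hX] : forall n : nat, exists X, U X /\
    forall x y, X x -> X y -> A n.+1%:R^-1 x /\ l2norm (x - y) <= n.+1%:R^-1.
  move=> n; have n0 : 0 < n.+1%:R^-1 :> R by rewrite invr_gt0.
  have [X UX hX] := Uosc _ n0; exists (A n.+1%:R^-1 `&` X); split.
    by apply: filterI => //; exact: UA.
  by move=> x y [Ax Xx] [_ Xy]; split => //; exact: hX.
(* Finite intersections stay in [U], hence are nonempty. Choosing [x n] in the first [n + 1] sets
   puts [x m] and [x n] in a common [X N] for all [m, n >= N]. *)
have UY n : U [set x | forall m, (m <= n)%N -> X m x].
  elim: n => [|n IH].
    by apply: filterS (hX 0%N).1 => x Xx m; rewrite leqn0 => /eqP ->.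
  apply: filterS (filterI IH (hX n.+1).1) => x [h1 h2] m.
  by rewrite leq_eqVlt ltnS => /orP[/eqP->//|/h1].
have /choice[x hx] : forall n, exists x, forall m, (m <= n)%N -> X m x.
  by move=> n; exact: filter_ex (UY n).
have hA n : A n.+1%:R^-1 (x n).
  by have [_ /(_ (x n) (x n))] := hX n; case=> //; exact: hx.
have small (e : R) : 0 < e -> exists N : nat, N.+1%:R^-1 <= e.
  move=> e0; exists (Num.bound e^-1); rewrite invf_ple ?posrE//.
  apply: ltW; apply: lt_trans (archi_boundP _) _; first by rewrite invr_ge0 ltW.
  by rewrite ltr_nat.
have [|z hz] := @l2_complete _ _ x.
  move=> e e0; have [N hN] := small e e0; exists N => m n Nm Nn.
  by apply: le_trans hN; apply: ((hX N).2 _ _ _ _).2; exact: hx.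
have Dz : D z by apply: Dcl hz => n; case: (hA n).
have z1 : l2norm z <= 1 by apply: hcvg_norm_le hz _ => n; case: (hA n).
have Wz : rho <= l2norm (W z).
  apply: (@ler_addeps _ _ _ (1 + opnorm W)) => e e0.
  have [N1 h1] := small e e0; have [N2 h2] := hz e e0.
  pose N := maxn N1 N2.
  have [_ _ /ltW hN] := hA N; rewrite lerBlDr in hN; apply: le_trans hN _.
  rewrite mulrDr mulr1 addrA [X in _ <= X]addrAC; apply: lerD; last first.
    apply: le_trans h1; rewrite lef_pV2 ?posrE// ler_nat ltnS leq_maxl//.
  rewrite -{1}[x N](subrK z) bopD addrC; apply: le_trans (ler_l2normD _ _) _.
  rewrite lerD2r; apply: le_trans (l2norm_bop _ _) _.
  by rewrite mulrC ler_wpM2r ?opnorm_ge0// h2// leq_maxr.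
have Wzr : l2norm (W z) = rho.
  apply/le_anti; rewrite Wz andbT; apply: le_trans (ub _ Dz) _.
  by rewrite ler_piMr// ltW.
exists z; split => //.
- apply/le_anti; rewrite z1 /=; have := ub _ Dz.
  by rewrite Wzr ler_pMr.
- apply: contraTneq rp => Wz0; by rewrite -Wzr Wz0 l2norm0 ltxx.
- by rewrite Wzr.
Qed.

(** The first-order condition at a maximizer of [|W y| / |y|]. *)
Lemma maximizer_eigen (W : B) (D : set H) x :
  (forall (a : C) x y, D x -> D y -> D (a *: x + y)) ->
  D x -> l2norm x = 1 ->
  (forall y, D y -> l2norm (W y) <= l2norm (W x) * l2norm y) ->
  forall y, D y -> inner (W y) (W x) = (l2norm (W x) ^+ 2)%:C%C * inner y x.
Proof.
move=> Dlin Dx x1 hmax.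
have [rho rhoE] : exists rho, l2norm (W x) = rho by exists (l2norm (W x)).
have rho0 : 0 <= rho by rewrite -rhoE l2norm_ge0.
rewrite rhoE in hmax *.
(* A linear term dominated by a quadratic one vanishes: [t = a / (b + 1)] gives
   [a^2 (b + 2) <= 0]. *)
have quad (a b : R) : (forall t, 2 * t * a <= t ^+ 2 * b) -> a = 0.
  move=> h; have [b0|b0] := leP 0 b; last first.
    have h1 := h 1; have h2 := h (-1); rewrite sqrrN expr1n in h1 h2; lra.
  have bp : 0 < b + 1 by rewrite ltr_wpDl.
  have := h (a / (b + 1)).
  have -> : 2 * (a / (b + 1)) * a = (2 * a ^+ 2 * (b + 1)) / (b + 1) ^+ 2.
    by field; rewrite gt_eqF.
  have -> : (a / (b + 1)) ^+ 2 * b = (a ^+ 2 * b) / (b + 1) ^+ 2.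
    by field; rewrite gt_eqF.
  rewrite ler_pM2r ?invr_gt0 ?exprn_gt0// => h'.
  apply/eqP; rewrite -sqrf_eq0; apply/eqP/le_anti; rewrite sqr_ge0 andbT.
  have a2 : 0 <= a ^+ 2 by rewrite sqr_ge0.
  have : 0 <= a ^+ 2 * b by rewrite mulr_ge0.
  lra.
(* First variation in the direction [y]: the maximality inequality at [t y + x], expanded in [t]. *)
have re y : D y -> complex.Re (inner (W x) (W y)) = rho ^+ 2 * complex.Re (inner x y).
  move=> Dy; apply/eqP; rewrite -subr_eq0; apply/eqP.
  apply: (quad _ (rho ^+ 2 * l2norm y ^+ 2)) => t.
  have := hmax _ (Dlin t%:C%C _ _ Dy Dx).
  rewrite -ler_sqr ?nnegrE ?mulr_ge0 ?l2norm_ge0// exprMn bopD bopZ.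
  have expand (u v : H) : l2norm (t%:C%C *: u + v) ^+ 2 =
      t ^+ 2 * l2norm u ^+ 2 + 2 * t * complex.Re (inner v u) + l2norm v ^+ 2.
    rewrite addrC sqr_l2normD l2normZ normc_real innerZr Re_realM.
    rewrite exprMn real_normK ?num_real//.
    by move: (complex.Re _) (l2norm u) (l2norm v) => *; ring.
  rewrite (expand (W y) (W x)) (expand y x) x1 rhoE.
  move: (complex.Re (inner (W x) _)) (complex.Re (inner x _)) => a b.
  have := mulr_ge0 (sqr_ge0 t) (sqr_ge0 (l2norm (W y))).
  move: (l2norm (W y)) (l2norm y) => u v; lra.
move=> y Dy; rewrite innerC [inner y x]innerC -[_%:C%C]conj_realC -conj_mul.
congr (_^*); apply/eqP; rewrite eq_complex.
have D0 : D 0 by have := Dlin (-1) _ _ Dx Dx; rewrite scaleN1r addNr.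
(* The direction [- 'i y] supplies the imaginary parts. *)
have Diy : D ((- 'i%C) *: y) by have := Dlin (- 'i%C) _ _ Dy D0; rewrite addr0.
have ri := re _ Diy; rewrite bopZ !innerZr in ri.
have imi (w : C) : complex.Re (- 'i%C * w) = complex.Im w.
  by rewrite RecM RecN ImcN /= oppr0 mul0r sub0r mulN1r opprK.
rewrite !imi in ri.
by rewrite Re_realM Im_realM re// ri !eqxx.
Qed.

End maximizers.

(** * Successive construction of the singular values *)

Section singular_value_decomposition.
Variables (R : realType) (G : groupType).
Local Notation C := R[i].
Local Notation H := (l2 R G).
Local Notation B := (bop R G).

Definition perp (s : seq H) : set H := [set x | forall f, f \in s -> inner f x = 0].

Lemma perp_linear s (a : C) x y : perp s x -> perp s y -> perp s (a *: x + y).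
Proof.
by move=> hx hy f fs; rewrite innerDr innerZr hx// hy// mulr0 addr0.
Qed.

Lemma perp_closed s (x : nat -> H) l : (forall n, perp s (x n)) -> hcvg x l -> perp s l.
Proof.
move=> hx hl f fs; apply: (ccvg_unique (hcvg_inner f hl)).
apply: (eq_ccvg (z := fun=> 0)); last exact: ccvg_cst.
by move=> n; rewrite hx.
Qed.

Variables (r : R) (W : B) (M : R).
Hypotheses (r1 : 1 <= r) (hW : pairing_bound r%:E W M).

Lemma next_singular_vector (s : seq H) : exists x, [/\ perp s x,
  l2norm x = 1 \/ x = 0, x != 0 -> W x != 0 &
  forall y, perp s y -> l2norm (W y) <= l2norm (W x) * l2norm y].
Proof.
have [h|h] := pselect (exists2 x, perp s x & W x != 0).
  have [x [h1 h2 h3 h4]] := exists_maximizer r1 hW (@perp_linear s) (@perp_closed s) h.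
  by exists x; split => //; left.
exists 0; split; [by move=> f _; rewrite inner0r|by right|by rewrite eqxx|].
move=> y Dy; have [->|Wy] := eqVneq (W y) 0; first by rewrite bop0 l2norm0 mul0r.
by exfalso; apply: h; exists y.
Qed.

Let nx (s : seq H) : H := projT1 (cid (next_singular_vector s)).

Let nxP s : [/\ perp s (nx s),
  l2norm (nx s) = 1 \/ nx s = 0, nx s != 0 -> W (nx s) != 0 &
  forall y, perp s y -> l2norm (W y) <= l2norm (W (nx s)) * l2norm y].
Proof. exact: projT2 (cid (next_singular_vector s)). Qed.

Fixpoint singular_vectors n : seq H :=
  if n is m.+1 then nx (singular_vectors m) :: singular_vectors m else [::].

Definition singular_vector n : H := nx (singular_vectors n).
Definition singular_value n : R := l2norm (W (singular_vector n)).

Local Notation f := singular_vector.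
Local Notation sg := singular_value.

Lemma mem_singular_vectors x n :
  reflect (exists2 j, (j < n)%N & x = f j) (x \in singular_vectors n).
Proof.
elim: n => [|n IH]; first by constructor=> -[].
rewrite /= in_cons; apply: (iffP orP) => [[/eqP ->|/IH[j jn ->]]|[j]].
- by exists n.
- by exists j => //; exact: ltnW.
- rewrite ltnS leq_eqVlt => /orP[/eqP->->|jn xj]; first by left; apply/eqP.
  by right; apply/IH; exists j.
Qed.

Lemma perp_singular_vectors n x :
  perp (singular_vectors n) x <-> forall j, (j < n)%N -> inner (f j) x = 0.
Proof.
split=> h; first by move=> j jn; apply: h; apply/mem_singular_vectors; exists j.
by move=> _ /mem_singular_vectors[j jn ->]; exact: h.
Qed.

Lemma singular_vector_perp m n : (m < n)%N -> inner (f m) (f n) = 0.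
Proof. by case: (nxP (singular_vectors n)) => /perp_singular_vectors h _ _ _; exact: h. Qed.

Lemma singular_vector_norm n : l2norm (f n) = 1 \/ f n = 0.
Proof. by case: (nxP (singular_vectors n)). Qed.

Lemma singular_vector_neq0 n : 0 < sg n -> f n != 0.
Proof. by apply: contraTneq => fn; rewrite /singular_value fn bop0 l2norm0 ltxx. Qed.

Lemma singular_value_gt0 n : f n != 0 -> 0 < sg n.
Proof.
case: (nxP (singular_vectors n)) => _ _ h _ /h Wn.
rewrite lt0r l2norm_ge0 andbT; apply: contra Wn => /eqP h'.
by rewrite (l2norm_eq0 h').
Qed.

Lemma singular_value_max n x : (forall j, (j < n)%N -> inner (f j) x = 0) ->
  l2norm (W x) <= sg n * l2norm x.
Proof.
by case: (nxP (singular_vectors n)) => _ _ _ h /perp_singular_vectors; exact: h.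
Qed.

Lemma singular_vector_onb n : partial_onb n f.
Proof.
split=> [i j _ _|i _]; last exact: singular_vector_norm.
rewrite neq_ltn => /orP[|ji]; first exact: singular_vector_perp.
by rewrite innerC singular_vector_perp// (rmorph0 Num.conj).
Qed.

Lemma singular_eigen_perp n x : (forall j, (j < n)%N -> inner (f j) x = 0) ->
  inner (W x) (W (f n)) = (sg n ^+ 2)%:C%C * inner x (f n).
Proof.
move=> hx; have [fn|fn0] := singular_vector_norm n; last first.
  by rewrite /singular_value fn0 bop0 !inner0r mulr0.
apply: (@maximizer_eigen _ _ W (perp (singular_vectors n)) (f n)) => //.
- exact: perp_linear.
- by case: (nxP (singular_vectors n)).
- by case: (nxP (singular_vectors n)).
- exact/perp_singular_vectors.
Qed.

(** The later of the two vectors is orthogonal to everything before the earlier one, so the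
    eigenvalue equation of the earlier one applies to it. *)
Lemma singular_images_perp m n : m != n -> inner (W (f m)) (W (f n)) = 0.
Proof.
have h i j : (i < j)%N -> inner (W (f j)) (W (f i)) = 0.
  move=> ij; rewrite singular_eigen_perp; last first.
    by move=> k ki; apply: singular_vector_perp; exact: ltn_trans ij.
  by rewrite innerC singular_vector_perp// (rmorph0 Num.conj) mulr0.
rewrite neq_ltn => /orP[mn|]; last exact: h.
by rewrite innerC h// (rmorph0 Num.conj).
Qed.

(** Extends the equation from the complement of the earlier vectors to all [y]: the component of [y]
    along those vectors contributes 0 on both sides, since images and vectors are orthogonal. *)
Lemma singular_eigen n y :
  inner (W y) (W (f n)) = (sg n ^+ 2)%:C%C * inner y (f n).
Proof.
have hy : y = onb_sum n f y + (y - onb_sum n f y) by rewrite addrC subrK.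
rewrite {1}hy bopD innerDl [X in _ + X]singular_eigen_perp; last first.
  by move=> j jn; exact: partial_onb_inner (singular_vector_onb n) jn.
rewrite {1}/onb_sum bop_sum inner_suml big1 => [|j _]; last first.
  by rewrite bopZ innerZl singular_images_perp ?mulr0// ltn_eqF.
rewrite add0r innerBl inner_onb_sum0 ?subr0// => j jn.
exact: singular_vector_perp.
Qed.

Lemma singular_value_sum N : \sum_(n < N) sg n `^ r <= M `^ r.
Proof.
(* The normalized images satisfy [<h n, W (f n)> = sg n]; since [0^-1 = 0], they are null where
   [sg n = 0]. *)
pose h n := (sg n)^-1%:C%C *: W (f n).
have hh : partial_onb N h.
  split=> [i j _ _ ij|i _].
    by rewrite innerZl innerZr singular_images_perp// !mulr0.
  have [s0|s0] := eqVneq (sg i) 0; first by right; rewrite /h s0 invr0 scale0r.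
  by left; rewrite l2normZ normc_real ger0_norm ?invr_ge0 ?l2norm_ge0// mulVf.
have := pairing_bound_sum r1 hW (partial_onb_bessel hh)
  (partial_onb_bessel (singular_vector_onb N)).
apply: le_trans; rewrite le_eqVlt; apply/orP; left; apply/eqP; apply: eq_bigr => i _.
rewrite innerZl conj_realC innerxx -rmorphM normc_real -/(sg i).
congr (_ `^ r); have [->|s0] := eqVneq (sg i) 0; first by rewrite invr0 mul0r normr0.
by rewrite expr2 mulKf// ger0_norm// l2norm_ge0.
Qed.

Lemma singular_value_small (d : R) : 0 < d -> exists n, sg n < d.
Proof.
move=> d0; have [//|h] := pselect (exists n, sg n < d); exfalso.
have hd n : d <= sg n by rewrite leNgt; apply/negP => hn; apply: h; exists n.
have r0 : 0 < r by rewrite (lt_le_trans _ r1).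
have dp : 0 < d `^ r by rewrite powR_gt0.
pose N := Num.bound (M `^ r / d `^ r).
have : N%:R * d `^ r <= M `^ r.
  apply: le_trans (singular_value_sum N).
  rewrite -[N in N%:R]card_ord -sum1_card natr_sum mulr_suml; apply: ler_sum => i _.
  by rewrite mul1r ge0_ler_powR ?nnegrE ?(ltW r0) ?(ltW d0) ?l2norm_ge0.
rewrite -ler_pdivlMr// leNgt archi_boundP//.
by rewrite divr_ge0 ?powR_ge0.
Qed.

Lemma singular_valuesP : singular_values W sg.
Proof.
exists f; split.
- by move=> n; exact: l2norm_ge0.
- move=> m n sm sn; have [->|mn] := eqVneq m n.
    have [fn|fn] := singular_vector_norm n; first by rewrite innerxx fn expr1n.
    by have := singular_vector_neq0 sn; rewrite fn eqxx.
  by have [/(_ m n) h _] := singular_vector_onb (maxn m n).+1; apply: h => //;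
    rewrite ltnS ?leq_maxl ?leq_maxr.
- by move=> n y _; exact: singular_eigen.
- move=> x hx; have hx' n : inner (f n) x = 0.
    have [->|/singular_value_gt0/hx//] := eqVneq (f n) 0; exact: inner0l.
  apply: l2norm_eq0; apply/le_anti; rewrite l2norm_ge0 andbT.
  (* Orthogonality to every vector gives [|W x| <= sg n |x|] for all [n], and [sg n] becomes
     arbitrarily small. *)
  apply: (@ler_addeps _ _ _ (l2norm x)) => e e0; rewrite add0r.
  have [n hn] := singular_value_small e0.
  apply: le_trans (singular_value_max (n := n) _) _ => //.
  by rewrite ler_wpM2r ?l2norm_ge0// ltW.
Qed.

End singular_value_decomposition.

Lemma schatten_norm_le (R : realType) (G : groupType) (p : \bar R) (W : bop R G) M :
  (1 <= p)%E -> 0 <= M -> pairing_bound p W M -> (schatten_norm p W <= M%:E)%E.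
Proof.
case: p => [r| |//] /=.
  rewrite lee_fin => r1 M0 hW; have r0 : 0 < r by rewrite (lt_le_trans _ r1).
  apply: le_trans (ereal_inf_lbound _) _.
    by exists (singular_value r1 hW); [exact: singular_valuesP|].
  have -> : M%:E = ((M `^ r)%:E `^ r^-1)%E.
    by rewrite poweR_EFin -powRrM mulfV ?gt_eqF// powRr1.
  have sg0 n : (0 <= (singular_value r1 hW n `^ r)%:E)%E by rewrite lee_fin powR_ge0.
  apply: gt0_ler_poweR.
  - by rewrite invr_ge0 ltW.
  - by rewrite in_itv /= nneseries_ge0// leey.
  - by rewrite in_itv /= lee_fin powR_ge0 leey.
  apply: lime_le; first exact: is_cvg_nneseries.
  apply: nearW => n; rewrite sumEFin lee_fin big_mkord; exact: singular_value_sum.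
move=> _ M0 hW; rewrite lee_fin; apply: opnorm_le_inner => // x y x1 y1.
have := hW _ _ _ _ (bessel_unit x1) (bessel_unit y1) (weights_unit +oo%E).
by rewrite big_const card_unit /= addr0 mul1r.
Qed.

(** * Bounds on Bessel families from singular values *)

Lemma monotone_tail (R : realType) (u : nat -> R) M :
  (forall m n, (m <= n)%N -> u m <= u n) -> (forall n, u n <= M) ->
  forall e, 0 < e -> exists N, forall n, (N <= n)%N -> u n - u N <= e.
Proof.
move=> um uM e e0.
have hs : has_sup (range u) by split; [exists (u 0), 0 | exists M => _ [n _ <-]].
have [_ [N _ <-] hN] := sup_adherent e0 hs; exists N => n Nn.
rewrite lerBlDr -lerBlDl; apply: le_trans (ltW hN); rewrite lerD2r.
by apply: ub_le_sup; [case: hs|exists n].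
Qed.

(** Young's inequality for [a] and [b ^ (r - 1)] with exponents [r] and [r / (r - 1)]; at [r = 1]
    both sides equal [a], as [0 ^ 0 = 1]. *)
Lemma young_powR (R : realType) (a b r : R) : 0 <= a -> 0 <= b -> 1 <= r ->
  a * b `^ (r - 1) <= r^-1 * a `^ r + (1 - r^-1) * b `^ r.
Proof.
move=> a0 b0; rewrite le_eqVlt => /orP[/eqP<-|r1].
  by rewrite subrr powRr0 mulr1 invr1 subrr mul0r addr0 mul1r powRr1.
have r0 : 0 < r by rewrite (lt_trans _ r1).
have r10 : 0 < r - 1 by rewrite subr_gt0.
have q0 : 0 < r / (r - 1) by rewrite divr_gt0.
have E : r^-1 + (r / (r - 1))^-1 = 1 by field; rewrite ?gt_eqF.
have := conjugate_powR a0 (powR_ge0 b (r - 1)) r0 q0 E.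
rewrite -powRrM [(r - 1) * _]mulrC divfK ?gt_eqF//.
have E' : (r / (r - 1))^-1 = 1 - r^-1 by apply/eqP; rewrite eq_sym subr_eq addrC E.
by rewrite E' [_ / r]mulrC [b `^ r * _]mulrC.
Qed.

(** * Rank-one operators and finite compressions *)

Section rank_one.
Variables (R : realType) (G : groupType).
Local Notation C := R[i].
Local Notation H := (l2 R G).
Local Notation B := (bop R G).

Lemma inner_bopZ (a : C) (T : B) x y : inner x ((a *: T) y) = a * inner x (T y).
Proof. by rewrite bop_scaleE innerZr. Qed.

Lemma rank1_subproof (h f : H) : (fun x => inner f x *: h) \in @bop_pred R G.
Proof.
rewrite inE; split=> [a x y|].
  by rewrite innerDr innerZr scalerDl scalerA.
exists (l2norm f * l2norm h) => x; rewrite l2normZ mulrAC.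
by rewrite ler_wpM2r ?l2norm_ge0// cauchy_schwarz.
Qed.

Definition rank1 h f : B := Bop (rank1_subproof h f).

Lemma inner_rank1 h f x y : inner x (rank1 h f y) = inner x h * inner f y.
Proof. by rewrite /= innerZr mulrC. Qed.

Lemma compress_subproof (F1 F2 : {fset G}) (S : B) :
  (fun x => fproj F1 (S (fproj F2 x))) \in @bop_pred R G.
Proof.
rewrite inE; split=> [a x y|].
  by rewrite fprojD fprojZ bopD bopZ fprojD fprojZ.
exists (opnorm S) => x; apply: le_trans (l2norm_fproj _ _) _.
apply: le_trans (l2norm_bop _ _) _.
by rewrite ler_wpM2l ?opnorm_ge0// l2norm_fproj.
Qed.

Definition compress F1 F2 S : B := Bop (compress_subproof F1 F2 S).

Lemma inner_compress F1 F2 S x y :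
  inner x (compress F1 F2 S y) = inner (fproj F1 x) (S (fproj F2 y)).
Proof. by rewrite inner_fproj. Qed.

End rank_one.

(** * Stability properties of bounds on rows *)

Section rows_bounds.
Variables (R : realType) (G : groupType) (p : \bar R).
Local Notation C := R[i].
Local Notation H := (l2 R G).
Local Notation B := (bop R G).
Implicit Types (S T : B).

Lemma rows_boundD S T M N : rows_bound p S M -> rows_bound p T N ->
  rows_bound p (S + T) (M + N).
Proof.
move=> hS hT I J l k c bl bk wc.
apply: le_trans (lerD (hS I J l k c bl bk wc) (hT I J l k c bl bk wc)).
apply: le_trans _ (le_normcD _ _).
rewrite le_eqVlt; apply/orP; left; apply/eqP; congr normc.
rewrite -big_split/=; apply: eq_bigr => i _; rewrite -mulrDr; congr (_ * _).
by rewrite -big_split/=; apply: eq_bigr => j _; rewrite -innerDr.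
Qed.

Lemma rows_boundZ (a : C) S M : rows_bound p S M ->
  rows_bound p (a *: S) (normc a * M).
Proof.
move=> hS I J l k c bl bk wc.
have := hS I J l k c bl bk wc.
move=> /(ler_wpM2l (normc_ge0 a)); apply: le_trans; rewrite -normcM.
rewrite le_eqVlt; apply/orP; left; apply/eqP; congr normc.
rewrite mulr_sumr; apply: eq_bigr => i _; rewrite mulrCA; congr (_ * _).
by rewrite mulr_sumr; apply: eq_bigr => j _; rewrite bop_scaleE innerZr.
Qed.

Lemma rows_boundN S M : rows_bound p S M -> rows_bound p (- S) M.
Proof. by move=> h; rewrite -scaleN1r -[M]mul1r -(normc1 R) -normcN; exact: rows_boundZ. Qed.

Lemma rows_bound0 : rows_bound p (0 : B) 0.
Proof.
move=> I J l k c _ _ _; rewrite big1 ?normc0// => i _.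
by rewrite big1 ?mulr0// => j _; rewrite inner0r.
Qed.

Lemma rows_bound_sum N (S : 'I_N -> B) (M : 'I_N -> R) :
  (forall i, rows_bound p (S i) (M i)) -> rows_bound p (\sum_i S i) (\sum_i M i).
Proof.
move=> h; elim/big_ind2: _ => [|*|i _]; [exact: rows_bound0| |exact: h].
exact: rows_boundD.
Qed.

Lemma rows_bound_compress F1 F2 S M : rows_bound p S M ->
  rows_bound p (compress F1 F2 S) M.
Proof.
move=> hS I J l k c bl bk wc.
have := hS _ _ _ _ c (bessel_rows_fproj F1 bl) (bessel_rows_fproj F2 bk) wc.
by under eq_bigr do under eq_bigr do rewrite -inner_compress.
Qed.

(** From [2 a b <= a^2 + b^2] and the first half of [bessel_rows] on each side. With [u], [v] a pair
    of singular vectors this is a column sum of the substochastic matrix. *)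
Lemma bessel_rows_amgm (I J : finType) (l k : I -> J -> H) (u v : H) :
  bessel_rows l -> bessel_rows k -> l2norm u <= 1 -> l2norm v <= 1 ->
  \sum_i \sum_j normc (inner (l i j) u) * normc (inner v (k i j)) <= 1.
Proof.
move=> [bl _] [bk _] u1 v1.
have u2 : l2norm u ^+ 2 <= 1 by rewrite expr_le1// l2norm_ge0.
have v2 : l2norm v ^+ 2 <= 1 by rewrite expr_le1// l2norm_ge0.
have hu := le_trans (bl u) u2; have hv := le_trans (bk v) v2.
apply: (@le_trans _ _ (2^-1 * (\sum_i \sum_j normc (inner (l i j) u) ^+ 2) +
    2^-1 * (\sum_i \sum_j normc (inner (k i j) v) ^+ 2))); last by lra.
rewrite !mulr_sumr -big_split/=; apply: ler_sum => i _.
rewrite !mulr_sumr -big_split/=; apply: ler_sum => j _.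
rewrite [inner v _]innerC normc_conj.
move: (normc _) (normc _) => a b; have := sqr_ge0 (a - b); nra.
Qed.

Lemma rows_bound_rank1 (u v : H) : (1 <= p)%E -> l2norm u <= 1 -> l2norm v <= 1 ->
  rows_bound p (rank1 u v) 1.
Proof.
move=> p1 u1 v1 I J l k c bl bk wc.
apply: le_trans (bessel_rows_amgm bl bk u1 v1).
apply: le_trans (normc_sum _ _ _) _; apply: ler_sum => i _.
rewrite normcM; apply: le_trans (ler_piMl (normc_ge0 _) (weights_le1 i p1 wc)) _.
apply: le_trans (normc_sum _ _ _) _; apply: ler_sum => j _.
by rewrite inner_rank1 normcM.
Qed.

Lemma rows_bound_rank1_compress (u v : H) (F : {fset G}) (e : R) : (1 <= p)%E ->
  l2norm u <= 1 -> l2norm v <= 1 -> 0 < e ->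
  l2norm (u - fproj F u) <= e -> l2norm (v - fproj F v) <= e ->
  rows_bound p (rank1 u v - compress F F (rank1 u v)) (e *+ 2).
Proof.
move=> p1 u1 v1 e0 ue ve.
have scale (x : H) : l2norm x <= e -> l2norm ((e^-1)%:C%C *: x) <= 1.
  move=> xe; rewrite l2normZ normc_real ger0_norm ?invr_ge0 ?(ltW e0)//.
  by rewrite mulrC ler_pdivrMr// mul1r.
(* With [P] the projection, [|u><v| - |P u><P v|] splits as [|u - P u><v| + |P u><v - P v|]. The
   factor [e] is extracted so that each small vector is rescaled into the unit ball. *)
have -> : rank1 u v - compress F F (rank1 u v) =
    e%:C%C *: rank1 ((e^-1)%:C%C *: (u - fproj F u)) v +
    e%:C%C *: rank1 (fproj F u) ((e^-1)%:C%C *: (v - fproj F v)).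
  apply: bop_ext => y; apply: inner_ext => x.
  rewrite !bop_addE bop_oppE !innerDr innerNr.
  rewrite !inner_bopZ inner_compress !inner_rank1 innerZr innerZl conj_realC innerBr innerBl.
  rewrite [inner (fproj F x) u]inner_fproj -[inner v (fproj F y)]inner_fproj.
  have : e%:C%C * (e^-1)%:C%C = 1 :> C by rewrite -rmorphM mulfV ?gt_eqF.
  move: (e%:C%C) (e^-1)%:C%C => a a' aa.
  move: (inner x u) (inner x (fproj F u)) (inner v y) (inner (fproj F v) y) => b b' d d'.
  transitivity ((a * a') * ((b - b') * d + b' * (d - d'))); first by rewrite aa; ring.
  by ring.
have rb (a b : H) : l2norm a <= 1 -> l2norm b <= 1 -> rows_bound p (e%:C%C *: rank1 a b) e.
  move=> a1 b1; have := rows_boundZ e%:C%C (rows_bound_rank1 p1 a1 b1).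
  by rewrite normc_real ger0_norm ?mulr1// ltW.
rewrite mulr2n; apply: rows_boundD; apply: rb => //; [exact: scale| |exact: scale].
exact: le_trans (l2norm_fproj _ _) u1.
Qed.

End rows_bounds.

(** * Singular value expansions and Young's inequality *)

Section singular_expansions.
Variables (R : realType) (G : groupType) (r : R).
Hypothesis r1 : 1 <= r.
Local Notation C := R[i].
Local Notation H := (l2 R G).
Local Notation B := (bop R G).

(** Young's inequality is applied entrywise to [sg n / M] and the weight of [i], then summed against
    [A]. The term in [sg] is controlled by the sums over [i], the term in [b] by the sums over
    [n]. *)
Lemma substochastic_bound (I : finType) N (A : I -> 'I_N -> R) (c : I -> C)
    (sg : 'I_N -> R) (M : R) : 0 < M ->
  (forall i n, 0 <= A i n) -> (forall i, \sum_n A i n <= 1) ->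
  (forall n, \sum_i A i n <= 1) -> weights r%:E c -> (forall n, 0 <= sg n) ->
  \sum_n sg n `^ r <= M `^ r ->
  \sum_i \sum_n normc (c i) * (sg n * A i n) <= M.
Proof.
move=> M0 A0 An Ai [b [b0 cb sb]] sg0 ssg.
have r0 : 0 < r by rewrite (lt_le_trans _ r1).
have ri0 : 0 <= r^-1 by rewrite invr_ge0 ltW.
have ri1 : 0 <= 1 - r^-1 by rewrite subr_ge0 invf_le1.
pose sg' n := sg n / M.
have sg'0 n : 0 <= sg' n by rewrite divr_ge0// ltW.
have ssg' : \sum_n sg' n `^ r <= 1.
  have E n : sg' n `^ r = sg n `^ r / M `^ r.
    apply/(canRL (mulfK _)); first by rewrite gt_eqF// powR_gt0.
    by rewrite -powRM ?(ltW M0)// /sg' divfK ?gt_eqF.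
  under eq_bigr do rewrite E.
  by rewrite -mulr_suml ler_pdivrMr ?powR_gt0// mul1r.
have le1 i n : normc (c i) * (sg n * A i n) <=
    M * (r^-1 * (sg' n `^ r * A i n) + (1 - r^-1) * (b i `^ r * A i n)).
  have -> : normc (c i) * (sg n * A i n) = M * (sg' n * normc (c i) * A i n).
    by rewrite /sg'; field; rewrite gt_eqF.
  rewrite ler_pM2l// [r^-1 * _]mulrA [(1 - _) * _]mulrA -mulrDl ler_wpM2r//.
  apply: le_trans (young_powR (sg'0 n) (b0 i) r1).
  by rewrite ler_wpM2l.
apply: (@le_trans _ _ (\sum_i \sum_n
    M * (r^-1 * (sg' n `^ r * A i n) + (1 - r^-1) * (b i `^ r * A i n)))).
  by apply: ler_sum => i _; apply: ler_sum => n _.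
have -> : \sum_i \sum_n
    M * (r^-1 * (sg' n `^ r * A i n) + (1 - r^-1) * (b i `^ r * A i n)) =
    M * (r^-1 * (\sum_n sg' n `^ r * \sum_i A i n) +
         (1 - r^-1) * (\sum_i b i `^ r * \sum_n A i n)).
  transitivity (M * (r^-1 * (\sum_i \sum_n sg' n `^ r * A i n) +
     (1 - r^-1) * (\sum_i \sum_n b i `^ r * A i n))).
    rewrite !mulr_sumr -big_split mulr_sumr/=; apply: eq_bigr => i _.
    by rewrite !mulr_sumr -big_split mulr_sumr.
  rewrite [in LHS]exchange_big/=; congr (M * (r^-1 * _ + (1 - r^-1) * _)).
    by apply: eq_bigr => n _; rewrite mulr_sumr.
  by apply: eq_bigr => i _; rewrite mulr_sumr.
rewrite ler_piMr ?(ltW M0)//.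
rewrite [leRHS](_ : 1 = r^-1 * 1 + (1 - r^-1) * 1); last by ring.
apply: lerD; rewrite ler_wpM2l//.
  apply: le_trans ssg'; apply: ler_sum => n _; rewrite ler_piMr ?powR_ge0//.
by apply: le_trans sb; apply: ler_sum => i _; rewrite ler_piMr ?powR_ge0.
Qed.

(** [X] is the sum of the [sg n |h n><f n|] in the weak sense, which is the convergence that
    finitely many inner products can see. *)
Definition expansion (X : B) (sg : nat -> R) (h f : nat -> H) :=
  [/\ forall n, 0 <= sg n, forall N, partial_onb N h, forall N, partial_onb N f &
  forall x y, ccvg (fun N => \sum_(n < N) (sg n)%:C%C * (inner x (h n) * inner (f n) y))
    (inner x (X y))].

Lemma rows_bound_expansion X sg h f M : 0 < M -> expansion X sg h f ->
  (forall N, \sum_(n < N) sg n `^ r <= M `^ r) -> rows_bound r%:E X M.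
Proof.
move=> M0 [sg0 hh hf hX] ssg I J l k c bl bk wc.
apply: (@ccvg_norm_le _ (fun N => \sum_i c i * \sum_j
  \sum_(n < N) (sg n)%:C%C * (inner (l i j) (h n) * inner (f n) (k i j)))).
  apply: ccvg_sum => i _; apply: ccvgZ.
  by apply: ccvg_sum => j _; exact: hX.
move=> e e0; exists 0%N => N _.
suff : normc (\sum_i c i * \sum_j \sum_(n < N) (sg n)%:C%C *
    (inner (l i j) (h n) * inner (f n) (k i j))) <= M.
  by move=> /le_trans; apply; rewrite lerDl ltW.
have bh := partial_onb_bessel (hh N); have bf := partial_onb_bessel (hf N).
pose A i (n : 'I_N) := \sum_j normc (inner (l i j) (h n)) * normc (inner (f n) (k i j)).
have A0 i n : 0 <= A i n.
  by apply: sumr_ge0 => j _; rewrite mulr_ge0 ?normc_ge0.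
have Ai n : \sum_i A i n <= 1.
  exact: (bessel_rows_amgm bl bk (bessel_l2norm n bh) (bessel_l2norm n bf)).
(* Here the roles are exchanged: the Bessel property of [h] and [f] is applied to each row vector,
   then the second half of [bessel_rows] sums over [j]. *)
have An i : \sum_n A i n <= 1.
  rewrite /A exchange_big/=.
  have [_ /(_ i) l1] := bl; have [_ /(_ i) k1] := bk.
  apply: (@le_trans _ _ (2^-1 * (\sum_j l2norm (l i j) ^+ 2) +
    2^-1 * (\sum_j l2norm (k i j) ^+ 2))); last by lra.
  rewrite !mulr_sumr -big_split/=; apply: ler_sum => j _.
  have h2 : 0 <= 2^-1 :> R by rewrite invr_ge0.
  apply: le_trans (lerD (ler_wpM2l h2 (bh (l i j))) (ler_wpM2l h2 (bf (k i j)))).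
  rewrite !mulr_sumr -big_split/=; apply: ler_sum => n _.
  rewrite [inner (l i j) _]innerC normc_conj.
  move: (normc _) (normc _) => a b; have := sqr_ge0 (a - b); nra.
have := substochastic_bound M0 A0 An Ai wc (fun n : 'I_N => sg0 n) (ssg N).
apply: le_trans; apply: le_trans (normc_sum _ _ _) _; apply: ler_sum => i _.
rewrite normcM -mulr_sumr ler_wpM2l ?normc_ge0// exchange_big/=.
apply: le_trans (normc_sum _ _ _) _; apply: ler_sum => n _.
rewrite -mulr_sumr normcM normc_real ger0_norm// ler_wpM2l//.
apply: le_trans (normc_sum _ _ _) _; apply: ler_sum => j _.
by rewrite normcM.
Qed.

(** Zeroing the first coefficients instead of shifting the sequence keeps the same [h] and [f]. *)
Lemma expansion_tail X sg h f N : expansion X sg h f ->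
  expansion (X - \sum_(n < N) (sg n)%:C%C *: rank1 (h n) (f n))
    (fun n => if (n < N)%N then 0 else sg n) h f.
Proof.
move=> [sg0 hh hf hX]; split => //; first by move=> n; case: ifP.
move=> x y e e0; have [N1 hN1] := hX x y e e0.
exists (maxn N1 N) => m; rewrite geq_max => /andP[m1 mN].
pose t n := (sg n)%:C%C * (inner x (h n) * inner (f n) y).
have E k : \sum_(n < N + k) (if (n < N)%N then 0 else sg n)%:C%C *
    (inner x (h n) * inner (f n) y) = \sum_(n < N + k) t n - \sum_(n < N) t n.
  elim: k => [|k IH].
    by rewrite addn0 subrr big1// => n _; rewrite ltn_ord mul0r.
  by rewrite addnS !big_ord_recr /= IH ltnNge leq_addr/= addrAC.
rewrite -(subnKC mN) E subnKC// bop_addE bop_oppE bop_sumE innerBr inner_sumr.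
have -> : \sum_(n < N) inner x (((sg n)%:C%C *: rank1 (h n) (f n)) y) =
    \sum_(n < N) t n.
  by apply: eq_bigr => n _; rewrite inner_bopZ inner_rank1.
rewrite opprB addrA subrK; exact: hN1.
Qed.

(** The squared distance of two partial sums is a difference of values of [A], which is increasing
    and bounded by Bessel's inequality. *)
Lemma hcauchy_onb_sum (f : nat -> H) x : (forall N, partial_onb N f) ->
  hcauchy (fun N => onb_sum N f x).
Proof.
move=> hf; pose A n := \sum_(i < n) normc (inner (f i) x) ^+ 2.
have Am m n : (m <= n)%N -> A m <= A n.
  move=> mn; rewrite /A -(subnKC mn) big_split_ord/= lerDl sumr_ge0// => i _.
  exact: sqr_ge0.
have AM n : A n <= l2norm x ^+ 2 by exact: (partial_onb_bessel (hf n)).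
have sx n : inner (onb_sum n f x) x = (A n)%:C%C.
  rewrite inner_suml rmorph_sum; apply: eq_bigr => i _.
  by rewrite innerZl mulc_conj.
have ss n m : (n <= m)%N -> inner (onb_sum n f x) (onb_sum m f x) = (A n)%:C%C.
  move=> nm; rewrite -sx.
  have -> : onb_sum m f x = x - (x - onb_sum m f x) by rewrite opprB addrC subrK.
  rewrite innerBr [X in _ - X]inner_onb_sum0 ?subr0// => i i_n.
  by apply: (partial_onb_inner x (hf m)); exact: leq_trans nm.
have nrm n : l2norm (onb_sum n f x) ^+ 2 = A n.
  by apply: (@complexI R); rewrite -innerxx ss.
have diff n m : (n <= m)%N -> l2norm (onb_sum m f x - onb_sum n f x) ^+ 2 = A m - A n.
  move=> nm; rewrite l2norm_distC sqr_l2normB ss// !nrm /= mulr2n; ring.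
move=> e e0; have e2 : 0 < (e / 2) ^+ 2 by rewrite exprn_gt0// divr_gt0.
have [N hN] := monotone_tail Am AM e2.
have hN' n : (N <= n)%N -> l2norm (onb_sum n f x - onb_sum N f x) <= e / 2.
  move=> Nn; rewrite -ler_sqr ?nnegrE ?l2norm_ge0 ?divr_ge0 ?(ltW e0)//.
  by rewrite diff// hN.
exists N => m n Nm Nn.
have -> : onb_sum m f x - onb_sum n f x =
    (onb_sum m f x - onb_sum N f x) - (onb_sum n f x - onb_sum N f x).
  by rewrite opprB addrA subrK.
apply: le_trans (ler_l2normB _ _) _.
by rewrite [leRHS](splitr e); exact: lerD (hN' _ Nm) (hN' _ Nn).
Qed.

(** The [h n] are the normalized images of the singular vectors; the eigenvalue equation makes them
    orthonormal where [sg n] is positive. *)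
Lemma singular_values_expansion (S : B) sg : singular_values S sg ->
  exists h f, expansion S sg h f.
Proof.
move=> [f [sg0 onf eig ker]].
(* The hypotheses say nothing of [f n] when [sg n = 0]; such vectors are replaced by 0. *)
pose f' n := if 0 < sg n then f n else 0.
pose h n := ((sg n)^-1)%:C%C *: S (f' n).
have f'P m n : inner (f' m) (f' n) = ((m == n) && (0 < sg m))%:R.
  rewrite /f'; case: ifPn => hm; last by rewrite inner0l andbF.
  case: ifPn => hn; first by rewrite onf// andbT.
  by rewrite inner0r; case: eqP => // mn; rewrite -mn hm in hn.
have Sf n : S (f' n) = (sg n)%:C%C *: h n.
  rewrite /h scalerA -rmorphM; have [s0|s0] := eqVneq (sg n) 0.
    by rewrite /f' s0 ltxx bop0 scaler0.
  by rewrite mulfV// scale1r.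
have nf' n : l2norm (f' n) = 1 \/ f' n = 0.
  rewrite /f'; case: ifPn => hn; [left|by right].
  apply/eqP; rewrite -(@eqrXn2 _ 2) ?l2norm_ge0//; apply/eqP.
  by apply: (@complexI R); rewrite -innerxx onf// eqxx expr1n.
have hf' N : partial_onb N f'.
  by split=> [i j _ _ /negbTE ij|i _]; [rewrite f'P ij|].
have SS m n : inner (S (f' m)) (S (f' n)) = (sg n ^+ 2)%:C%C * inner (f' m) (f' n).
  have [hn|hn] := boolP (0 < sg n).
    by rewrite [f' n]/f' hn eig.
  by rewrite [f' n]/f' (negbTE hn) bop0 !inner0r mulr0.
have hh N : partial_onb N h.
  split=> [i j _ _ /negbTE ij|i _].
    by rewrite innerZl innerZr SS f'P ij !mulr0.
  have [hi|hi] := boolP (0 < sg i); last first.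
    by right; rewrite /h /f' (negbTE hi) bop0 scaler0.
  left; apply/eqP; rewrite -(@eqrXn2 _ 2) ?l2norm_ge0//; apply/eqP.
  apply: (@complexI R); rewrite -innerxx innerZl innerZr SS f'P eqxx hi conj_realC.
  rewrite mulr1 expr1n mulrA -!rmorphM; congr (_%:C%C).
  by field; rewrite gt_eqF.
exists h, f'; split => // x y.
have [z hz] := l2_complete (hcauchy_onb_sum y hf').
(* [z] is the projection of [y] on the closed span of the [f' n], so [y - z] is orthogonal to all of
   them and is killed by [S]. *)
have Syz : S y = S z.
  apply/eqP; rewrite -subr_eq0 -bopB; apply/eqP; apply: ker => n sn.
  have -> : f n = f' n by rewrite /f' sn.
  rewrite innerBr; apply/eqP; rewrite subr_eq0; apply/eqP.
  apply: (ccvg_unique _ (hcvg_inner (f' n) hz)) => e e0.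
  exists n.+1 => m nm; rewrite -normcN opprB -innerBr.
  by rewrite (partial_onb_inner y (hf' m) nm) normc0 ltW.
have hS : hcvg (fun N => S (onb_sum N f' y)) (S z).
  move=> e e0; have c0 : 0 < opnorm S + 1 by rewrite ltr_wpDl ?opnorm_ge0.
  have [N hN] := hz _ (divr_gt0 e0 c0); exists N => n /hN.
  rewrite -bopB ler_pdivlMr// mulrC; apply: le_trans.
  by apply: le_trans (l2norm_bop _ _) _; rewrite ler_wpM2r ?l2norm_ge0// lerDl.
rewrite Syz; apply: eq_ccvg (hcvg_inner x hS) => N.
rewrite bop_sum inner_sumr; apply: eq_bigr => n _.
by rewrite bopZ Sf !innerZr; ring.
Qed.

End singular_expansions.

(** * Operators of finite Schatten norm and their truncations *)

Section schatten_operators.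
Variables (R : realType) (G : groupType).
Local Notation C := R[i].
Local Notation B := (bop R G).

Lemma schatten_sum_le (r : R) (sg : nat -> R) (m : R) : 1 <= r -> 0 <= m ->
  ((\sum_(n <oo) (sg n `^ r)%:E) `^ r^-1 <= m%:E)%E ->
  forall N, \sum_(n < N) sg n `^ r <= m `^ r.
Proof.
move=> r1 m0 hm N; have r0 : 0 < r by rewrite (lt_le_trans _ r1).
have sg0 n : (0 <= (sg n `^ r)%:E)%E by rewrite lee_fin powR_ge0.
set T := (\sum_(n <oo) _)%E in hm.
have T0 : (0 <= T)%E by exact: nneseries_ge0.
have Tm : (T <= (m `^ r)%:E)%E.
  rewrite -poweR_EFin -[leLHS]poweRe1// -[X in (T `^ X)%E](mulVf (lt0r_neq0 r0)) poweRrM.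
  apply: gt0_ler_poweR => //; first exact: ltW.
  - by rewrite in_itv /= poweR_ge0 leey.
  - by rewrite in_itv /= lee_fin m0 leey.
rewrite -lee_fin; apply: le_trans Tm; rewrite -sumEFin -(big_mkord xpredT (fun n => (sg n `^ r)%:E)).
exact: nneseries_lim_ge.
Qed.

(** For [p = +oo] the second half of [bessel_rows] bounds each row by [opnorm S]. For finite [p] an
    almost minimal sequence is expanded; the excess [e] also makes the bound positive, as
    [rows_bound_expansion] requires. *)
Lemma rows_bound_schatten (p : \bar R) (S : B) : (1 <= p)%E ->
  (schatten_norm p S < +oo)%E -> rows_bound p S (fine (schatten_norm p S)).
Proof.
case: p => [r| |//] p1 hS; last first.
  move=> I J l k c [_ bl] [_ bk] wc /=; rewrite -[leRHS]mul1r.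
  apply: le_trans (ler_wpM2r (opnorm_ge0 S) wc); rewrite mulr_suml.
  apply: le_trans (normc_sum _ _ _) _; apply: ler_sum => i _.
  rewrite normcM ler_wpM2l ?normc_ge0//; apply: le_trans (normc_sum _ _ _) _.
  apply: (@le_trans _ _ (\sum_j opnorm S * (2^-1 * l2norm (l i j) ^+ 2 +
      2^-1 * l2norm (k i j) ^+ 2))).
    apply: ler_sum => j _; apply: le_trans (normc_inner_bop _ _ _) _.
    rewrite ler_wpM2l ?opnorm_ge0//.
    move: (l2norm _) (l2norm _) => a b; have := sqr_ge0 (a - b); nra.
  rewrite -mulr_sumr ler_piMr ?opnorm_ge0// big_split/= -!mulr_sumr.
  have := bl i; have := bk i; lra.
have r1 : 1 <= r by rewrite -lee_fin.
have S0 := schatten_norm_ge0 r%:E S.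
have Sfin : schatten_norm r%:E S \is a fin_num by rewrite ge0_fin_numE.
move=> I J l k c bl bk wc; apply/ler_addgt0Pr => e e0.
have [_ [sg hsg <-] hlt] := lb_ereal_inf_adherent e0 Sfin.
have [h [f hexp]] := singular_values_expansion hsg.
have M0 : 0 < fine (schatten_norm r%:E S) + e by rewrite ltr_wpDl// fine_ge0.
apply: (rows_bound_expansion r1 M0 hexp) => //.
apply: schatten_sum_le => //; first exact: ltW.
by rewrite EFinD fineK// ltW.
Qed.

(** The expansion is cut at [N]. The tail and its compression are both small, and the head is a
    finite sum of rank-one operators, whose vectors are nearly supported in a finite [F]. *)
Lemma schatten_compress (r : R) (S : B) (d : R) : 1 <= r ->
  (schatten_norm r%:E S < +oo)%E -> 0 < d ->
  exists F, rows_bound r%:E (S - compress F F S) d.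
Proof.
move=> r1 hS d0; have r0 : 0 < r by rewrite (lt_le_trans _ r1).
have S0 := schatten_norm_ge0 r%:E S.
have Sfin : schatten_norm r%:E S \is a fin_num by rewrite ge0_fin_numE.
have [_ [sg hsg <-] hlt] := lb_ereal_inf_adherent ltr01 Sfin.
have [h [f hexp]] := singular_values_expansion hsg.
pose m := fine (schatten_norm r%:E S) + 1.
have m0 : 0 < m by rewrite ltr_wpDl// fine_ge0.
have ssg : forall N, \sum_(n < N) sg n `^ r <= m `^ r.
  apply: schatten_sum_le => //; first exact: ltW.
  by rewrite EFinD fineK// ltW.
pose A n := \sum_(i < n) sg i `^ r.
have Am i n : (i <= n)%N -> A i <= A n.
  by move=> mn; rewrite /A -(subnKC mn) big_split_ord/= lerDl sumr_ge0// => j _;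
    exact: powR_ge0.
have d4 : 0 < d / 4 by rewrite divr_gt0.
have [N hN] := monotone_tail Am ssg (powR_gt0 r d4).
have htail := expansion_tail N hexp.
set SN := \sum_(n < N) _ in htail.
have tail : rows_bound r%:E (S - SN) (d / 4).
  apply: (rows_bound_expansion r1 d4 htail) => k.
  pose T n := \sum_(i < n) (if (i < N)%N then 0 else sg i) `^ r.
  have TE j : T (N + j)%N = A (N + j)%N - A N.
    elim: j => [|j IH].
      by rewrite addn0 subrr /T big1// => i _; rewrite ltn_ord powR0// gt_eqF.
    by rewrite addnS /T /A !big_ord_recr/= -/(T _) -/(A _) IH ltnNge leq_addr/= addrAC.
  apply: (@le_trans _ _ (T (N + k)%N)); last by rewrite TE hN// leq_addr.
  rewrite /T addnC big_split_ord/= lerDl sumr_ge0// => i _; exact: powR_ge0.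
pose s := \sum_(n < N) sg n.
have [sg0 hh hf _] := hexp.
have s0 : 0 <= s by exact: sumr_ge0.
(* Each rank-one term costs [2 e sg n], in total [2 s e <= d / 2]; the [+ 1] allows [s = 0]. *)
pose e := d / 4 / (s + 1).
have e0 : 0 < e by rewrite !divr_gt0// ltr_wpDl.
have [F1 hF1] := fproj_approx_fin (fun n : 'I_N => h n) e0.
have [F2 hF2] := fproj_approx_fin (fun n : 'I_N => f n) e0.
pose F := (F1 `|` F2)%fset.
have {}hF1 := hF1 F (fsubsetUl _ _); have {}hF2 := hF2 F (fsubsetUr _ _).
exists F.
have cSN : compress F F SN =
    \sum_(n < N) (sg n)%:C%C *: compress F F (rank1 (h n) (f n)).
  apply: bop_ext => x; apply: inner_ext => y; rewrite inner_compress.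
  rewrite !bop_sumE !inner_sumr; apply: eq_bigr => n _.
  by rewrite !inner_bopZ inner_compress.
have head : rows_bound r%:E (SN - compress F F SN) (d / 2).
  rewrite cSN /SN -sumrB.
  have h1 (n : 'I_N) := bessel_l2norm n (partial_onb_bessel (hh N)).
  have f1 (n : 'I_N) := bessel_l2norm n (partial_onb_bessel (hf N)).
  have r1' : (1 <= r%:E)%E by rewrite lee_fin.
  have hn (n : 'I_N) := rows_boundZ (sg n)%:C%C
    (rows_bound_rank1_compress r1' (h1 n) (f1 n) e0 (hF1 n) (hF2 n)).
  have := rows_bound_sum hn.
  under eq_bigr do rewrite scalerBr.
  have : \sum_(n < N) normc (sg n)%:C%C * e *+ 2 <= d / 2.
    under eq_bigr do rewrite normc_real ger0_norm//.
    rewrite sumrMnl -mulr_suml -/s.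
    have : s * e <= d / 4.
      rewrite /e mulrA ler_pdivrMr ?ltr_wpDl// [s * _]mulrC.
      by rewrite ler_wpM2l ?(ltW d4)// lerDl.
    rewrite mulr2n; lra.
  move=> le2 hb I J l k c bl bk wc; apply: le_trans (hb I J l k c bl bk wc) _.
  by apply: le_trans le2; apply: ler_sum => n _; rewrite mulrnAr.
have cB : compress F F (S - SN) = compress F F S - compress F F SN.
  apply: bop_ext => x; apply: inner_ext => y.
  by rewrite bop_addE bop_oppE innerBr !inner_compress bop_addE bop_oppE innerBr.
have -> : S - compress F F S =
    (S - SN) - compress F F (S - SN) + (SN - compress F F SN).
  by rewrite cB opprB addrAC [S - SN + _]addrA subrK [RHS]addrA subrK.
have -> : d = d / 4 + d / 4 + d / 2 by lra.
apply: rows_boundD head; apply: rows_boundD => //.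
by apply: rows_boundN; exact: rows_bound_compress.
Qed.

End schatten_operators.

(** * The map on tensors *)

Section twisted_schur_map.
Variables (R : realType) (G : groupType) (p : \bar R).
Hypothesis p1 : (1 <= p)%E.
Local Notation C := R[i].
Local Notation B := (bop R G).
Local Notation Sp := (schatten G p).
Implicit Types (phi : dual_ball R G) (s t : G).

Definition twist s t (T : B) : B :=
  bop_comp (transl R s) (bop_comp T (transl R (t^-1)%g)).

Lemma twist_linear s t (a : C) T T' : twist s t (a *: T + T') = a *: twist s t T + twist s t T'.
Proof.
apply: bop_ext => x; set y := transl R (t^-1)%g x.
transitivity (transl R s (a *: T y + T' y)); first by [].
by rewrite bopD bopZ.
Qed.

Lemma matrix_boundD (K L : G -> G -> C) M N : matrix_bound p K M -> matrix_bound p L N ->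
  matrix_bound p (fun s t => K s t + L s t) (M + N).
Proof.
move=> hK hL F I l k c bl bk wc.
apply: le_trans (lerD (hK F I l k c bl bk wc) (hL F I l k c bl bk wc)).
apply: le_trans _ (le_normcD _ _).
rewrite le_eqVlt; apply/orP; left; apply/eqP; congr normc.
rewrite -big_split/=; apply: eq_bigr => i _; rewrite -mulrDr; congr (_ * _).
rewrite -big_split/=; apply: eq_bigr => s _.
by rewrite -big_split/=; apply: eq_bigr => t _; rewrite mulrDr mulrDl.
Qed.

Lemma matrix_bound0 : matrix_bound p (fun _ _ => 0 : C) 0 (G := G).
Proof.
move=> F I l k c _ _ _; rewrite big1 ?normc0// => i _.
by rewrite big1 ?mulr0// => s _; rewrite big1// => t _; rewrite mulr0 mul0r.
Qed.

Lemma eq_matrix_bound (K L : G -> G -> C) M :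
  matrix_bound p K M -> (forall s t, K s t = L s t) -> matrix_bound p L M.
Proof. by move=> hK KL; rewrite -(_ : K = L)//; apply/funext => s; apply/funext. Qed.

Lemma matrix_bound_le (K : G -> G -> C) M N : M <= N ->
  matrix_bound p K M -> matrix_bound p K N.
Proof. by move=> MN hK F I l k c bl bk wc; apply: le_trans (hK _ _ _ _ _ bl bk wc) MN. Qed.

Lemma matrix_bound_cvg (K : nat -> G -> G -> C) (L : G -> G -> C) M :
  (forall s t, ccvg (fun n => K n s t) (L s t)) ->
  (forall e, 0 < e -> exists N, forall n, (N <= n)%N -> matrix_bound p (K n) (M + e)) ->
  matrix_bound p L M.
Proof.
move=> KL hK F I l k c bl bk wc.
apply: (@ccvg_norm_le _ (fun n => \sum_i c i *
    \sum_(s <- F) \sum_(t <- F) (l i s)^* * K n s t * k i t)).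
  apply: ccvg_sum => i _; apply: ccvgZ; apply: ccvg_sum => s _.
  apply: ccvg_sum => t _; have := ccvgZ ((l i s)^* * k i t) (KL s t).
  by rewrite mulrAC; apply: eq_ccvg => n; rewrite mulrAC.
by move=> e /hK[N hN]; exists N => n /hN; exact.
Qed.

Lemma schatten_norm_le_matrix (W : B) M :
  matrix_bound p (fun s t => W (delta R t) s) M -> (schatten_norm p W <= M%:E)%E.
Proof.
move=> hW; apply: schatten_norm_le => //; first exact: matrix_bound_ge0 hW.
exact: matrix_bound_pairing hW _ _.
Qed.

Lemma eps_norm_le (V : dual_ball R G -> B) M :
  (forall phi, matrix_bound p (fun s t => V phi (delta R t) s) M) ->
  (eps_norm p V <= M%:E)%E.
Proof. by move=> hV; apply: ge_ereal_sup => _ [phi _ <-]; exact: schatten_norm_le_matrix. Qed.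

(** * Entries of slices and their limits *)

Lemma entry_linear_l phi s t (a : C) (S S' S'' : Sp) T :
  S'' = a *: (S : B) + S' :> B ->
  S'' (delta R t) s * phi (twist s t T) =
  a * (S (delta R t) s * phi (twist s t T)) + S' (delta R t) s * phi (twist s t T).
Proof. by move=> ->; rewrite bop_addE l2_addE bop_scaleE l2_scaleE mulrDl mulrA. Qed.

Lemma entry_linear_r phi s t (S : Sp) :
  scalar (fun T : B => S (delta R t) s * phi (twist s t T)).
Proof. by move=> a T T'; rewrite twist_linear linearP mulrDr mulrCA. Qed.

(** A tensor is a function on bilinear forms. Its value at this form is the entry of its slice by
    [phi], hence is independent of any representation. *)
Definition entry_form phi s t : bilform G p :=
  Bilform (entry_linear_l phi s t) (entry_linear_r phi s t).

Definition entry phi s t (u : atens G p) : C := atens_fun u (entry_form phi s t).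

Lemma entryD phi s t u v : entry phi s t (u + v) = entry phi s t u + entry phi s t v.
Proof. by []. Qed.

Lemma entryB phi s t u v : entry phi s t (u - v) = entry phi s t u - entry phi s t v.
Proof. by []. Qed.

Lemma entry_represents phi s t (r : seq (Sp * B)) u : represents r u ->
  entry phi s t u = \sum_(z <- r) (z.1 : B) (delta R t) s * phi (twist s t z.2).
Proof.
move=> ->; elim: r => [|z r IH]; first by rewrite !big_nil.
by rewrite !big_cons entryD IH.
Qed.

(** Every representation yields the bound, term by term through [schur_bound]; the entries do not
    depend on the representation, so the infimum can be taken. *)
Lemma entry_bound phi (u : atens G p) :
  matrix_bound p (fun s t => entry phi s t u) (pi_norm u).
Proof.
have rep r : represents r u -> matrix_bound p (fun s t => entry phi s t u)
    (\sum_(z <- r) fine (schatten_norm p z.1) * opnorm z.2).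
  move=> ru; apply: (eq_matrix_bound (K := fun s t => \sum_(z <- r)
      (z.1 : B) (delta R t) s * phi (twist s t z.2))); last first.
    by move=> s t; rewrite (entry_represents _ _ _ ru).
  elim: r {ru} => [|z r IH].
    rewrite big_nil; apply: (eq_matrix_bound matrix_bound0) => s t.
    by rewrite big_nil.
  rewrite big_cons; apply: (eq_matrix_bound (matrix_boundD (schur_bound z.2 phi
    (rows_bound_schatten p1 (schatten_opP z.1))) IH)) => s t.
  by rewrite big_cons.
move=> F I l k c bl bk wc; apply/ler_addgt0Pr => e e0.
have [_ [r ru <-] hr] := inf_adherent e0 (pi_norm_has_inf u).
exact: le_trans (rep r ru F I l k c bl bk wc) (ltW hr).
Qed.

Lemma ptens_cauchy (U : ptens G p) (e : R) : 0 < e -> exists N, forall m n,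
  (N <= m)%N -> (N <= n)%N -> pi_norm (ptens_seq U m - ptens_seq U n) < e.
Proof. by case: U => u uP; have := uP; rewrite inE; exact. Qed.

Definition limit_entry (U : ptens G p) phi s t : C :=
  xget 0 [set l | ccvg (fun n => entry phi s t (ptens_seq U n)) l].

Lemma limit_entryP U phi s t :
  ccvg (fun n => entry phi s t (ptens_seq U n)) (limit_entry U phi s t).
Proof.
apply: xgetPex; apply: ccauchy_cvg => e e0.
have [N hN] := ptens_cauchy U e0; exists N => m n Nm Nn.
rewrite -entryB; apply: le_trans (ltW (hN _ _ Nm Nn)).
exact: matrix_entry (entry_bound phi _) s t.
Qed.

(** The [limn] in [ptens_norm] is a true limit because the reverse triangle inequality makes the
    sequence of norms Cauchy. *)
Lemma ptens_norm_cvg (U : ptens G p) (e : R) : 0 < e -> exists N, forall n,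
  (N <= n)%N -> pi_norm (ptens_seq U n) <= ptens_norm U + e.
Proof.
move=> e0.
have piB (u v : atens G p) : pi_norm u <= pi_norm v + pi_norm (u - v).
  by rewrite -{1}[u](subrK v) addrC; exact: pi_normD.
have [|l hl] := @real_cauchy_cvg _ (fun n => pi_norm (ptens_seq U n)).
  move=> d /(ptens_cauchy U)[N hN]; exists N => m n Nm Nn.
  have h1 := piB (ptens_seq U m) (ptens_seq U n).
  have h2 := piB (ptens_seq U n) (ptens_seq U m).
  have h3 := hN m n Nm Nn; have h4 := hN n m Nn Nm.
  by rewrite ler_norml; apply/andP; split; lra.
have hlim : pi_norm (ptens_seq U n) @[n --> \oo] --> l.
  apply/cvgrPdist_le => d /hl[N hN]; exists N => // n Nn.
  by rewrite distrC; exact: hN.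
have -> : ptens_norm U = l by exact: cvg_lim hlim.
have [N hN] := hl e e0; exists N => n /hN; rewrite ler_norml => /andP[_].
by rewrite lerBlDl.
Qed.

Lemma limit_entry_bound U phi : matrix_bound p (limit_entry U phi) (ptens_norm U).
Proof.
apply: (matrix_bound_cvg (limit_entryP U phi)) => e /(ptens_norm_cvg U)[N hN].
by exists N => n /hN; move/matrix_bound_le; apply; exact: entry_bound.
Qed.

(** A single [u] serves all [phi], as the supremum in [eps_norm] demands; [entry_bound] is uniform
    in [phi]. *)
Lemma limit_entry_near U (e : R) : 0 < e -> exists u, forall phi,
  matrix_bound p (fun s t => limit_entry U phi s t - entry phi s t u) e.
Proof.
move=> e0; have [N hN] := ptens_cauchy U e0; exists (ptens_seq U N) => phi.
apply: (matrix_bound_cvg (K := fun n s t =>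
    entry phi s t (ptens_seq U n) - entry phi s t (ptens_seq U N))).
  by move=> s t; apply: ccvgD; [exact: limit_entryP|exact: ccvg_cst].
move=> d d0; exists N => n Nn.
have le : pi_norm (ptens_seq U n - ptens_seq U N) <= e + d.
  by apply: le_trans (ltW (hN _ _ Nn (leqnn N))) _; rewrite lerDl ltW.
exact: (eq_matrix_bound (matrix_bound_le le (entry_bound phi _))
  (fun s t => entryB phi s t _ _)).
Qed.

Definition schur_map (U : ptens G p) phi : B :=
  xget 0 [set W : B | forall s t, W (delta R t) s = limit_entry U phi s t].

Lemma schur_mapE U phi s t : schur_map U phi (delta R t) s = limit_entry U phi s t.
Proof.
suff : [set W : B | forall s t, W (delta R t) s = limit_entry U phi s t] (schur_map U phi).
  exact.
apply: xgetPex.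
by have [W hW _] := operator_of_matrix (limit_entry_bound U phi); exists W.
Qed.

(** Operators are determined by their entries, and entries of a combination are limits of
    combinations of entries. *)
Lemma schur_map_linear : linear schur_map.
Proof.
move=> a U V; apply/funext => phi; apply: bop_delta_ext => s t.
rewrite -[(a *: schur_map U + schur_map V) phi]/(a *: schur_map U phi + schur_map V phi).
rewrite bop_addE l2_addE bop_scaleE l2_scaleE !schur_mapE.
apply: (ccvg_unique (limit_entryP _ phi s t)).
exact: ccvgD (ccvgZ a (limit_entryP U phi s t)) (limit_entryP V phi s t).
Qed.

(** * Approximation of the image by algebraic tensors *)

Lemma slice_cat (r r' : seq (Sp * B)) phi : slice (r ++ r') phi = slice r phi + slice r' phi.
Proof. by rewrite /slice big_cat. Qed.

Lemma compress_entry F1 F2 (S : B) s t :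
  compress F1 F2 S (delta R t) s =
  if (s \in F1) && (t \in F2) then S (delta R t) s else 0.
Proof.
rewrite /= fproj_coord; case: ifPn => //= sF.
have -> : fproj F2 (delta R t) = if t \in F2 then delta R t else 0.
  apply: l2P => v; rewrite fproj_coord.
  case: (boolP (t \in F2)) => tF.
    by case: ifPn => // vF /=; case: eqP => // vt; rewrite vt tF in vF.
  by case: ifPn => // vF /=; case: eqP => // vt; rewrite -vt vF in tF.
by case: ifP; rewrite ?bop0.
Qed.

Lemma schatten_compress_fin F1 F2 (S : Sp) :
  (schatten_norm p (compress F1 F2 S) < +oo)%E.
Proof.
have hS := rows_bound_schatten p1 (schatten_opP S).
apply: le_lt_trans (ltry (fine (schatten_norm p S))); apply: schatten_norm_le => //.
  exact: rows_bound_ge0 hS.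
exact: rows_bound_pairing (rows_bound_compress F1 F2 hS).
Qed.

(** The error is the image of [S - compress F F S], to which [schur_bound] applies for all [phi] at
    once; the chosen tensor is the sum of the [p_s S p_t] tensored with twists of [T]. *)
Lemma slice_approx_elem (S : Sp) (T : B) (d : R) : (p < +oo)%E -> 0 < d ->
  exists r : seq (Sp * B), forall phi, matrix_bound p
    (fun s t => S (delta R t) s * phi (twist s t T) - slice r phi (delta R t) s)
    (d * opnorm T).
Proof.
move=> poo d0.
(* Finite [p] enters here: on an infinite group the identity is not a norm limit of its finite
   compressions. *)
have [F hF] : exists F, rows_bound p ((S : B) - compress F F S) d.
  case: (p) p1 poo S => [r| |]// r1 _ S'.
  exact: schatten_compress (schatten_opP S') d0.
exists [seq (Schatten (schatten_compress_fin [fset s]%fset [fset t]%fset S), twist s t T)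
  | s <- F, t <- F] => phi.
apply: (eq_matrix_bound (schur_bound T phi hF)) => s t.
rewrite bop_addE bop_oppE l2_addE l2_oppE mulrBl; congr (_ - _).
rewrite /slice big_allpairs_dep bop_sumE -[RHS]inner_delta inner_sumr.
under eq_bigr do rewrite bop_sumE inner_sumr.
have E s' t' : inner (delta R s) ((phi (twist s' t' T) *:
    compress [fset s']%fset [fset t']%fset S) (delta R t)) =
    if (s' == s) && (t' == t) then S (delta R t) s * phi (twist s t T) else 0.
  rewrite inner_bopZ inner_delta compress_entry !inE [s == s']eq_sym [t == t']eq_sym.
  by case: eqP => [->|]; case: eqP => [->|]; rewrite /= ?mulr0// mulrC.
under eq_bigr do under eq_bigr do rewrite E.
rewrite compress_entry.
have [sF|sF] := boolP (s \in F); last first.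
  rewrite /= mul0r big_seq big1// => s' s'F; rewrite big1// => t' _.
  by case: eqP => // ss; rewrite ss (negbTE sF) in s'F.
rewrite (bigD1_seq s) ?fset_uniq//= [X in _ + X]big1 => [|s' /negbTE ss]; last first.
  by rewrite big1// => t' _; rewrite ss.
rewrite addr0 eqxx /=; have [tF|tF] := boolP (t \in F); last first.
  rewrite mul0r big_seq big1// => t' t'F.
  by case: eqP => // tt; rewrite tt (negbTE tF) in t'F.
rewrite (bigD1_seq t) ?fset_uniq//= [X in _ + X]big1 => [|t' /negbTE ->//].
by rewrite addr0 eqxx.
Qed.

Lemma slice_approx (r0 : seq (Sp * B)) (d : R) : (p < +oo)%E -> 0 < d ->
  exists r : seq (Sp * B), forall phi, matrix_bound p
    (fun s t => \sum_(z <- r0) (z.1 : B) (delta R t) s * phi (twist s t z.2) -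
      slice r phi (delta R t) s)
    (d * \sum_(z <- r0) opnorm z.2).
Proof.
move=> poo d0; elim: r0 => [|z r0 [r IH]].
  exists [::] => phi; rewrite big_nil mulr0; apply: (eq_matrix_bound matrix_bound0) => s t.
  by rewrite /slice !big_nil subr0.
have [rz hz] := slice_approx_elem z.1 z.2 poo d0.
exists (rz ++ r) => phi; rewrite big_cons mulrDr.
apply: (eq_matrix_bound (matrix_boundD (hz phi) (IH phi))) => s t.
by rewrite slice_cat bop_addE l2_addE big_cons opprD addrACA.
Qed.

Lemma schur_map_injective U : (p < +oo)%E -> in_injective p (schur_map U).
Proof.
move=> poo e e0; have e4 : 0 < e / 4 by rewrite divr_gt0.
have [u hu] := limit_entry_near U e4.
have [r0 ru] := representsP u.
(* Scales the error of [slice_approx] down to [e / 4]; the [+ 1] covers a zero sum of norms. Two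
   such errors remain strictly below [e]. *)
pose c := \sum_(z <- r0) opnorm z.2 + 1.
have s0 : 0 <= \sum_(z <- r0) opnorm z.2 by apply: sumr_ge0 => z _; exact: opnorm_ge0.
have c0 : 0 < c by rewrite ltr_wpDl.
have [r hr] := slice_approx r0 poo (divr_gt0 e4 c0).
exists r; apply: (@le_lt_trans _ _ (e / 4 + e / 4)%:E); last first.
  by rewrite lte_fin; lra.
apply: eps_norm_le => phi.
have hd : e / 4 / c * \sum_(z <- r0) opnorm z.2 <= e / 4.
  rewrite -mulrA ler_piMr ?(ltW e4)// mulrC ler_pdivrMr// mul1r lerDl ler01//.
apply: (eq_matrix_bound (matrix_boundD (hu phi) (matrix_bound_le hd (hr phi)))) => s t.
rewrite -[(schur_map U - slice r) phi]/(schur_map U phi - slice r phi).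
by rewrite bop_addE bop_oppE l2_addE l2_oppE schur_mapE (entry_represents _ _ _ ru)
  addrA subrK.
Qed.

End twisted_schur_map.

Theorem lemma3p16 (R : realType) (G : groupType) (hG : countable [set: G])
    (p : \bar R) (hp : (1 <= p)%E) :
  exists w : {linear ptens G p -> (dual_ball R G -> bop R G)},
    [/\ forall (S : schatten G p) (T : bop R G) (phi : dual_ball R G) (s t : G),
          inner (delta R s) (w (ptens_elem S T) phi (delta R t)) =
          inner (delta R s) (S (delta R t)) *
          phi (bop_comp (transl R s) (bop_comp T (transl R (t^-1)%g))),
        (p < +oo)%E -> forall U, in_injective p (w U)
      & forall U, (eps_norm p (w U) <= (ptens_norm U)%:E)%E].
Proof.
pose mixin := GRing.isLinear.Build _ _ _ _ (@schur_map R G p) (schur_map_linear hp).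
pose w : {linear ptens G p -> (dual_ball R G -> bop R G)} :=
  HB.pack (@schur_map R G p) mixin.
exists w; split.
- move=> S T phi s t; rewrite !inner_delta -[w _]/(schur_map _) (schur_mapE hp).
  (* An elementary tensor is presented by a constant sequence, so its entries are their own
     limits. *)
  apply: (ccvg_unique (limit_entryP hp _ phi s t)).
  exact: (ccvg_cst (_ * _)).
- by move=> poo U; exact: schur_map_injective.
- move=> U; apply: (eps_norm_le hp) => phi.
  apply: (eq_matrix_bound (limit_entry_bound hp U phi)) => s t.
  by rewrite -(schur_mapE hp).
Qed.
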